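(* Over $\mathrm{ACA}_0$, Martin's pointed tree theorem $\mathrm{MPT}$ implies $\mathrm{ATR}_0$; that is, $\mathrm{ACA}_0+\mathrm{MPT}\vdash \mathrm{ATR}_0$.
   Context: All theories are in the language of second order arithmetic, with models $(N,M,0,1,+,\times,<)$, where $N$ is the number sort and $M$ is the sort of sets of numbers (equivalently, up to coding, functions from numbers to numbers, called reals). $\mathrm{ACA}_0$ is the usual system including all arithmetical comprehension axioms, and $\mathrm{ATR}_0$ is the usual system of arithmetical transfinite recursion. $\leq_{\rm T}$ denotes Turing reducibility. A tree $T\subseteq\omega^{<\omega}$ is a set of finite strings closed under initial segments; $[T]$ is the collection of its infinite paths. A perfect tree is a nonempty tree in which every node has two incompatible extensions in the tree. A set $A$ of reals is cofinal if for every real $x$ there is some $y\in A$ with $y\geq_{\rm T} x$. A pointed tree $T$ is a perfect tree such that $T\leq_{\rm T} x$ for every infinite path $x\in[T]$. Martin's pointed tree theorem, $\mathrm{MPT}$, is the statement (formulated in second order arithmetic): for every tree $T\subseteq\omega^{<\omega}$, if $[T]$ is cofinal, then $T$ has a pointed subtree. *)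

(* Defs.v *)
From Stdlib Require Import List.
Import ListNotations.

(** * Second order arithmetic: syntax and classical derivability *)

(** Two-sorted de Bruijn syntax: number variables and set variables are
    indexed independently, and each quantifier only shifts its own sort. *)

Inductive term : Type :=
| Var (i : nat)
| Zero
| One
| Plus (s t : term)
| Times (s t : term).

Inductive formula : Type :=
| Fal
| Eq (s t : term)
| Lt (s t : term)
| Mem (t : term) (X : nat)
| Imp (p q : formula)
| AllNum (p : formula)
| AllSet (p : formula).

Fixpoint subst_term (sg : nat -> term) (t : term) : term :=
  match t with
  | Var i => sg i
  | Zero => Zero
  | One => One
  | Plus s t => Plus (subst_term sg s) (subst_term sg t)
  | Times s t => Times (subst_term sg s) (subst_term sg t)
  end.

Definition up (k : nat) (t : term) : term :=
  subst_term (fun i => Var (k + i)) t.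

Definition liftN (sg : nat -> term) (i : nat) : term :=
  match i with 0 => Var 0 | S i => up 1 (sg i) end.

Definition liftS (rho : nat -> nat) (X : nat) : nat :=
  match X with 0 => 0 | S X => S (rho X) end.

Fixpoint subst (sg : nat -> term) (rho : nat -> nat) (p : formula) : formula :=
  match p with
  | Fal => Fal
  | Eq s t => Eq (subst_term sg s) (subst_term sg t)
  | Lt s t => Lt (subst_term sg s) (subst_term sg t)
  | Mem t X => Mem (subst_term sg t) (rho X)
  | Imp p q => Imp (subst sg rho p) (subst sg rho q)
  | AllNum p => AllNum (subst (liftN sg) rho p)
  | AllSet p => AllSet (subst sg (liftS rho) p)
  end.

Definition shiftN (p : formula) : formula :=
  subst (fun i => Var (S i)) (fun X => X) p.

Definition shiftS (p : formula) : formula := subst Var S p.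

Definition instN (t : term) (p : formula) : formula :=
  subst (fun i => match i with 0 => t | S i => Var i end) (fun X => X) p.

Definition instS (Y : nat) (p : formula) : formula :=
  subst Var (fun X => match X with 0 => Y | S X => X end) p.

Definition theory := formula -> Prop.

(** Classical natural deduction.  An axiom with free variables stands for its
    universal closure: [D_AllNumI] and [D_AllSetI] shift the hypotheses [G] but
    not the theory [T], so the free variables of axioms can be generalised. *)
Inductive deriv (T : theory) : list formula -> formula -> Prop :=
| D_Ax G p : T p -> deriv T G p
| D_Hyp G p : In p G -> deriv T G p
| D_ImpI G p q : deriv T (p :: G) q -> deriv T G (Imp p q)
| D_ImpE G p q : deriv T G (Imp p q) -> deriv T G p -> deriv T G q
| D_Raa G p : deriv T (Imp p Fal :: G) Fal -> deriv T G p
| D_AllNumI G p : deriv T (map shiftN G) p -> deriv T G (AllNum p)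
| D_AllNumE G p t : deriv T G (AllNum p) -> deriv T G (instN t p)
| D_AllSetI G p : deriv T (map shiftS G) p -> deriv T G (AllSet p)
| D_AllSetE G p Y : deriv T G (AllSet p) -> deriv T G (instS Y p)
| D_EqRefl G t : deriv T G (Eq t t)
| D_EqSubst G p s t :
    deriv T G (Eq s t) -> deriv T G (instN s p) -> deriv T G (instN t p).

Definition proves (T : theory) (p : formula) : Prop := deriv T [] p.

Definition proves_theory (T U : theory) : Prop :=
  forall p, U p -> proves T p.

Definition add_axiom (T : theory) (a : formula) : theory :=
  fun p => T p \/ p = a.

Definition Neg (p : formula) := Imp p Fal.
Definition And (p q : formula) := Neg (Imp p (Neg q)).
Definition Or (p q : formula) := Imp (Neg p) q.
Definition Iff (p q : formula) := And (Imp p q) (Imp q p).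
Definition ExNum (p : formula) := Neg (AllNum (Neg p)).
Definition ExSet (p : formula) := Neg (AllSet (Neg p)).

Declare Scope fm_scope.
Delimit Scope fm_scope with fm.
Bind Scope fm_scope with formula.
Declare Scope tm_scope.
Delimit Scope tm_scope with tm.
Bind Scope tm_scope with term.

Notation "s + t" := (Plus s t) : tm_scope.
Notation "s * t" := (Times s t) : tm_scope.
Notation "0" := Zero : tm_scope.
Notation "1" := One : tm_scope.
Notation "# i" := (Var i) (at level 1, i at level 0, format "# i") : tm_scope.

Notation "s = t" := (Eq s%tm t%tm) : fm_scope.
Notation "s < t" := (Lt s%tm t%tm) : fm_scope.
Notation "t \in X" := (Mem t%tm X) (at level 70, no associativity) : fm_scope.
Notation "p -> q" := (Imp p q) : fm_scope.
Notation "p <-> q" := (Iff p q) : fm_scope.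
Notation "p /\ q" := (And p q) : fm_scope.
Notation "p \/ q" := (Or p q) : fm_scope.
Notation "~ p" := (Neg p) : fm_scope.

Local Open Scope tm_scope.
Local Open Scope fm_scope.

(** Conventions for the formula macros below: a macro takes terms and set
    indices valid in the context where it is used, so term arguments are lifted
    by [up] under number quantifiers, and set indices by [S] under set
    quantifiers.  A [let] names the variables of a block of quantifiers, the
    innermost one being [#0]. *)

(** * ACA_0 *)

Inductive basic_axiom : theory :=
| B_succ_ne : basic_axiom (AllNum (~ (#0 + 1 = 0)))
| B_succ_inj : basic_axiom (AllNum (AllNum (#1 + 1 = #0 + 1 -> #1 = #0)))
| B_add0 : basic_axiom (AllNum (#0 + 0 = #0))
| B_addS : basic_axiom (AllNum (AllNum (#1 + (#0 + 1) = (#1 + #0) + 1)))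
| B_mul0 : basic_axiom (AllNum (#0 * 0 = 0))
| B_mulS : basic_axiom (AllNum (AllNum (#1 * (#0 + 1) = #1 * #0 + #1)))
| B_lt0 : basic_axiom (AllNum (~ (#0 < 0)))
| B_ltS : basic_axiom (AllNum (AllNum (#1 < #0 + 1 <-> #1 < #0 \/ #1 = #0))).

Definition induction_axiom : formula :=
  AllSet (0 \in 0 /\ AllNum (#0 \in 0 -> #0 + 1 \in 0) -> AllNum (#0 \in 0)).

Fixpoint arithmetical (p : formula) : Prop :=
  match p with
  | Fal | Eq _ _ | Lt _ _ | Mem _ _ => True
  | Imp p q => and (arithmetical p) (arithmetical q)
  | AllNum p => arithmetical p
  | AllSet _ => False
  end.

(** In [p], the number variable 0 is the element; the set being defined does
    not occur in [p] thanks to [shiftS].  All other variables are parameters. *)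
Definition comprehension (p : formula) : formula :=
  ExSet (AllNum (#0 \in 0 <-> shiftS p)).

Inductive ACA0 : theory :=
| ACA0_basic_axiom p : basic_axiom p -> ACA0 p
| ACA0_induction : ACA0 induction_axiom
| ACA0_comprehension p : arithmetical p -> ACA0 (comprehension p).

(** * Coding of pairs and sequences *)

Definition pair (s t : term) : term := (s + t) * (s + t) + s.

(** Goedel's beta function: [v] is the remainder of [a] modulo
    [1 + (i + 1) * b]. *)
Definition Beta (a b i v : term) : formula :=
  v < 1 + (i + 1) * b /\
  ExNum (up 1 a = #0 * (1 + (up 1 i + 1) * up 1 b) + up 1 v).

(** Finite strings are numbers: [0] codes the empty string, and if [s] codes a
    string then [snoc s x] codes the string extended by the entry [x].  Each
    string has exactly one code. *)
Definition snoc (s x : term) : term := pair s x + 1.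

(** [t] is obtained from [s] by finitely many one-entry extensions, the
    intermediate strings being listed by a beta-coded sequence. *)
Definition Extends (s t : term) : formula :=
  ExNum (ExNum (ExNum (let a := #2 in let b := #1 in let n := #0 in
    Beta a b 0 (up 3 s) /\ Beta a b n (up 3 t) /\
    AllNum (let a := #3 in let b := #2 in let n := #1 in let i := #0 in
      i < n ->
      ExNum (ExNum (let a := #5 in let b := #4 in let i := #2 in
        let r := #1 in let x := #0 in
        Beta a b i r /\ Beta a b (i + 1) (snoc r x))))))).

Definition IsString (s : term) : formula := Extends 0 s.

(** * Oracle computability and Turing reducibility *)

Fixpoint num (n : nat) : term :=
  match n with O => Zero | S n => Plus (num n) One end.

(** Kleene indices for the partial recursive functionals; tuples of arguments
    are coded by [pair]. *)
Definition c_zero := pair (num 0) 0.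
Definition c_succ := pair (num 1) 0.
Definition c_id := pair (num 2) 0.
Definition c_fst := pair (num 3) 0.
Definition c_snd := pair (num 4) 0.
Definition c_oracle := pair (num 5) 0.
Definition c_pair (f g : term) := pair (num 6) (pair f g).
Definition c_comp (f g : term) := pair (num 7) (pair f g).
Definition c_prec (f g : term) := pair (num 8) (pair f g).
Definition c_mu (f : term) := pair (num 9) f.

(** The triple [(e, x, y)] codes the assertion [{e}^Y(x) = y].  A computation
    is a beta-coded finite sequence [a, b] of triples, each justified by
    triples at smaller positions. *)
Definition triple (e x y : term) : term := pair e (pair x y).

Definition Earlier (a b i e x y : term) : formula :=
  ExNum (#0 < up 1 i /\ Beta (up 1 a) (up 1 b) #0 (up 1 (triple e x y))).

Definition Justified (Y : nat) (a b i e x y : term) : formula :=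
  (e = c_zero /\ y = 0) \/
  (e = c_succ /\ y = x + 1) \/
  (e = c_id /\ y = x) \/
  (e = c_fst /\ ExNum (up 1 x = pair (up 1 y) #0)) \/
  (e = c_snd /\ ExNum (up 1 x = pair #0 (up 1 y))) \/
  (e = c_oracle /\ ((x \in Y /\ y = 1) \/ (~ x \in Y /\ y = 0))) \/
  (* {c_pair f g}(x) = ({f}(x), {g}(x)) *)
  ExNum (ExNum (let f := #1 in let g := #0 in
    up 2 e = c_pair f g /\
    ExNum (ExNum (let f := #3 in let g := #2 in let u := #1 in let v := #0 in
      let E := Earlier (up 4 a) (up 4 b) (up 4 i) in
      E f (up 4 x) u /\ E g (up 4 x) v /\ up 4 y = pair u v)))) \/
  (* {c_comp f g}(x) = {f}({g}(x)) *)
  ExNum (ExNum (let f := #1 in let g := #0 in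
    up 2 e = c_comp f g /\
    ExNum (let f := #2 in let g := #1 in let u := #0 in
      let E := Earlier (up 3 a) (up 3 b) (up 3 i) in
      E g (up 3 x) u /\ E f u (up 3 y)))) \/
  (* {c_prec f g}(w, 0) = {f}(w) and
     {c_prec f g}(w, k + 1) = {g}(w, (k, {c_prec f g}(w, k))) *)
  ExNum (ExNum (let f := #1 in let g := #0 in
    up 2 e = c_prec f g /\
    (ExNum (let f := #2 in let w := #0 in
       let E := Earlier (up 3 a) (up 3 b) (up 3 i) in
       up 3 x = pair w 0 /\ E f w (up 3 y)) \/
     ExNum (ExNum (ExNum (let g := #3 in
       let w := #2 in let k := #1 in let v := #0 in
       let E := Earlier (up 5 a) (up 5 b) (up 5 i) in
       up 5 x = pair w (k + 1) /\
       E (up 5 e) (pair w k) v /\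
       E g (pair w (pair k v)) (up 5 y))))))) \/
  (* {c_mu f}(x) is the least y with {f}(x, y) = 0, where {f}(x, k) is defined
     and nonzero for every k < y *)
  ExNum (let f := #0 in
    up 1 e = c_mu f /\
    Earlier (up 1 a) (up 1 b) (up 1 i) f (pair (up 1 x) (up 1 y)) 0 /\
    AllNum (let k := #0 in k < up 2 y ->
      ExNum (let f := #2 in let k := #1 in let v := #0 in
        Earlier (up 3 a) (up 3 b) (up 3 i) f (pair (up 3 x) k) (v + 1)))).

(** [{e}^Y(x) = y] *)
Definition Computes (Y : nat) (e x y : term) : formula :=
  ExNum (ExNum (ExNum (let a := #2 in let b := #1 in let n := #0 in
    Beta a b n (triple (up 3 e) (up 3 x) (up 3 y)) /\
    AllNum (let a := #3 in let b := #2 in let n := #1 in let i := #0 in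
      i < n + 1 ->
      ExNum (ExNum (ExNum (let a := #6 in let b := #5 in let i := #3 in
        let e := #2 in let x := #1 in let y := #0 in
        Beta a b i (triple e x y) /\ Justified Y a b i e x y))))))).

(** [X <=_T Y]: some [{e}^Y] is the characteristic function of [X]. *)
Definition TuringLe (X Y : nat) : formula :=
  ExNum (AllNum (let e := #1 in let n := #0 in
    (n \in X -> Computes Y e n 1) /\ (~ n \in X -> Computes Y e n 0))).

(** * Trees and Martin's pointed tree theorem *)

(** [F] is (the graph of) a function from numbers to numbers. *)
Definition IsFunction (F : nat) : formula :=
  AllNum (#0 \in F -> ExNum (ExNum (#2 = pair #1 #0))) /\
  AllNum (ExNum (pair #1 #0 \in F)) /\
  AllNum (AllNum (AllNum (pair #2 #1 \in F -> pair #2 #0 \in F -> #1 = #0))).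

(** [s] is the string [F(0), ..., F(n - 1)]. *)
Definition Restriction (F : nat) (n s : term) : formula :=
  ExNum (ExNum (let a := #1 in let b := #0 in
    Beta a b 0 0 /\ Beta a b (up 2 n) (up 2 s) /\
    AllNum (let a := #2 in let b := #1 in let i := #0 in
      i < up 3 n ->
      ExNum (ExNum (let a := #4 in let b := #3 in let i := #2 in
        let r := #1 in let x := #0 in
        Beta a b i r /\ pair i x \in F /\
        Beta a b (i + 1) (snoc r x)))))).

Definition IsTree (T : nat) : formula :=
  AllNum (#0 \in T ->
    IsString #0 /\ AllNum (Extends #0 #1 -> #0 \in T)).

(** [F] is an infinite path through [T]. *)
Definition IsPath (F T : nat) : formula :=
  IsFunction F /\ AllNum (ExNum (Restriction F #1 #0 /\ #0 \in T)).

Definition IsPerfect (T : nat) : formula :=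
  IsTree T /\ ExNum (#0 \in T) /\
  AllNum (#0 \in T ->
    ExNum (ExNum (let s := #2 in let t := #1 in let u := #0 in
      t \in T /\ u \in T /\ Extends s t /\ Extends s u /\
      ~ Extends t u /\ ~ Extends u t))).

Definition IsPointed (T : nat) : formula :=
  IsPerfect T /\ AllSet (IsPath 0 (S T) -> TuringLe (S T) 0).

(** The set of paths through [T] is cofinal in the Turing degrees. *)
Definition IsCofinal (T : nat) : formula :=
  AllSet (ExSet (IsPath 0 (S (S T)) /\ TuringLe 1 0)).

Definition MPT : formula :=
  AllSet (IsTree 0 /\ IsCofinal 0 ->
    ExSet (AllNum (#0 \in 0 -> #0 \in 1) /\ IsPointed 0)).

(** * ATR_0 *)

(** A relation is a set [X] of pairs with [(i, j) \in X] read as [i <=_X j];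
    its field is the set of [i] with [(i, i) \in X]. *)
Definition Le_in (X : nat) (i j : term) : formula := pair i j \in X.
Definition Lt_in (X : nat) (i j : term) : formula :=
  pair i j \in X /\ ~ pair j i \in X.
Definition InField (X : nat) (i : term) : formula := pair i i \in X.

Definition IsReflexive (X : nat) : formula :=
  AllNum (#0 \in X -> ExNum (ExNum (#2 = pair #1 #0))) /\
  AllNum (AllNum (Le_in X #1 #0 -> InField X #1 /\ InField X #0)).

Definition IsLinearOrder (X : nat) : formula :=
  IsReflexive X /\
  AllNum (AllNum (AllNum (Le_in X #2 #1 /\ Le_in X #1 #0 -> Le_in X #2 #0))) /\
  AllNum (AllNum (Le_in X #1 #0 /\ Le_in X #0 #1 -> #1 = #0)) /\
  AllNum (AllNum (InField X #1 /\ InField X #0 ->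
    Le_in X #1 #0 \/ Le_in X #0 #1)).

(** There is no function [F] with [F(n + 1) <_X F(n)] for all [n]. *)
Definition IsWellFounded (X : nat) : formula :=
  ~ ExSet (IsFunction 0 /\
      AllNum (ExNum (ExNum (let n := #2 in let x := #1 in let y := #0 in
        pair n x \in 0 /\ pair (n + 1) y \in 0 /\ Lt_in (S X) y x)))).

Definition IsWellOrder (X : nat) : formula :=
  IsLinearOrder X /\ IsWellFounded X.

(** [Z] is [Y^j], the set of those [(m, i) \in Y] with [i <_X j]. *)
Definition IsBelow (X Y : nat) (j : term) (Z : nat) : formula :=
  AllNum (#0 \in Z <->
    ExNum (ExNum (let z := #2 in let m := #1 in let i := #0 in
      z = pair m i /\ Lt_in X i (up 3 j) /\ z \in Y))).

(** Arithmetical transfinite recursion for [th(n, Z)], where [n] is number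
    variable 0, [Z] is set variable 0 and all other variables are parameters:
    for every well-order [X] there is [Y] such that
    [Y = { (n, j) | j in the field of X, th(n, Y^j) }].
    In the matrix the set variables 0, 1, 2 are [Z = Y^j], [Y], [X] and the
    number variables 0, 1, 2 are [j], [n], [z], which determines the renaming
    of [th]. *)
Definition transfinite_recursion (th : formula) : formula :=
  let th' := subst
    (fun i => Var (match i with O => 1 | S i => 3 + i end)%nat)
    (fun X => (match X with O => 0 | S X => 3 + X end)%nat) th in
  AllSet (IsWellOrder 0 ->
    ExSet (AllNum (#0 \in 0 <->
      ExNum (ExNum (let z := #2 in let n := #1 in let j := #0 in
        z = pair n j /\ InField 1 j /\
        ExSet (IsBelow 2 1 j 0 /\ th')))))).

Inductive ATR0 : theory :=
| ATR0_ACA0 p : ACA0 p -> ATR0 p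
| ATR0_rec th : arithmetical th -> ATR0 (transfinite_recursion th).

(* Main.v *)
(** By completeness it suffices to prove transfinite recursion in every model of [ACA_0 + MPT].

    The heart of the argument is that if every tree [K i] of an arithmetical family has at most one
    path, then [{i | K i has a path}] is a set. Suppose not, and consider the tree of those [y] that
    carry an arbitrary set [X], an index [i], and the values of a hidden path [g] of [K i], where
    these values are kept on a stack managed by a finite injury construction which ensures the
    following for all [(e, s0)]: if [y] computes a perfect tree by [e], then [y] does not follow the
    bits of the graph of [g] through the splittings of that tree above [s0]. Given [X], some [K i]
    has a path that is not uniformly arithmetical in [X], since otherwise the set would exist; such
    a path can be hidden in some [y] carrying [X], so the tree is cofinal. A pointed subtree, on the
    other hand, decides [i] and hence [g] at one of its nodes [s0], and it has a path which follows
    the bits of the graph of [g] above [s0] and computes the subtree, contradicting the construction.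

    A hierarchy along a well order, with Skolem functions for the formula that is iterated, is the
    unique path of a tree, so all hierarchies can be put together by a single use of this principle. *)

From Stdlib Require Import List Lia Arith ClassicalEpsilon FunctionalExtensionality PropExtensionality Cantor.
Require Import Defs.
Import ListNotations.

(** * Completeness of the calculus *)

(** If a path carried [X], [i] and the hidden function in the clear, no contradiction could arise:
    fixing [i] and [g] and letting [X] vary gives a perfect tree computable from [g], hence from
    each of its paths. The revisable claims on the stack are there to exclude such subtrees. A level
    of the stack meets its requirement by waiting for an answer about some number [k]. When a path
    is built inside the tree, [k] is chosen so that no answer ever comes or a wrong one does. If no
    [k] allows either, the right answers define the graph of the hidden function from [X], the
    family [K] and two numbers. This is the exact sense in which the hidden path must not be
    arithmetical in [X], and it leaves one countable family of sets to avoid. Uniqueness of paths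
    breaks a circle in the other half: the bits that the branch of the pointed subtree has to follow
    are those of the function which this same branch hides. As the index is fixed at the root, any
    branch reveals that function beforehand. *)

Lemma subst_term_comp sg sg' t :
  subst_term sg (subst_term sg' t) = subst_term (fun i => subst_term sg (sg' i)) t.
Proof. induction t; simpl; congruence. Qed.

Lemma subst_term_Var t : subst_term Var t = t.
Proof. induction t; simpl; congruence. Qed.

Lemma liftN_Var : liftN Var = Var.
Proof. extensionality i. destruct i; reflexivity. Qed.

Lemma liftS_id : liftS (fun X => X) = (fun X => X).
Proof. extensionality i. destruct i; reflexivity. Qed.

Lemma liftN_comp sg sg' :
  (fun i => subst_term (liftN sg) (liftN sg' i)) = liftN (fun i => subst_term sg (sg' i)).
Proof.
  extensionality i. destruct i as [|i]; [reflexivity|]. simpl. unfold up.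
  rewrite !subst_term_comp. reflexivity.
Qed.

Lemma liftS_comp rho rho' :
  (fun X => liftS rho (liftS rho' X)) = liftS (fun X => rho (rho' X)).
Proof. extensionality i. destruct i; reflexivity. Qed.

Lemma subst_id p : subst Var (fun X => X) p = p.
Proof.
  induction p; simpl; rewrite ?liftN_Var, ?liftS_id, ?subst_term_Var; congruence.
Qed.

Lemma subst_comp sg rho sg' rho' p :
  subst sg rho (subst sg' rho' p) =
  subst (fun i => subst_term sg (sg' i)) (fun X => rho (rho' X)) p.
Proof.
  revert sg rho sg' rho'.
  induction p; intros; simpl; rewrite ?subst_term_comp; try reflexivity.
  - rewrite IHp1, IHp2. reflexivity.
  - rewrite IHp, liftN_comp. reflexivity.
  - rewrite IHp, liftS_comp. reflexivity.
Qed.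

Lemma subst_shiftN sg rho p :
  subst (liftN sg) rho (shiftN p) = shiftN (subst sg rho p).
Proof. unfold shiftN. rewrite !subst_comp. reflexivity. Qed.

Lemma subst_shiftS sg rho p :
  subst sg (liftS rho) (shiftS p) = shiftS (subst sg rho p).
Proof.
  unfold shiftS. rewrite !subst_comp. f_equal. extensionality i. simpl.
  symmetry. apply subst_term_Var.
Qed.

Lemma subst_instN sg rho t p :
  subst sg rho (instN t p) = instN (subst_term sg t) (subst (liftN sg) rho p).
Proof.
  unfold instN. rewrite !subst_comp. f_equal. extensionality i.
  destruct i as [|i]; simpl; [reflexivity|]. unfold up. rewrite subst_term_comp.
  symmetry. apply subst_term_Var.
Qed.

Lemma subst_instS sg rho Y p :
  subst sg rho (instS Y p) = instS (rho Y) (subst sg (liftS rho) p).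
Proof.
  unfold instS. rewrite !subst_comp. f_equal.
  - extensionality i. symmetry. apply subst_term_Var.
  - extensionality i. destruct i; reflexivity.
Qed.

Lemma instN_up t s : subst_term (fun i => match i with 0 => t | S i => Var i end) (up 1 s) = s.
Proof. unfold up. rewrite subst_term_comp. apply subst_term_Var. Qed.

(** Axioms may contain free variables, and the arguments with fresh variables rename whole
    derivations; the renamed axioms must again be axioms. *)
Definition subst_closed (T : theory) : Prop := forall sg rho p, T p -> T (subst sg rho p).

Lemma deriv_weaken T G p : deriv T G p -> forall G', incl G G' -> deriv T G' p.
Proof.
  induction 1; intros G' HG.
  - apply D_Ax; auto.
  - apply D_Hyp; auto.
  - apply D_ImpI, IHderiv. intros x [->|Hx]; [left|right]; auto.
  - eapply D_ImpE; eauto.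
  - apply D_Raa, IHderiv. intros x [->|Hx]; [left|right]; auto.
  - apply D_AllNumI, IHderiv. apply incl_map; auto.
  - apply D_AllNumE; auto.
  - apply D_AllSetI, IHderiv. apply incl_map; auto.
  - apply D_AllSetE; auto.
  - apply D_EqRefl.
  - eapply D_EqSubst; eauto.
Qed.

Lemma deriv_subst T : subst_closed T -> forall G p, deriv T G p ->
  forall sg rho, deriv T (map (subst sg rho) G) (subst sg rho p).
Proof.
  intros HT G p H. induction H; intros sg rho; simpl in *.
  - apply D_Ax; auto.
  - apply D_Hyp, in_map; auto.
  - apply D_ImpI; auto.
  - eapply D_ImpE; eauto.
  - apply D_Raa; auto.
  - apply D_AllNumI. specialize (IHderiv (liftN sg) rho). rewrite map_map in *.
    erewrite map_ext; [apply IHderiv|]. intros; symmetry; apply subst_shiftN.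
  - rewrite subst_instN. apply D_AllNumE, IHderiv.
  - apply D_AllSetI. specialize (IHderiv sg (liftS rho)). rewrite map_map in *.
    erewrite map_ext; [apply IHderiv|]. intros; symmetry; apply subst_shiftS.
  - rewrite subst_instS. apply D_AllSetE, IHderiv.
  - apply D_EqRefl.
  - rewrite subst_instN in *. eapply D_EqSubst; [apply IHderiv1|].
    rewrite <- subst_instN. apply IHderiv2.
Qed.

(** * Bounds on free variables, and fresh variables *)

Fixpoint boundT (t : term) : nat :=
  match t with
  | Var i => S i
  | Plus s t | Times s t => max (boundT s) (boundT t)
  | _ => 0
  end.

(** Upper bounds, not exact, for the free variables: a quantifier does not lower them. *)
Fixpoint boundN (p : formula) : nat :=
  match p with
  | Fal => 0
  | Eq s t | Lt s t => max (boundT s) (boundT t)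
  | Mem t _ => boundT t
  | Imp p q => max (boundN p) (boundN q)
  | AllNum p | AllSet p => boundN p
  end.

Fixpoint boundS (p : formula) : nat :=
  match p with
  | Mem _ X => S X
  | Imp p q => max (boundS p) (boundS q)
  | AllNum p | AllSet p => boundS p
  | _ => 0
  end.

Lemma subst_term_agree sg sg' t :
  (forall i, i < boundT t -> sg i = sg' i) -> subst_term sg t = subst_term sg' t.
Proof.
  induction t; simpl; intros H; auto;
    f_equal; first [apply IHt1 | apply IHt2]; intros; apply H; lia.
Qed.

Lemma subst_agree p : forall sg sg' rho rho',
  (forall i, i < boundN p -> sg i = sg' i) -> (forall X, X < boundS p -> rho X = rho' X) ->
  subst sg rho p = subst sg' rho' p.
Proof.
  induction p; simpl; intros sg sg' rho rho' HN HS; f_equal;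
    try (apply subst_term_agree; intros; apply HN; lia); try reflexivity.
  - apply HS; lia.
  - apply IHp1; intros; [apply HN|apply HS]; lia.
  - apply IHp2; intros; [apply HN|apply HS]; lia.
  - apply IHp; auto. intros [|i] Hi; simpl; auto. rewrite HN; auto; lia.
  - apply IHp; auto. intros [|X] HX; simpl; auto. rewrite HS; auto; lia.
Qed.

Definition bounds (f : formula -> nat) (G : list formula) : nat := list_max (map f G).

Lemma bounds_in f G p : In p G -> f p <= bounds f G.
Proof.
  intros H. pose proof (proj1 (list_max_le (map f G) (bounds f G)) (le_n _)) as Hf.
  rewrite Forall_forall in Hf. apply Hf, in_map, H.
Qed.

(** The variable [c] occurs in none of the formulas, so the renaming that sends it to 0 and shifts
    all others turns [G] into its shift and the instance of [p] back into [p]; then [D_AllNumI]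
    applies. *)
Lemma deriv_fresh_num T G p c : subst_closed T ->
  (forall q, In q (p :: G) -> boundN q <= c) ->
  deriv T (Neg (instN (Var c) p) :: G) Fal -> deriv T G (AllNum p).
Proof.
  intros HT Hc H.
  apply D_AllNumI, D_Raa.
  apply (deriv_subst T HT) with (sg := fun i => if Nat.eq_dec i c then Var 0 else Var (S i))
    (rho := fun X => X) in H.
  simpl in H. eapply deriv_weaken; [exact H|].
  intros q [<-|Hq].
  - left. unfold Neg. f_equal. unfold instN. rewrite subst_comp.
    transitivity (subst Var (fun X => X) p); [symmetry; apply subst_id|].
    apply subst_agree; auto. intros [|i] Hi; simpl.
    + destruct (Nat.eq_dec c c); congruence.
    + destruct (Nat.eq_dec i c); auto.
      specialize (Hc p (or_introl eq_refl)). lia.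
  - right. apply in_map_iff in Hq. destruct Hq as (q' & <- & Hq').
    apply in_map_iff. exists q'. split; auto. unfold shiftN.
    apply subst_agree; auto. intros i Hi.
    destruct (Nat.eq_dec i c); auto.
    specialize (Hc q' (or_intror Hq')). lia.
Qed.

Lemma deriv_fresh_set T G p c : subst_closed T ->
  (forall q, In q (p :: G) -> boundS q <= c) ->
  deriv T (Neg (instS c p) :: G) Fal -> deriv T G (AllSet p).
Proof.
  intros HT Hc H.
  apply D_AllSetI, D_Raa.
  apply (deriv_subst T HT) with (sg := Var)
    (rho := fun i => if Nat.eq_dec i c then 0 else S i) in H.
  simpl in H. eapply deriv_weaken; [exact H|].
  intros q [<-|Hq].
  - left. unfold Neg. f_equal. unfold instS. rewrite subst_comp.
    transitivity (subst Var (fun X => X) p); [symmetry; apply subst_id|].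
    apply subst_agree; auto. intros [|i] Hi; simpl.
    + destruct (Nat.eq_dec c c); congruence.
    + destruct (Nat.eq_dec i c); auto.
      specialize (Hc p (or_introl eq_refl)). lia.
  - right. apply in_map_iff in Hq. destruct Hq as (q' & <- & Hq').
    apply in_map_iff. exists q'. split; auto. unfold shiftS.
    apply subst_agree; auto. intros i Hi.
    destruct (Nat.eq_dec i c); auto.
    specialize (Hc q' (or_intror Hq')). lia.
Qed.

(** * Structures and satisfaction *)

Record structure := {
  num_sort : Type;
  set_sort : Type;
  s_zero : num_sort;
  s_one : num_sort;
  s_plus : num_sort -> num_sort -> num_sort;
  s_times : num_sort -> num_sort -> num_sort;
  s_lt : num_sort -> num_sort -> Prop;
  s_mem : num_sort -> set_sort -> Prop
}.

Definition scons {A : Type} (a : A) (e : nat -> A) (i : nat) : A :=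
  match i with 0 => a | S i => e i end.

Fixpoint eval (A : structure) (e : nat -> num_sort A) (t : term) : num_sort A :=
  match t with
  | Var i => e i
  | Zero => s_zero A
  | One => s_one A
  | Plus s t => s_plus A (eval A e s) (eval A e t)
  | Times s t => s_times A (eval A e s) (eval A e t)
  end.

Fixpoint sat (A : structure) (e : nat -> num_sort A) (v : nat -> set_sort A) (p : formula) : Prop :=
  match p with
  | Fal => False
  | Eq s t => eval A e s = eval A e t
  | Lt s t => s_lt A (eval A e s) (eval A e t)
  | Mem t X => s_mem A (eval A e t) (v X)
  | Imp p q => sat A e v p -> sat A e v q
  | AllNum p => forall d, sat A (scons d e) v p
  | AllSet p => forall D, sat A e (scons D v) p
  end.

(** * Numbering of formulas *)

Definition enc2 (a b : nat) : nat := to_nat (a, b).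

Lemma enc2_inj a b c d : enc2 a b = enc2 c d -> a = c /\ b = d.
Proof.
  unfold enc2. intros H. apply (f_equal of_nat) in H. rewrite !cancel_of_to in H.
  inversion H; auto.
Qed.

Fixpoint encT (t : term) : nat :=
  match t with
  | Var i => enc2 0 i
  | Zero => enc2 1 0
  | One => enc2 2 0
  | Plus s t => enc2 3 (enc2 (encT s) (encT t))
  | Times s t => enc2 4 (enc2 (encT s) (encT t))
  end.

Fixpoint enc (p : formula) : nat :=
  match p with
  | Fal => enc2 0 0
  | Eq s t => enc2 1 (enc2 (encT s) (encT t))
  | Lt s t => enc2 2 (enc2 (encT s) (encT t))
  | Mem t X => enc2 3 (enc2 (encT t) X)
  | Imp p q => enc2 4 (enc2 (enc p) (enc q))
  | AllNum p => enc2 5 (enc p)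
  | AllSet p => enc2 6 (enc p)
  end.

Lemma encT_inj s : forall t, encT s = encT t -> s = t.
Proof.
  induction s; intros [] H; simpl in H;
    repeat match goal with E : enc2 _ _ = enc2 _ _ |- _ => apply enc2_inj in E; destruct E end;
    try discriminate; f_equal; auto.
Qed.

Lemma enc_inj p : forall q, enc p = enc q -> p = q.
Proof.
  induction p; intros [] H; simpl in H;
    repeat match goal with E : enc2 _ _ = enc2 _ _ |- _ => apply enc2_inj in E; destruct E end;
    try discriminate; f_equal; auto using encT_inj.
Qed.

Definition decode_formula (n : nat) : formula := epsilon (inhabits Fal) (fun p => enc p = n).

Lemma decode_formula_enc p : decode_formula (enc p) = p.
Proof. apply enc_inj, (epsilon_spec (inhabits Fal) (fun q => enc q = enc p)). eauto. Qed.

(** * The Henkin construction *)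

Section Henkin.

Variable T : theory.
Hypothesis HT : subst_closed T.
Variable p0 : formula.
Hypothesis Hp0 : ~ proves T p0.

(** Free variables play the role of Henkin constants. *)
Definition witness (G : list formula) (q : formula) : list formula :=
  match q with
  | Imp (AllNum r) Fal => [Neg (instN (Var (bounds boundN (r :: q :: G))) r)]
  | Imp (AllSet r) Fal => [Neg (instS (bounds boundS (r :: q :: G)) r)]
  | _ => []
  end.

(** Every formula is considered at the stage given by its code. A formula that is rejected has its
    negation derivable already, so the limit is complete. *)
Fixpoint stage (n : nat) : list formula :=
  match n with
  | 0 => [Neg p0]
  | S n =>
    let G := stage n in let q := decode_formula n in
    if excluded_middle_informative (deriv T (q :: G) Fal) then G
    else witness G q ++ q :: G
  end.

(** A contradiction from the added counterexample would, by freshness of its variable, derive the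
    very universal formula that [q] negates. *)
Lemma witness_consistent G q :
  ~ deriv T (q :: G) Fal -> ~ deriv T (witness G q ++ q :: G) Fal.
Proof.
  intros Hc H. assert (Hd := H).
  destruct q as [| | | |q1 q2| |]; try exact (Hc H).
  destruct q1 as [| | | | |r|r]; try exact (Hc H); destruct q2; try exact (Hc H);
    simpl in Hd; apply Hc.
  - apply deriv_fresh_num in Hd; auto.
    + eapply D_ImpE; [apply D_Hyp; left; reflexivity|exact Hd].
    + intros q Hq. apply bounds_in; auto.
  - apply deriv_fresh_set in Hd; auto.
    + eapply D_ImpE; [apply D_Hyp; left; reflexivity|exact Hd].
    + intros q Hq. apply bounds_in; auto.
Qed.

Lemma stage_consistent n : ~ deriv T (stage n) Fal.
Proof.
  induction n; simpl.
  - intros H. apply Hp0. apply D_Raa. exact H.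
  - destruct (excluded_middle_informative _); auto.
    apply witness_consistent; auto.
Qed.

Lemma stage_mono n m : n <= m -> incl (stage n) (stage m).
Proof.
  induction 1; [apply incl_refl|]. eapply incl_tran; [eassumption|]. simpl.
  destruct (excluded_middle_informative _); [apply incl_refl|].
  apply incl_appr, incl_tl, incl_refl.
Qed.

Definition limit (q : formula) : Prop := exists n, deriv T (stage n) q.

Lemma limit_lift q n m : deriv T (stage n) q -> n <= m -> deriv T (stage m) q.
Proof. intros H Hn. eapply deriv_weaken; [exact H|]. apply stage_mono, Hn. Qed.

Lemma limit_proves q : (forall G, deriv T G q) -> limit q.
Proof. exists 0. auto. Qed.

Lemma limit_mp q r : limit (Imp q r) -> limit q -> limit r.
Proof.
  intros (n & Hn) (m & Hm). exists (max n m).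
  eapply D_ImpE; eapply limit_lift; eauto; lia.
Qed.

Lemma limit_consistent : ~ limit Fal.
Proof. intros (n & Hn). exact (stage_consistent n Hn). Qed.

(** A formula derivable at some stage is consistent with every stage, hence was accepted, together
    with its witness, when its turn came. *)
Lemma limit_stage q : limit q -> In q (stage (S (enc q))) /\
  incl (witness (stage (enc q)) q) (stage (S (enc q))).
Proof.
  intros (n & Hn). simpl. rewrite decode_formula_enc.
  destruct (excluded_middle_informative _) as [Hd|].
  - exfalso. apply (stage_consistent (max n (enc q))).
    apply D_ImpE with q.
    + apply D_ImpI. eapply deriv_weaken; [exact Hd|]. intros r [<-|Hr]; [left; auto|].
      right. eapply stage_mono; [|exact Hr]. lia.
    + eapply limit_lift; eauto. lia.
  - split; [apply in_or_app; right; left; auto|apply incl_appl, incl_refl].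
Qed.

Lemma limit_complete q : limit q \/ limit (Neg q).
Proof.
  destruct (classic (deriv T (q :: stage (enc q)) Fal)) as [H|H].
  - right. exists (enc q). apply D_ImpI, H.
  - left. exists (S (enc q)). apply D_Hyp. simpl. rewrite decode_formula_enc.
    destruct (excluded_middle_informative _); [contradiction|].
    apply in_or_app; right; left; auto.
Qed.

Lemma limit_imp q r : limit (Imp q r) <-> (limit q -> limit r).
Proof.
  split; [apply limit_mp|]. intros H.
  destruct (limit_complete q) as [Hq|(n & Hq)].
  - destruct (H Hq) as (n & Hn). exists n. apply D_ImpI.
    eapply deriv_weaken; [exact Hn|]. apply incl_tl, incl_refl.
  - exists n. apply D_ImpI, D_Raa. apply D_ImpE with q.
    + eapply deriv_weaken; [exact Hq|]. apply incl_tl, incl_tl, incl_refl.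
    + apply D_Hyp. right; left; auto.
Qed.

Lemma limit_allnum q : limit (AllNum q) <-> forall t, limit (instN t q).
Proof.
  split.
  - intros (n & Hn) t. exists n. apply D_AllNumE, Hn.
  - intros H. destruct (limit_complete (AllNum q)) as [Hq|Hq]; auto.
    destruct (limit_stage _ Hq) as [_ Hw]. exfalso. apply limit_consistent.
    eapply limit_mp; [|apply H]. eexists. apply D_Hyp, Hw. left. reflexivity.
Qed.

Lemma limit_allset q : limit (AllSet q) <-> forall Y, limit (instS Y q).
Proof.
  split.
  - intros (n & Hn) t. exists n. apply D_AllSetE, Hn.
  - intros H. destruct (limit_complete (AllSet q)) as [Hq|Hq]; auto.
    destruct (limit_stage _ Hq) as [_ Hw]. exfalso. apply limit_consistent.
    eapply limit_mp; [|apply H]. eexists. apply D_Hyp, Hw. left. reflexivity.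
Qed.

Lemma limit_refl t : limit (Eq t t).
Proof. apply limit_proves. intros. apply D_EqRefl. Qed.

Lemma limit_subst q s t : limit (Eq s t) -> limit (instN s q) -> limit (instN t q).
Proof.
  intros (n & Hn) (m & Hm). exists (max n m).
  eapply D_EqSubst; eapply limit_lift; eauto; lia.
Qed.

Lemma limit_sym s t : limit (Eq s t) -> limit (Eq t s).
Proof.
  intros H. pose proof (limit_subst (Eq (Var 0) (up 1 s)) s t H) as K.
  unfold instN in K. simpl in K. rewrite !instN_up in K. apply K, limit_refl.
Qed.

Lemma limit_trans s t u : limit (Eq s t) -> limit (Eq t u) -> limit (Eq s u).
Proof.
  intros H H'. pose proof (limit_subst (Eq (up 1 s) (Var 0)) t u H') as K.
  unfold instN in K. simpl in K. rewrite !instN_up in K. apply K, H.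
Qed.

(** Satisfaction reads [Eq] as equality of Rocq, so terms have to be identified when they are
    provably equal; chosen representatives realize the quotient. *)
Definition rep (t : term) : term := epsilon (inhabits Zero) (fun s => limit (Eq t s)).

Lemma rep_eq t : limit (Eq t (rep t)).
Proof. apply (epsilon_spec (inhabits Zero) (fun s => limit (Eq t s))). exists t. apply limit_refl. Qed.

Lemma rep_compat s t : limit (Eq s t) -> rep s = rep t.
Proof.
  intros H. unfold rep. f_equal. extensionality u. apply propositional_extensionality.
  split; intros K; eapply limit_trans; eauto using limit_sym.
Qed.

Definition classes : Type := {t : term | rep t = t}.

Definition cls (t : term) : classes :=
  exist _ (rep t) (eq_sym (rep_compat _ _ (rep_eq t))).

Lemma cls_eq s t : cls s = cls t <-> limit (Eq s t).
Proof.
  split.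
  - intros H. apply (f_equal (@proj1_sig _ _)) in H. simpl in H.
    eapply limit_trans; [apply rep_eq|]. rewrite H. apply limit_sym, rep_eq.
  - intros H. apply eq_sig_hprop; [intros; apply proof_irrelevance|]. apply rep_compat, H.
Qed.

Lemma cls_surj (x : classes) : x = cls (proj1_sig x).
Proof.
  destruct x as [t Ht]. apply eq_sig_hprop; [intros; apply proof_irrelevance|].
  simpl. congruence.
Qed.

Lemma limit_eq_op (op : term -> term -> term) s s' t t' :
  (forall sg s t, subst_term sg (op s t) = op (subst_term sg s) (subst_term sg t)) ->
  limit (Eq s s') -> limit (Eq t t') -> limit (Eq (op s t) (op s' t')).
Proof.
  intros Hop Hs Ht.
  pose proof (limit_subst (Eq (up 1 (op s t)) (op (Var 0) (up 1 t))) s s' Hs) as K.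
  unfold instN in K. simpl in K. rewrite Hop, !instN_up in K. simpl in K.
  rewrite Hop in K. simpl in K. rewrite !instN_up in K.
  eapply limit_trans; [apply K, limit_refl|]. clear K.
  pose proof (limit_subst (Eq (up 1 (op s' t)) (op (up 1 s') (Var 0))) t t' Ht) as K.
  unfold instN in K. simpl in K. rewrite !Hop in K. simpl in K.
  rewrite !instN_up in K.
  apply K, limit_refl.
Qed.

Lemma limit_lt_compat s s' t t' :
  limit (Eq s s') -> limit (Eq t t') -> limit (Lt s t) -> limit (Lt s' t').
Proof.
  intros Hs Ht H.
  pose proof (limit_subst (Lt (Var 0) (up 1 t)) s s' Hs) as K.
  unfold instN in K. simpl in K. rewrite !instN_up in K.
  pose proof (limit_subst (Lt (up 1 s') (Var 0)) t t' Ht) as K'.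
  unfold instN in K'. simpl in K'. rewrite !instN_up in K'. auto.
Qed.

Lemma limit_mem_compat s s' X : limit (Eq s s') -> limit (Mem s X) -> limit (Mem s' X).
Proof. intros Hs H. exact (limit_subst (Mem (Var 0) X) s s' Hs H). Qed.

(** The language has no equality of sets, so set variables serve as sets without a quotient. *)
Definition term_model : structure := {|
  num_sort := classes;
  set_sort := nat;
  s_zero := cls Zero;
  s_one := cls One;
  s_plus x y := cls (Plus (proj1_sig x) (proj1_sig y));
  s_times x y := cls (Times (proj1_sig x) (proj1_sig y));
  s_lt x y := limit (Lt (proj1_sig x) (proj1_sig y));
  s_mem x X := limit (Mem (proj1_sig x) X)
|}.

Lemma eval_cls sg t : eval term_model (fun i => cls (sg i)) t = cls (subst_term sg t).
Proof.
  induction t; simpl; auto; rewrite IHt1, IHt2; simpl; apply cls_eq;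
    apply limit_eq_op; auto; apply limit_sym, rep_eq.
Qed.

Lemma truth q : forall sg rho,
  sat term_model (fun i => cls (sg i)) rho q <-> limit (subst sg rho q).
Proof.
  induction q; intros sg rho; simpl; rewrite ?eval_cls.
  - split; [tauto|apply limit_consistent].
  - apply cls_eq.
  - simpl. split; apply limit_lt_compat; auto using rep_eq, limit_sym.
  - simpl. split; apply limit_mem_compat; auto using rep_eq, limit_sym.
  - rewrite limit_imp, IHq1, IHq2. tauto.
  - rewrite limit_allnum. 
    assert (E : forall t, sat term_model (scons (cls t) (fun i => cls (sg i))) rho q <->
      limit (instN t (subst (liftN sg) rho q))).
    { intros t. unfold instN. rewrite subst_comp.
      replace (scons (cls t) (fun i => cls (sg i)))
        with (fun i => cls (scons t sg i)) by (extensionality i; destruct i; reflexivity).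
      rewrite IHq. simpl.
      replace (fun i => subst_term _ (liftN sg i)) with (scons t sg); [reflexivity|].
      extensionality i. destruct i as [|i]; [reflexivity|]. simpl.
      rewrite instN_up. reflexivity. }
    split; intros H.
    + intros t. apply E, H.
    + intros d. rewrite (cls_surj d). apply E, H.
  - rewrite limit_allset.
    assert (E : forall Y, sat term_model (fun i => cls (sg i)) (scons Y rho) q <->
      limit (instS Y (subst sg (liftS rho) q))).
    { intros Y. rewrite IHq. unfold instS. rewrite subst_comp.
      replace (subst sg (scons Y rho) q) with (subst (fun i => subst_term Var (sg i))
        (fun X => match liftS rho X with 0 => Y | S X => X end) q); [reflexivity|].
      apply subst_agree; intros i _; [apply subst_term_Var|destruct i; reflexivity]. }
    split; intros H Y; apply E, H.
Qed.

Lemma countermodel :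
  (forall q e v, T q -> sat term_model e v q) /\ exists e v, ~ sat term_model e v p0.
Proof.
  split.
  - intros q e v Hq.
    replace e with (fun i => cls (proj1_sig (e i)))
      by (extensionality i; symmetry; apply cls_surj).
    apply truth. apply limit_proves. intros. apply D_Ax, HT, Hq.
  - exists (fun i => cls (Var i)), (fun X => X). rewrite truth, subst_id.
    intros H. apply limit_consistent. apply limit_mp with p0; auto.
    exists 0. apply D_Hyp. left; auto.
Qed.

End Henkin.

Theorem completeness T p : subst_closed T ->
  (forall A : structure, (forall q e v, T q -> sat A e v q) -> forall e v, sat A e v p) ->
  proves T p.
Proof.
  intros HT H. apply NNPP. intros Hp.
  destruct (countermodel T HT p Hp) as (Hax & e & v & Hn). eauto.
Qed.

(** * Definable predicates in a model of ACA_0 *)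

(** Axioms are evaluated under assignments of sets to set variables, of which there are none if
    there is no set; hence the second field. *)
Class aca_model (A : structure) : Prop := {
  aca_sat : forall q e v, ACA0 q -> sat A e v q;
  aca_inh : inhabited (set_sort A)
}.

Lemma eval_subst A e sg t :
  eval A e (subst_term sg t) = eval A (fun i => eval A e (sg i)) t.
Proof. induction t; simpl; congruence. Qed.

Lemma sat_ext A p : forall e e' v v', (forall i, e i = e' i) -> (forall X, v X = v' X) ->
  sat A e v p <-> sat A e' v' p.
Proof.
  intros e e' v v' He Hv. replace e' with e by (extensionality i; auto).
  replace v' with v by (extensionality i; auto). reflexivity.
Qed.

Lemma forall_iff {X : Type} (P Q : X -> Prop) :
  (forall x, P x <-> Q x) -> (forall x, P x) <-> (forall x, Q x).
Proof. firstorder. Qed.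

Lemma exists_iff {X : Type} (P Q : X -> Prop) :
  (forall x, P x <-> Q x) -> (exists x, P x) <-> (exists x, Q x).
Proof. firstorder. Qed.

Lemma sat_subst A p : forall e v sg rho,
  sat A e v (subst sg rho p) <-> sat A (fun i => eval A e (sg i)) (fun X => v (rho X)) p.
Proof.
  induction p; intros e v sg rho; simpl; rewrite ?eval_subst; try reflexivity.
  - rewrite IHp1, IHp2. reflexivity.
  - apply forall_iff. intros d. rewrite IHp. apply sat_ext; auto.
    intros [|i]; simpl; auto. unfold up. rewrite eval_subst. reflexivity.
  - apply forall_iff. intros d. rewrite IHp. apply sat_ext; auto. intros [|i]; reflexivity.
Qed.

Lemma sat_shiftS A p e v D : sat A e (scons D v) (shiftS p) <-> sat A e v p.
Proof. unfold shiftS. rewrite sat_subst. reflexivity. Qed.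

Section Connectives.
Variables (A : structure) (e : nat -> num_sort A) (v : nat -> set_sort A).

Lemma sat_Neg p : sat A e v (Neg p) <-> ~ sat A e v p.
Proof. reflexivity. Qed.
Lemma sat_Imp p q : sat A e v (Imp p q) <-> (sat A e v p -> sat A e v q).
Proof. reflexivity. Qed.
Lemma sat_And p q : sat A e v (And p q) <-> sat A e v p /\ sat A e v q.
Proof. unfold And, Neg; simpl. split; [|tauto]. intros H. apply NNPP. tauto. Qed.
Lemma sat_Or p q : sat A e v (Or p q) <-> sat A e v p \/ sat A e v q.
Proof. unfold Or, Neg; simpl. split; [|tauto]. intros H. apply NNPP. tauto. Qed.
Lemma sat_Iff p q : sat A e v (Iff p q) <-> (sat A e v p <-> sat A e v q).
Proof. unfold Iff. rewrite sat_And. reflexivity. Qed.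
Lemma sat_AllNum p : sat A e v (AllNum p) <-> forall d, sat A (scons d e) v p.
Proof. reflexivity. Qed.
Lemma sat_AllSet p : sat A e v (AllSet p) <-> forall D, sat A e (scons D v) p.
Proof. reflexivity. Qed.
Lemma sat_ExNum p : sat A e v (ExNum p) <-> exists d, sat A (scons d e) v p.
Proof.
  unfold ExNum, Neg; simpl. split; [|firstorder].
  intros H. apply NNPP. intros K. apply H. intros d Hd. apply K. eauto.
Qed.
Lemma sat_ExSet p : sat A e v (ExSet p) <-> exists D, sat A e (scons D v) p.
Proof.
  unfold ExSet, Neg; simpl. split; [|firstorder].
  intros H. apply NNPP. intros K. apply H. intros d Hd. apply K. eauto.
Qed.
End Connectives.

Section Definability.

Context {A : structure} {HA : aca_model A}.
Local Notation N := (num_sort A).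
Local Notation env := (nat -> N).

Definition Def (P : env -> Prop) : Prop :=
  exists p v, arithmetical p /\ forall e, P e <-> sat A e v p.

Definition TDef (t : env -> N) : Prop := Def (fun e => e 0 = t (fun i => e (S i))).

Lemma Def_ext P Q : Def P -> (forall e, P e <-> Q e) -> Def Q.
Proof. intros (p & v & Hp & H) HPQ. exists p, v. split; auto. intros e. rewrite <- HPQ. auto. Qed.

Lemma arithmetical_subst p : forall sg rho, arithmetical p -> arithmetical (subst sg rho p).
Proof. induction p; simpl; intuition. Qed.

Lemma Def_imp P Q : Def P -> Def Q -> Def (fun e => P e -> Q e).
Proof.
  intros (p & v & Hp & H) (q & w & Hq & K).
  (* The two lists of set parameters are interleaved: even indices belong to [p], odd ones to
     [q]. *)
  exists (Imp (subst Var (fun X => 2 * X) p) (subst Var (fun X => 2 * X + 1) q)).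
  exists (fun X => if Nat.even X then v (Nat.div2 X) else w (Nat.div2 X)).
  split; [split; apply arithmetical_subst; auto|].
  intros e. rewrite H, K, sat_Imp, !sat_subst.
  assert (E : forall e0 : env, (fun i => eval A e0 (Var i)) = e0) by reflexivity.
  rewrite E.
  replace (fun X => if Nat.even (2 * X) then _ else _) with v.
  replace (fun X => if Nat.even (2 * X + 1) then _ else _) with w.
  reflexivity.
  - extensionality X. rewrite Nat.even_add, Nat.even_mul. simpl.
    replace (X + (X + 0) + 1) with (S (2 * X)) by lia. rewrite Nat.div2_succ_double. auto.
  - extensionality X. rewrite Nat.even_mul. simpl orb. cbv iota.
    rewrite Nat.div2_double. auto.
Qed.

Lemma Def_all (P : env -> N -> Prop) :
  Def (fun e => P (fun i => e (S i)) (e 0)) -> Def (fun e => forall x, P e x).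
Proof.
  intros (p & v & Hp & H). exists (AllNum p), v. split; auto.
  intros e. rewrite sat_AllNum. apply forall_iff. intros d. rewrite <- H. reflexivity.
Qed.

Lemma Def_closed (P : Prop) : Def (fun _ => P).
Proof.
  destruct aca_inh as [X].
  destruct (classic P) as [HP|HP].
  - exists (Imp Fal Fal), (fun _ => X). simpl. tauto.
  - exists Fal, (fun _ => X). simpl. tauto.
Qed.

Lemma Def_not P : Def P -> Def (fun e => ~ P e).
Proof. intros H. apply Def_imp; auto. apply Def_closed. Qed.

Lemma Def_and P Q : Def P -> Def Q -> Def (fun e => P e /\ Q e).
Proof.
  intros HP HQ. apply (Def_ext (fun e => ~ (P e -> ~ Q e))).
  - apply Def_not, Def_imp; auto. apply Def_not; auto.
  - intros e. tauto.
Qed.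

Lemma Def_or P Q : Def P -> Def Q -> Def (fun e => P e \/ Q e).
Proof.
  intros HP HQ. apply (Def_ext (fun e => ~ P e -> Q e)).
  - apply Def_imp; auto. apply Def_not; auto.
  - intros e. tauto.
Qed.

Lemma Def_iff P Q : Def P -> Def Q -> Def (fun e => P e <-> Q e).
Proof. intros HP HQ. apply Def_and; apply Def_imp; auto. Qed.

Lemma Def_ex (P : env -> N -> Prop) :
  Def (fun e => P (fun i => e (S i)) (e 0)) -> Def (fun e => exists x, P e x).
Proof.
  intros HP. apply (Def_ext (fun e => ~ forall x, ~ P e x)).
  - apply Def_not. apply (Def_all (fun e x => ~ P e x)), Def_not, HP.
  - intros e. split; [|firstorder]. intros H. apply NNPP. firstorder.
Qed.

Lemma Def_ren f P : Def P -> Def (fun e => P (fun i => e (f i))).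
Proof.
  intros (p & v & Hp & H). exists (subst (fun i => Var (f i)) (fun X => X) p), v.
  split; [apply arithmetical_subst; auto|]. intros e. rewrite sat_subst, H. reflexivity.
Qed.

Lemma Def_atom (p : formula) : arithmetical p -> (forall e v v', sat A e v p <-> sat A e v' p) ->
  forall P : env -> Prop, (forall e v, P e <-> sat A e v p) -> Def P.
Proof. destruct aca_inh as [X]. intros Hp _ P HP. exists p, (fun _ => X). auto. Qed.

Lemma comprehension_axiom (P : N -> Prop) : Def (fun e => P (e 0)) ->
  exists X : set_sort A, forall n, s_mem A n X <-> P n.
Proof.
  intros (p & v & Hp & H).
  assert (K := aca_sat (comprehension p) (fun _ => s_zero A) v (ACA0_comprehension p Hp)).
  unfold comprehension in K. rewrite sat_ExSet in K. destruct K as (X & K).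
  exists X. intros n. specialize (K n). rewrite sat_Iff, sat_shiftS, <- H in K. exact K.
Qed.

Lemma TDef_var i : TDef (fun e => e i).
Proof. eapply (Def_atom (Eq (Var 0) (Var (S i)))); simpl; auto; reflexivity. Qed.

(** The parameters in [Def] are sets, so a number parameter enters through its singleton, which
    comprehension provides. *)
Lemma TDef_const (d : N) : TDef (fun _ => d).
Proof.
  destruct (aca_inh) as [X0].
  assert (K := aca_sat (comprehension (Eq (Var 0) (Var 1))) (fun _ => d) (fun _ => X0)
    (ACA0_comprehension (Eq (Var 0) (Var 1)) I)).
  unfold comprehension in K. rewrite sat_ExSet in K. destruct K as (X & K).
  exists (Mem (Var 0) 0), (fun _ => X). split; [exact I|].
  intros e. specialize (K (e 0)). rewrite sat_Iff in K. simpl in *. tauto.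
Qed.

(** * Definable relations and functions by arity *)

Class Rel1 (R : N -> Prop) : Prop := rel1 : Def (fun e => R (e 0)).
Class Rel2 (R : N -> N -> Prop) : Prop := rel2 : Def (fun e => R (e 0) (e 1)).
Class Rel3 (R : N -> N -> N -> Prop) : Prop := rel3 : Def (fun e => R (e 0) (e 1) (e 2)).
Class Rel4 (R : N -> N -> N -> N -> Prop) : Prop := rel4 : Def (fun e => R (e 0) (e 1) (e 2) (e 3)).
Class Rel5 (R : N -> N -> N -> N -> N -> Prop) : Prop :=
  rel5 : Def (fun e => R (e 0) (e 1) (e 2) (e 3) (e 4)).
Class Fun1 (f : N -> N) : Prop := fun1 : TDef (fun e => f (e 0)).
Class Fun2 (f : N -> N -> N) : Prop := fun2 : TDef (fun e => f (e 0) (e 1)).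
Class Fun3 (f : N -> N -> N -> N) : Prop := fun3 : TDef (fun e => f (e 0) (e 1) (e 2)).

Lemma set_exists P {HP : Rel1 P} : exists X : set_sort A, forall n, s_mem A n X <-> P n.
Proof. exact (comprehension_axiom P HP). Qed.

Lemma Def_let (P : env -> N -> Prop) t : TDef t ->
  Def (fun e => P (fun i => e (S i)) (e 0)) -> Def (fun e => P e (t e)).
Proof.
  intros Ht HP. apply (Def_ext (fun e => exists x, x = t e /\ P e x)).
  - apply (Def_ex (fun e x => x = t e /\ P e x)), Def_and; auto.
  - intros e. split; [intros (x & -> & H); auto|eauto].
Qed.

Lemma TDef_wk t : TDef t -> TDef (fun e => t (fun i => e (S i))).
Proof. intros Ht. apply (Def_ren (fun i => match i with 0 => 0 | S i => S (S i) end) _ Ht). Qed.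

Lemma TDef_wkn k t : TDef t -> TDef (fun e => t (fun i => e (k + i))).
Proof.
  intros Ht. apply (Def_ren (fun i => match i with 0 => 0 | S i => S (k + i) end) _ Ht).
Qed.

Lemma Def_app1 R {HR : Rel1 R} t1 : TDef t1 -> Def (fun e => R (t1 e)).
Proof. intros H1. apply (Def_let (fun _ x => R x)); auto. Qed.

Lemma Def_app2 R {HR : Rel2 R} t1 t2 : TDef t1 -> TDef t2 -> Def (fun e => R (t1 e) (t2 e)).
Proof.
  intros H1 H2. apply (Def_let (fun e x => R (t1 e) x)); auto.
  apply (Def_let (fun e x => R x (e 0)) (fun e => t1 (fun i => e (S i)))); [exact (TDef_wkn 1 _ H1)|].
  exact HR.
Qed.

Lemma Def_app3 R {HR : Rel3 R} t1 t2 t3 : TDef t1 -> TDef t2 -> TDef t3 ->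
  Def (fun e => R (t1 e) (t2 e) (t3 e)).
Proof.
  intros H1 H2 H3. apply (Def_let (fun e x => R (t1 e) (t2 e) x)); auto.
  apply (Def_let (fun e x => R (t1 (fun i => e (S i))) x (e 0)) (fun e => t2 (fun i => e (S i))));
    [exact (TDef_wkn 1 _ H2)|].
  apply (Def_let (fun e x => R x (e 0) (e 1)) (fun e => t1 (fun i => e (S (S i)))));
    [exact (TDef_wkn 2 _ H1)|].
  exact HR.
Qed.

Lemma Def_app4 R {HR : Rel4 R} t1 t2 t3 t4 : TDef t1 -> TDef t2 -> TDef t3 -> TDef t4 ->
  Def (fun e => R (t1 e) (t2 e) (t3 e) (t4 e)).
Proof.
  intros H1 H2 H3 H4. apply (Def_let (fun e x => R (t1 e) (t2 e) (t3 e) x)); auto.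
  apply (Def_let (fun e x => R (t1 (fun i => e (S i))) (t2 (fun i => e (S i))) x (e 0)) (fun e => t3 (fun i => e (S i))));
    [exact (TDef_wkn 1 _ H3)|].
  apply (Def_let (fun e x => R (t1 (fun i => e (S (S i)))) x (e 0) (e 1)) (fun e => t2 (fun i => e (S (S i)))));
    [exact (TDef_wkn 2 _ H2)|].
  apply (Def_let (fun e x => R x (e 0) (e 1) (e 2)) (fun e => t1 (fun i => e (S (S (S i))))));
    [exact (TDef_wkn 3 _ H1)|].
  exact HR.
Qed.

Lemma Def_app5 R {HR : Rel5 R} t1 t2 t3 t4 t5 :
  TDef t1 -> TDef t2 -> TDef t3 -> TDef t4 -> TDef t5 ->
  Def (fun e => R (t1 e) (t2 e) (t3 e) (t4 e) (t5 e)).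
Proof.
  intros H1 H2 H3 H4 H5. apply (Def_let (fun e x => R (t1 e) (t2 e) (t3 e) (t4 e) x)); auto.
  apply (Def_let (fun e x => R (t1 (fun i => e (S i))) (t2 (fun i => e (S i))) (t3 (fun i => e (S i))) x (e 0)) (fun e => t4 (fun i => e (S i))));
    [exact (TDef_wkn 1 _ H4)|].
  apply (Def_let (fun e x => R (t1 (fun i => e (S (S i)))) (t2 (fun i => e (S (S i)))) x (e 0) (e 1)) (fun e => t3 (fun i => e (S (S i)))));
    [exact (TDef_wkn 2 _ H3)|].
  apply (Def_let (fun e x => R (t1 (fun i => e (S (S (S i))))) x (e 0) (e 1) (e 2)) (fun e => t2 (fun i => e (S (S (S i))))));
    [exact (TDef_wkn 3 _ H2)|].
  apply (Def_let (fun e x => R x (e 0) (e 1) (e 2) (e 3)) (fun e => t1 (fun i => e (S (S (S (S i)))))));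
    [exact (TDef_wkn 4 _ H1)|].
  exact HR.
Qed.

Instance Rel2_of_Fun1 f {Hf : Fun1 f} : Rel2 (fun y x => y = f x) := Hf.
Instance Rel3_of_Fun2 f {Hf : Fun2 f} : Rel3 (fun z x y => z = f x y) := Hf.
Instance Rel4_of_Fun3 f {Hf : Fun3 f} : Rel4 (fun w x y z => w = f x y z) := Hf.

Lemma TDef_app1 f {Hf : Fun1 f} t1 : TDef t1 -> TDef (fun e => f (t1 e)).
Proof.
  intros H1. apply (Def_app2 (fun y x => y = f x) (fun e => e 0) (fun e => t1 (fun i => e (S i)))).
  apply TDef_var. apply TDef_wk; auto.
Qed.

Lemma TDef_app2 f {Hf : Fun2 f} t1 t2 : TDef t1 -> TDef t2 -> TDef (fun e => f (t1 e) (t2 e)).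
Proof.
  intros H1 H2. apply (Def_app3 (fun y x1 x2 => y = f x1 x2) (fun e => e 0)
    (fun e => t1 (fun i => e (S i))) (fun e => t2 (fun i => e (S i)))).
  apply TDef_var. all: apply TDef_wk; auto.
Qed.

Lemma TDef_app3 f {Hf : Fun3 f} t1 t2 t3 : TDef t1 -> TDef t2 -> TDef t3 ->
  TDef (fun e => f (t1 e) (t2 e) (t3 e)).
Proof.
  intros H1 H2 H3. apply (Def_app4 (fun y x1 x2 x3 => y = f x1 x2 x3) (fun e => e 0)
    (fun e => t1 (fun i => e (S i))) (fun e => t2 (fun i => e (S i))) (fun e => t3 (fun i => e (S i)))).
  apply TDef_var. all: apply TDef_wk; auto.
Qed.

Global Instance Fun2_plus : Fun2 (s_plus A).
Proof. eapply (Def_atom (Eq (Var 0) (Plus (Var 1) (Var 2)))); simpl; auto; reflexivity. Qed.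
Global Instance Fun2_times : Fun2 (s_times A).
Proof. eapply (Def_atom (Eq (Var 0) (Times (Var 1) (Var 2)))); simpl; auto; reflexivity. Qed.
Global Instance Rel2_eq : Rel2 (fun x y => x = y).
Proof. eapply (Def_atom (Eq (Var 0) (Var 1))); simpl; auto; reflexivity. Qed.
Global Instance Rel2_lt : Rel2 (s_lt A).
Proof. eapply (Def_atom (Lt (Var 0) (Var 1))); simpl; auto; reflexivity. Qed.
Global Instance Rel1_mem X : Rel1 (fun x => s_mem A x X).
Proof. exists (Mem (Var 0) 0), (fun _ => X). simpl. split; [exact I|reflexivity]. Qed.

Lemma Def_eq t1 t2 : TDef t1 -> TDef t2 -> Def (fun e => t1 e = t2 e).
Proof. apply (Def_app2 (fun x y => x = y)). Qed.

Lemma Def_mem X t1 : TDef t1 -> Def (fun e => s_mem A (t1 e) X).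
Proof. apply (Def_app1 (fun x => s_mem A x X)). Qed.

End Definability.

(** Definitions by cases, least witness and, later, recursion are handled by [def_ho],
    which is extended as these are introduced. *)
Ltac def_ho := fail.

Ltac def_step :=
  cbv beta;
  lazymatch goal with
  | |- Def (fun _ => ?P) => apply Def_closed
  | |- Def (fun e => @?P e /\ @?Q e) => apply (Def_and P Q)
  | |- Def (fun e => @?P e \/ @?Q e) => apply (Def_or P Q)
  | |- Def (fun e => @?P e <-> @?Q e) => apply (Def_iff P Q)
  | |- Def (fun e => ~ @?P e) => apply (Def_not P)
  | |- Def (fun e => @?P e -> @?Q e) => apply (Def_imp P Q)
  | |- Def (fun e => forall x, @?P e x) => apply (Def_all P)
  | |- Def (fun e => exists x, @?P e x) => apply (Def_ex P)
  | |- Def (fun e => @?s e = @?t e) => apply (Def_eq s t)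
  | |- Def (fun e => s_mem _ (@?s e) ?X) => apply (Def_mem X s)
  | |- TDef (fun _ => ?d) => apply TDef_const
  | |- TDef (fun e => e ?i) => apply TDef_var
  | |- _ =>
    first
    [ def_ho
    | lazymatch goal with |- Def (fun e => ?R (@?t1 e) (@?t2 e) (@?t3 e) (@?t4 e) (@?t5 e)) =>
        let H := constr:(Def_app5 R) in refine (H t1 t2 t3 t4 t5 _ _ _ _ _) end
    | lazymatch goal with |- Def (fun e => ?R (@?t1 e) (@?t2 e) (@?t3 e) (@?t4 e)) =>
        let H := constr:(Def_app4 R) in refine (H t1 t2 t3 t4 _ _ _ _) end
    | lazymatch goal with |- Def (fun e => ?R (@?t1 e) (@?t2 e) (@?t3 e)) =>
        let H := constr:(Def_app3 R) in refine (H t1 t2 t3 _ _ _) end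
    | lazymatch goal with |- Def (fun e => ?R (@?t1 e) (@?t2 e)) =>
        let H := constr:(Def_app2 R) in refine (H t1 t2 _ _) end
    | lazymatch goal with |- Def (fun e => ?R (@?t1 e)) =>
        let H := constr:(Def_app1 R) in refine (H t1 _) end
    | lazymatch goal with |- TDef (fun e => ?f (@?t1 e) (@?t2 e) (@?t3 e)) =>
        let H := constr:(TDef_app3 f) in refine (H t1 t2 t3 _ _ _) end
    | lazymatch goal with |- TDef (fun e => ?f (@?t1 e) (@?t2 e)) =>
        let H := constr:(TDef_app2 f) in refine (H t1 t2 _ _) end
    | lazymatch goal with |- TDef (fun e => ?f (@?t1 e)) =>
        let H := constr:(TDef_app1 f) in refine (H t1 _) end ]
  end.

Ltac def_start :=
  lazymatch goal with
  | |- Rel1 _ => unfold Rel1 | |- Rel2 _ => unfold Rel2 | |- Rel3 _ => unfold Rel3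
  | |- Rel4 _ => unfold Rel4 | |- Rel5 _ => unfold Rel5
  | |- Fun1 _ => unfold Fun1 | |- Fun2 _ => unfold Fun2 | |- Fun3 _ => unfold Fun3
  | |- _ => idtac
  end.

Ltac def := def_start; repeat (progress (repeat def_step)).

Ltac def_lambda :=
  lazymatch goal with
  | |- Rel1 (fun x => _) => solve [def] | |- Rel2 (fun x => _) => solve [def]
  | |- Rel3 (fun x => _) => solve [def]
  | |- Fun1 (fun x => _) => solve [def] | |- Fun2 (fun x => _) => solve [def]
  | |- Fun3 (fun x => _) => solve [def]
  end.
Global Hint Extern 9 (Rel1 _) => def_lambda : typeclass_instances.
Global Hint Extern 9 (Rel2 _) => def_lambda : typeclass_instances.
Global Hint Extern 9 (Rel3 _) => def_lambda : typeclass_instances.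
Global Hint Extern 9 (Fun1 _) => def_lambda : typeclass_instances.
Global Hint Extern 9 (Fun2 _) => def_lambda : typeclass_instances.
Global Hint Extern 9 (Fun3 _) => def_lambda : typeclass_instances.

Section PartialApplication.
Context {A : structure} {HA : aca_model A}.
Local Notation N := (num_sort A).

Global Instance Fun1_partial (f : N -> N -> N) a {Hf : Fun2 f} : Fun1 (f a) | 5.
Proof. apply (TDef_app2 f (fun _ => a) (fun e => e 0)); def. Qed.
Global Instance Rel1_partial (R : N -> N -> Prop) a {HR : Rel2 R} : Rel1 (R a) | 5.
Proof. apply (Def_app2 R (fun _ => a) (fun e => e 0)); def. Qed.
Global Instance Rel2_partial (R : N -> N -> N -> Prop) a {HR : Rel3 R} : Rel2 (R a) | 5.
Proof. apply (Def_app3 R (fun _ => a) (fun e => e 0) (fun e => e 1)); def. Qed.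
Global Instance Rel3_partial (R : N -> N -> N -> N -> Prop) a {HR : Rel4 R} : Rel3 (R a) | 5.
Proof. apply (Def_app4 R (fun _ => a) (fun e => e 0) (fun e => e 1) (fun e => e 2)); def. Qed.
End PartialApplication.

(** * Arithmetic in the model *)

Declare Scope model_scope.
Delimit Scope model_scope with m.
Notation "x + y" := (s_plus _ x y) : model_scope.
Notation "x * y" := (s_times _ x y) : model_scope.
Notation "x < y" := (s_lt _ x y) : model_scope.
Notation "0" := (s_zero _) : model_scope.
Notation "1" := (s_one _) : model_scope.
Definition le_m {A : structure} (x y : num_sort A) : Prop := exists z, y = s_plus A x z.
Notation "x <= y" := (le_m x y) : model_scope.

Section Arithmetic.

Context {A : structure} {HA : aca_model A}.
Local Notation N := (num_sort A).
Local Open Scope model_scope.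

Lemma sat_basic q : basic_axiom q -> forall e v, sat A e v q.
Proof. intros Hq e v. apply aca_sat. constructor; auto. Qed.

Let e0 : nat -> N := fun _ => 0.

Lemma succ_ne (x : N) : x + 1 <> 0.
Proof. destruct aca_inh as [X]. exact (sat_basic _ B_succ_ne e0 (fun _ => X) x). Qed.
Lemma succ_inj (x y : N) : x + 1 = y + 1 -> x = y.
Proof. destruct aca_inh as [X]. exact (sat_basic _ B_succ_inj e0 (fun _ => X) x y). Qed.
Lemma add_0_r (x : N) : x + 0 = x.
Proof. destruct aca_inh as [X]. exact (sat_basic _ B_add0 e0 (fun _ => X) x). Qed.
Lemma add_S_r (x y : N) : x + (y + 1) = (x + y) + 1.
Proof. destruct aca_inh as [X]. exact (sat_basic _ B_addS e0 (fun _ => X) x y). Qed.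
Lemma mul_0_r (x : N) : x * 0 = 0.
Proof. destruct aca_inh as [X]. exact (sat_basic _ B_mul0 e0 (fun _ => X) x). Qed.
Lemma mul_S_r (x y : N) : x * (y + 1) = x * y + x.
Proof. destruct aca_inh as [X]. exact (sat_basic _ B_mulS e0 (fun _ => X) x y). Qed.
Lemma nlt_0 (x : N) : ~ x < 0.
Proof. destruct aca_inh as [X]. exact (sat_basic _ B_lt0 e0 (fun _ => X) x). Qed.
Lemma lt_succ (x y : N) : x < y + 1 <-> x < y \/ x = y.
Proof.
  destruct aca_inh as [X]. pose proof (sat_basic _ B_ltS e0 (fun _ => X) x y) as H.
  rewrite sat_Iff, sat_Or in H. exact H.
Qed.

(** The model may be nonstandard, and induction is available only for predicates that form a set;
    this is why definability accompanies every notion from here on. *)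
Lemma ind (P : N -> Prop) : Rel1 P -> P 0 -> (forall x, P x -> P (x + 1)) -> forall x, P x.
Proof.
  intros HP H0 HS. destruct (comprehension_axiom P HP) as (X & HX).
  pose proof (aca_sat induction_axiom e0 (fun _ => X) ACA0_induction X) as H.
  rewrite sat_Imp, sat_And in H. simpl in H.
  intros x. apply HX. apply H. split; [apply HX, H0|].
  intros d Hd. apply HX, HS, HX, Hd.
Qed.

Lemma add_0_l (x : N) : 0 + x = x.
Proof.
  revert x. apply (ind (fun x => 0 + x = x)); [def|apply add_0_r|].
  intros x H. rewrite add_S_r, H. reflexivity.
Qed.

Lemma add_S_l (x y : N) : x + 1 + y = x + y + 1.
Proof.
  revert y. apply (ind (fun y => x + 1 + y = x + y + 1)); [def|rewrite !add_0_r; auto|].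
  intros y H. rewrite !add_S_r, H. reflexivity.
Qed.

Lemma add_comm (x y : N) : x + y = y + x.
Proof.
  revert y. apply (ind (fun y => x + y = y + x)); [def|rewrite add_0_r, add_0_l; auto|].
  intros y H. rewrite add_S_r, add_S_l, H. reflexivity.
Qed.

Lemma add_assoc (x y z : N) : x + (y + z) = x + y + z.
Proof.
  revert z. apply (ind (fun z => x + (y + z) = x + y + z)); [def|rewrite !add_0_r; auto|].
  intros z H. rewrite !add_S_r, H. reflexivity.
Qed.

Lemma mul_1_r (x : N) : x * 1 = x.
Proof. rewrite <- (add_0_l 1), mul_S_r, mul_0_r, add_0_l. reflexivity. Qed.

Lemma mul_0_l (x : N) : 0 * x = 0.
Proof.
  revert x. apply (ind (fun x => 0 * x = 0)); [def|apply mul_0_r|].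
  intros x H. rewrite mul_S_r, H, add_0_r. reflexivity.
Qed.

Lemma mul_S_l (x y : N) : (x + 1) * y = x * y + y.
Proof.
  revert y. apply (ind (fun y => (x + 1) * y = x * y + y)); [def|rewrite !mul_0_r, add_0_r; auto|].
  intros y H. rewrite !mul_S_r, H, !add_S_r. f_equal.
  rewrite <- !add_assoc, (add_comm y x). reflexivity.
Qed.

Lemma mul_comm (x y : N) : x * y = y * x.
Proof.
  revert y. apply (ind (fun y => x * y = y * x)); [def|rewrite mul_0_r, mul_0_l; auto|].
  intros y H. rewrite mul_S_r, mul_S_l, H. reflexivity.
Qed.

Lemma mul_add_l (x y z : N) : (x + y) * z = x * z + y * z.
Proof.
  revert z. apply (ind (fun z => (x + y) * z = x * z + y * z)); [def|rewrite !mul_0_r, add_0_r; auto|].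
  intros z H. rewrite !mul_S_r, H, <- !add_assoc. f_equal.
  rewrite !add_assoc. f_equal. apply add_comm.
Qed.

Lemma mul_assoc (x y z : N) : x * (y * z) = x * y * z.
Proof.
  revert x. apply (ind (fun x => x * (y * z) = x * y * z)); [def|rewrite !mul_0_l; auto|].
  intros x H. rewrite !mul_S_l, H, mul_add_l. reflexivity.
Qed.

Lemma model_semiring : semi_ring_theory (s_zero A) (s_one A) (s_plus A) (s_times A) eq.
Proof.
  constructor; intros.
  - apply add_0_l.
  - apply add_comm.
  - apply add_assoc.
  - rewrite mul_comm. apply mul_1_r.
  - apply mul_0_l.
  - apply mul_comm.
  - apply mul_assoc.
  - apply mul_add_l.
Qed.
Add Ring model_ring : model_semiring.

Global Instance Rel2_le : Rel2 (@le_m A).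
Proof. unfold le_m. def. Qed.

Lemma add_cancel_r (x y z : N) : x + z = y + z -> x = y.
Proof.
  revert z. apply (ind (fun z => x + z = y + z -> x = y)); [def|rewrite !add_0_r; auto|].
  intros z H. rewrite !add_S_r. intros K. apply H, succ_inj, K.
Qed.

Lemma zero_or_succ (x : N) : x = 0 \/ exists y, x = y + 1.
Proof. revert x. apply (ind (fun x => x = 0 \/ exists y, x = y + 1)); [def|auto|eauto]. Qed.

Lemma add_eq_0 (x y : N) : x + y = 0 -> x = 0.
Proof.
  destruct (zero_or_succ y) as [->|(z & ->)]; [rewrite add_0_r; auto|].
  rewrite add_S_r. intros H. destruct (succ_ne _ H).
Qed.

Lemma le_refl (x : N) : x <= x.
Proof. exists 0. ring. Qed.
Lemma zero_le (x : N) : 0 <= x.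
Proof. exists x. ring. Qed.
Lemma le_trans (x y z : N) : x <= y -> y <= z -> x <= z.
Proof. intros (a & ->) (b & ->). exists (a + b). ring. Qed.
Lemma le_antisym (x y : N) : x <= y -> y <= x -> x = y.
Proof.
  intros (a & ->) (b & H).
  assert (K : a + b + x = 0 + x) by (transitivity (x + a + b); [ring|rewrite <- H; ring]).
  apply add_cancel_r, add_eq_0 in K. subst. ring.
Qed.

Lemma lt_iff (x y : N) : x < y <-> x + 1 <= y.
Proof.
  revert y. apply (ind (fun y => x < y <-> x + 1 <= y)); [def| |].
  - split; [intros H; destruct (nlt_0 _ H)|]. intros (z & H).
    replace (x + 1 + z) with (x + z + 1) in H by ring. symmetry in H. destruct (succ_ne _ H).
  - intros y IH. rewrite lt_succ, IH. split.
    + intros [(z & ->)| ->]; [exists (z + 1); ring|apply le_refl].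
    + intros (z & H). replace (x + 1 + z) with (x + z + 1) in H by ring. apply succ_inj in H.
      destruct (zero_or_succ z) as [->|(w & ->)]; [right|left; exists w]; rewrite H; ring.
Qed.

(** Reduces a linear inequality to one known inequality and an identity that [ring] proves, with
    slack [w]. *)
Lemma lin (a b u v w : N) : a <= b -> u + b + w = v + a -> u <= v.
Proof.
  intros (z & ->) H. exists (z + w).
  apply (add_cancel_r _ _ a). rewrite <- H. ring.
Qed.

Lemma le_or_lt (x y : N) : x <= y \/ y < x.
Proof.
  rewrite lt_iff. revert y. apply (ind (fun y => x <= y \/ y + 1 <= x)); [def| |].
  - destruct (zero_or_succ x) as [->|(z & ->)]; [left; apply le_refl|right; exists z; ring].
  - intros y [H|(z & ->)]; [left; apply (lin _ _ _ _ 1 H); ring|].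
    destruct (zero_or_succ z) as [->|(w & ->)]; [left; exists 0; ring|right; exists w; ring].
Qed.

Lemma lt_irrefl (x : N) : ~ x < x.
Proof.
  rewrite lt_iff. intros (z & H). apply (succ_ne z). apply (add_cancel_r _ _ x).
  transitivity (x + 1 + z); [ring|rewrite <- H; ring].
Qed.

Lemma le_not_lt (x y : N) : x <= y -> ~ y < x.
Proof.
  rewrite lt_iff. intros H K. apply (lt_irrefl x). apply lt_iff.
  destruct H as (a & ->), K as (b & H). exists (a + b).
  rewrite H at 1. ring.
Qed.

Lemma lt_le (x y : N) : x < y -> x <= y.
Proof. rewrite lt_iff. intros H. apply (lin _ _ _ _ 1 H). ring. Qed.
Lemma lt_le_trans (x y z : N) : x < y -> y <= z -> x < z.
Proof. rewrite !lt_iff. apply le_trans. Qed.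
Lemma le_lt_trans (x y z : N) : x <= y -> y < z -> x < z.
Proof. rewrite !lt_iff. intros (a & ->) (b & ->). exists (a + b). ring. Qed.
Lemma lt_trans (x y z : N) : x < y -> y < z -> x < z.
Proof. intros H K. apply lt_le in H. eapply le_lt_trans; eauto. Qed.
Lemma lt_succ_le (x y : N) : x < y + 1 <-> x <= y.
Proof. rewrite lt_iff. split; intros H; apply (lin _ _ _ _ 0 H); ring. Qed.
Lemma lt_succ_diag (x : N) : x < x + 1.
Proof. apply lt_succ_le, le_refl. Qed.
Lemma le_succ (x : N) : x <= x + 1.
Proof. apply lt_le, lt_succ_diag. Qed.
Lemma le_lt_eq (x y : N) : x <= y -> x < y \/ x = y.
Proof. intros H. apply lt_succ, lt_succ_le, H. Qed.
Lemma zero_lt_succ (x : N) : 0 < x + 1.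
Proof. apply lt_succ_le, zero_le. Qed.
Lemma le_add_r (x y : N) : x <= x + y.
Proof. exists y. reflexivity. Qed.
Lemma le_add_l (x y : N) : x <= y + x.
Proof. exists y. ring. Qed.
Lemma succ_lt (x y : N) : x < y -> x + 1 < y + 1.
Proof. rewrite !lt_iff. intros H. apply (lin _ _ _ _ 0 H). ring. Qed.
Lemma succ_lt_inv (x y : N) : x + 1 < y + 1 -> x < y.
Proof. rewrite !lt_iff. intros H. apply (lin _ _ _ _ 0 H). ring. Qed.

Lemma strong_ind (P : N -> Prop) : Rel1 P ->
  (forall x, (forall y, y < x -> P y) -> P x) -> forall x, P x.
Proof.
  intros HP H. assert (K : forall x y, y < x -> P y).
  { apply (ind (fun x => forall y, y < x -> P y)); [def| |].
    - intros y Hy. destruct (nlt_0 _ Hy).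
    - intros x IH y Hy. apply lt_succ in Hy. destruct Hy as [Hy| ->]; auto. }
  intros x. apply H, K.
Qed.

Lemma least (P : N -> Prop) : Rel1 P -> (exists x, P x) ->
  exists x, P x /\ forall y, y < x -> ~ P y.
Proof.
  intros HP (x & Hx). apply NNPP. intros H.
  assert (K : forall x, ~ P x); [|exact (K _ Hx)].
  apply (strong_ind (fun x => ~ P x)); [def|]. intros y Hy Py. apply H. eauto.
Qed.

(** * Definition by cases and by least witness *)

Definition ite (P : Prop) (a b : N) : N := if excluded_middle_informative P then a else b.

Lemma ite_true P a b : P -> ite P a b = a.
Proof. unfold ite. destruct (excluded_middle_informative P); tauto. Qed.
Lemma ite_false P a b : ~ P -> ite P a b = b.
Proof. unfold ite. destruct (excluded_middle_informative P); tauto. Qed.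

Lemma TDef_ite P a b : Def P -> TDef a -> TDef b -> TDef (fun e => ite (P e) (a e) (b e)).
Proof.
  intros HP Ha Hb. unfold TDef.
  apply (Def_ext (fun e => (P (fun i => e (S i)) /\ e 0%nat = a (fun i => e (S i))) \/
    (~ P (fun i => e (S i)) /\ e 0%nat = b (fun i => e (S i))))).
  - pose proof (Def_ren S _ HP). repeat (assumption || apply Def_or || apply Def_and || apply Def_not).
  - intros e. unfold ite. destruct (excluded_middle_informative _); tauto.
Qed.

(** The least [x] with [P x], and [0] if there is none. *)
Definition mu (P : N -> Prop) : N :=
  epsilon (inhabits 0) (fun x => (P x /\ forall y, y < x -> ~ P y) \/ ((forall y, ~ P y) /\ x = 0)).

Lemma mu_cases P : Rel1 P ->
  (P (mu P) /\ forall y, y < mu P -> ~ P y) \/ ((forall y, ~ P y) /\ mu P = 0).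
Proof.
  intros HP. unfold mu. apply epsilon_spec.
  destruct (classic (exists x, P x)) as [H|H].
  - destruct (least P HP H) as (x & Hx). eauto.
  - exists 0. right. split; auto. intros y Hy. eauto.
Qed.

Lemma mu_spec P : Rel1 P -> (exists x, P x) -> P (mu P).
Proof. intros HP (x & Hx). destruct (mu_cases P HP) as [[H _]|[H _]]; auto. destruct (H x Hx). Qed.

Lemma mu_least P x : Rel1 P -> P x -> mu P <= x.
Proof.
  intros HP Hx. destruct (mu_cases P HP) as [[_ H]|[H _]]; [|destruct (H x Hx)].
  destruct (le_or_lt (mu P) x) as [|K]; auto. destruct (H _ K Hx).
Qed.

Lemma mu_unique P x : Rel1 P -> P x -> (forall y, P y -> y = x) -> mu P = x.
Proof. intros HP Hx H. apply H, mu_spec; eauto. Qed.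

Lemma sat_agree p : forall e e' v, (forall i, (i < boundN p)%nat -> e i = e' i) ->
  sat A e v p <-> sat A e' v p.
Proof.
  intros e e' v H.
  assert (E : subst (fun i => if i <? boundN p then Var i else Zero) (fun X => X) p = p).
  { transitivity (subst Var (fun X => X) p); [|apply subst_id]. apply subst_agree; auto.
    intros i Hi. apply Nat.ltb_lt in Hi. rewrite Hi. reflexivity. }
  rewrite <- E, !sat_subst. apply sat_ext; auto. intros i.
  destruct (Nat.ltb_spec i (boundN p)); simpl; auto.
Qed.

(** A formula has finitely many variables, so it is enough to turn finitely many of them into
    constants, one after the other; the values of the rest have no influence. *)
Lemma Def_inst (Q : (nat -> N) -> Prop) (e1 : nat -> N) : Def Q -> Rel1 (fun x => Q (scons x e1)).
Proof.
  intros HQ.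
  assert (H : forall n, Def (fun e => Q (scons (e 0%nat) (fun j => if j <? n then e1 j else e (S (j - n)))))).
  { induction n.
    - eapply Def_ext; [exact (Def_ren (fun i => i) _ HQ)|]. intros e.
      replace (scons (e 0%nat) _) with e; [reflexivity|].
      extensionality i. destruct i; simpl; auto. rewrite Nat.sub_0_r. auto.
    - pose proof (Def_ren (fun i => match i with 0 => 1 | 1 => 0 | S (S i) => S (S i) end)%nat _ IHn) as H.
      assert (H' := Def_let (fun e x => Q (scons (e 0%nat) (fun j => if j <? n then e1 j
        else scons x (fun i => e (S i)) (j - n)%nat))) _ (TDef_const (e1 n))). cbv beta in H'.
      lapply H'; clear H'; [intros H'|].
      2: { eapply Def_ext; [exact H|]. intros e. cbv beta.
        match goal with |- Q ?f <-> Q ?g => replace g with f; [reflexivity|] end.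
        extensionality i. destruct i as [|i]; auto. simpl. destruct (i <? n); auto.
        destruct (i - n)%nat; auto. }
      clear H. rename H' into H.
      eapply Def_ext; [exact H|]. intros e. cbv beta.
      match goal with |- Q ?f <-> Q ?g => replace g with f; [reflexivity|] end.
      extensionality i. destruct i as [|i]; auto. simpl.
      destruct (Nat.ltb_spec i n), (Nat.ltb_spec i (S n)); try lia; auto.
      + replace (i - n)%nat with 0%nat by lia. simpl. f_equal. lia.
      + replace (i - n)%nat with (S (i - S n)) by lia. reflexivity. }
  pose proof HQ as (p & v & Hp & HP).
  eapply Def_ext; [exact (H (boundN p))|]. intros e. rewrite !HP.
  apply sat_agree. intros [|i] Hi; simpl; auto.
  destruct (Nat.ltb_spec i (boundN p)); auto. lia.
Qed.

Lemma TDef_mu (P : (nat -> N) -> N -> Prop) :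
  Def (fun e => P (fun i => e (S i)) (e 0%nat)) -> TDef (fun e => mu (P e)).
Proof.
  intros HP.
  assert (H1 : forall e, Rel1 (P e)) by (intros e; exact (Def_inst _ e HP)).
  apply (Def_ext (fun e => (P (fun i => e (S i)) (e 0%nat) /\ forall y, y < e 0%nat -> ~ P (fun i => e (S i)) y)
    \/ ((forall y, ~ P (fun i => e (S i)) y) /\ e 0%nat = 0))).
  - assert (K : Def (fun e => P (fun i => e (S (S i))) (e 0%nat))).
    { exact (Def_ren (fun i => match i with 0 => 0 | S i => S (S i) end)%nat _ HP). }
    apply Def_or; apply Def_and; try (apply Def_eq; [apply TDef_var|apply TDef_const]); auto.
    + apply (Def_all (fun e y => y < e 0%nat -> ~ P (fun i => e (S i)) y)).
      apply Def_imp; [def|apply Def_not, K].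
    + apply (Def_all (fun e y => ~ P (fun i => e (S i)) y)), Def_not, K.
  - intros e. specialize (H1 (fun i => e (S i))). pose proof (mu_cases _ H1) as Hm. cbv beta in *.
    set (m := mu (P (fun i : nat => e (S i)))) in *. split.
    + intros H. destruct H as [[Ha Hb]|[Ha Hb]], Hm as [[Hc Hd]|[Hc Hd]]; try (exfalso; eapply Ha; eassumption);
        try (exfalso; eapply Hc; eassumption); try congruence.
      destruct (le_or_lt (e 0%nat) m) as [H|H]; [|destruct (Hb _ H Hc)].
      destruct (le_lt_eq _ _ H) as [K|K]; auto. destruct (Hd _ K Ha).
    + intros E. rewrite E. exact Hm.
Qed.

End Arithmetic.

Ltac def_ho ::=
  lazymatch goal with
  | |- TDef (fun e => ite (@?P e) (@?a e) (@?b e)) => apply (TDef_ite P a b)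
  | |- TDef (fun e => mu (@?P e)) => apply (TDef_mu P)
  end.

(** * Pairs, sequences and recursion in the model *)

Section Sequences.

Context {A : structure} {HA : aca_model A}.
Local Notation N := (num_sort A).
Local Open Scope model_scope.
Add Ring model_ring : (model_semiring (A := A)).

(** This pairing is injective but not onto, which explains the tests of the form
    [n = pr (fs n) (sn n)] further on. *)
Definition pr (x y : N) : N := (x + y) * (x + y) + x.

Global Instance Fun2_pr : Fun2 pr.
Proof. unfold pr. def. Qed.

(** The code [pr x y] lies below the square of [x + y + 1], so a larger sum gives a larger code. *)
Lemma pr_sum_le (x y x' y' : N) : pr x y = pr x' y' -> x' + y' <= x + y.
Proof.
  intros H. destruct (le_or_lt (x' + y') (x + y)) as [|K]; auto. exfalso.
  apply lt_iff in K. destruct K as (z & K). unfold pr in H. rewrite K in H.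
  apply (lt_irrefl (pr x y)). unfold pr. rewrite H at 2. apply lt_iff.
  exists (x + y + y + z * z + x' + (1 + 1) * z * (x + y + 1)). ring.
Qed.

Lemma pr_inj (x y x' y' : N) : pr x y = pr x' y' -> x = x' /\ y = y'.
Proof.
  intros H. assert (E : x + y = x' + y').
  { apply le_antisym; apply pr_sum_le; auto. }
  unfold pr in H. rewrite E in H.
  assert (E' : x = x').
  { apply (add_cancel_r _ _ ((x' + y') * (x' + y'))).
    transitivity ((x' + y') * (x' + y') + x); [ring|rewrite H; ring]. }
  split; auto. subst. apply (add_cancel_r _ _ x'). rewrite (add_comm y), (add_comm y'). exact E.
Qed.

Lemma le_pr_l (x y : N) : x <= pr x y.
Proof. exists ((x + y) * (x + y)). unfold pr. ring. Qed.

Lemma le_pr_r (x y : N) : y <= pr x y.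
Proof.
  unfold pr. destruct (zero_or_succ y) as [->|(z & ->)]; [apply zero_le|].
  exists (x + x * x + x * (z + 1) + x * (z + 1) + z * z + z). ring.
Qed.

Definition fs (z : N) : N := mu (fun x => exists y, z = pr x y).
Definition sn (z : N) : N := mu (fun y => exists x, z = pr x y).

Global Instance Fun1_fs : Fun1 fs.
Proof. unfold fs. def. Qed.
Global Instance Fun1_sn : Fun1 sn.
Proof. unfold sn. def. Qed.

Lemma fs_pr x y : fs (pr x y) = x.
Proof.
  apply mu_unique; [def|eauto|]. intros x' (y' & H). apply pr_inj in H. symmetry; tauto.
Qed.
Lemma sn_pr x y : sn (pr x y) = y.
Proof.
  apply mu_unique; [def|eauto|]. intros x' (y' & H). apply pr_inj in H. symmetry; tauto.
Qed.

Definition beta (a b i v : N) : Prop :=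
  v < 1 + (i + 1) * b /\ exists q, a = q * (1 + (i + 1) * b) + v.

Global Instance Rel4_beta : Rel4 beta.
Proof. unfold beta. def. Qed.

Lemma div_unique (m q q' v v' : N) :
  v < m -> v' < m -> q * m + v = q' * m + v' -> v = v'.
Proof.
  assert (K : forall q z v v', v < m -> q * m + v = (q + z) * m + v' -> v = v').
  { intros k z w w' Hw E.
    assert (E' : w = z * m + w').
    { apply (add_cancel_r _ _ (k * m)). rewrite (add_comm w), E. ring. }
    destruct (zero_or_succ z) as [->|(y & ->)]; [rewrite E'; ring|].
    exfalso. revert Hw. apply le_not_lt. rewrite E'. exists (y * m + w'). ring. }
  intros Hv Hv' E. destruct (le_or_lt q q') as [(z & ->)|H].
  - eapply K; eauto.
  - apply lt_le in H. destruct H as (z & ->). symmetry. eapply K; eauto.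
Qed.

Lemma beta_unique a b i v v' : beta a b i v -> beta a b i v' -> v = v'.
Proof. intros (Hv & q & Hq) (Hv' & q' & Hq'). apply (div_unique _ _ _ _ _ Hv Hv' (eq_trans (eq_sym Hq) Hq')). Qed.

Lemma beta_le a b i v : beta a b i v -> v <= a.
Proof. intros (_ & q & ->). exists (q * (1 + (i + 1) * b)). ring. Qed.

Lemma bounded_values (f : N -> N) {Hf : Fun1 f} n : exists B, forall i, i < n -> f i <= B.
Proof.
  revert n. apply (ind (fun n => exists B, forall i, i < n -> f i <= B)); [def| |].
  - exists 0. intros i Hi. destruct (nlt_0 _ Hi).
  - intros n (B & HB). exists (B + f n). intros i Hi. apply lt_succ in Hi.
    destruct Hi as [Hi| ->]; [|apply le_add_l]. eapply le_trans; [eauto|apply le_add_r].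
Qed.

(** The factorial in disguise: definition by recursion will only be derived from the beta function,
    so the multiple is obtained by an induction on its existence. *)
Lemma common_multiple n : exists c : N, 0 < c /\
  forall d, 0 < d -> d <= n -> exists k, c = d * k.
Proof.
  revert n. apply (ind (fun n => exists c : N, 0 < c /\
    forall d, 0 < d -> d <= n -> exists k, c = d * k)); [def| |].
  - exists 1. split; [rewrite <- (add_0_l 1); apply zero_lt_succ|].
    intros d Hd Hd'. destruct (le_not_lt _ _ Hd' Hd).
  - intros n (c & Hc & H). exists (c * (n + 1)). split.
    + apply lt_iff in Hc. destruct Hc as (z & ->).
      apply lt_iff. exists (n + z + z * n). ring.
    + intros d Hd Hd'. apply le_lt_eq in Hd'. destruct Hd' as [Hd'| ->].
      * apply lt_succ_le in Hd'. destruct (H d Hd Hd') as (k & ->). exists (k * (n + 1)). ring.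
      * exists c. ring.
Qed.

Definition modulus (b i : N) : N := 1 + (i + 1) * b.
Global Instance Fun2_modulus : Fun2 modulus.
Proof. unfold modulus. def. Qed.

(** Coprimality in the form needed for the Chinese remainder theorem: [M] is invertible modulo [m],
    written without subtraction. *)
Definition inv_mod (M m : N) : Prop := exists u k, u * M = 1 + k * m.
Global Instance Rel2_inv_mod : Rel2 inv_mod.
Proof. unfold inv_mod. def. Qed.

Lemma inv_mod_mul M M' m : inv_mod M m -> inv_mod M' m -> inv_mod (M * M') m.
Proof.
  intros (u & k & H) (u' & k' & H'). exists (u * u'), (k + k' + k * k' * m).
  transitivity ((u * M) * (u' * M')); [ring|]. rewrite H, H'. ring.
Qed.

(** The two moduli differ by [d * (d * q)], and [d * q], which [d] divides, is prime to both. *)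
Lemma moduli_coprime (d q i : N) : inv_mod (modulus (d * q) i) (modulus (d * q) (i + d)).
Proof.
  unfold modulus.
  (* The inverse is [1 - (i + 1) * q * (i + d + 1)]; the sign is supplied by
     [(i + d + 1) * (d * q)], which is -1 modulo the second modulus. *)
  exists (1 + (i + 1) * q * (i + d + 1) * ((i + d + 1) * (d * q))),
    ((i + 1) * (d * q) + (i + 1) * q * (i + 1) * (i + d + 1) * (d * q)).
  ring.
Qed.

Lemma beta_exists (f : N -> N) {Hf : Fun1 f} n : exists a b, forall i, i < n -> beta a b i (f i).
Proof.
  destruct (bounded_values f n) as (B & HB). destruct (common_multiple n) as (c & Hc & Hd).
  (* The factor [c] makes the moduli coprime, since differences of indices divide it, and [B + 1]
     makes them exceed all values. *)
  set (b := c * (B + 1)).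
  assert (Hcop : forall i j, i < j -> j < n -> inv_mod (modulus b i) (modulus b j)).
  { intros i j Hij Hj. apply lt_iff in Hij. destruct Hij as (z & ->).
    destruct (Hd (z + 1)) as (k & Hk); [apply zero_lt_succ| |].
    - apply lt_le. eapply le_lt_trans; [|exact Hj]. exists i. ring.
    - unfold b. replace (i + 1 + z) with (i + (z + 1)) by ring. rewrite Hk.
      replace ((z + 1) * k * (B + 1)) with ((z + 1) * (k * (B + 1))) by ring.
      apply moduli_coprime. }
  assert (Hlt : forall i, i < n -> f i < modulus b i).
  { intros i Hi. apply le_lt_trans with B; auto. apply lt_iff.
    apply lt_iff in Hc. destruct Hc as (z & Hz). unfold modulus, b. rewrite Hz.
    exists (1 + z + z * B + i * (0 + 1 + z) * (B + 1)). ring. }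
  assert (H : forall m, m <= n -> exists a M,
    (forall i, i < m -> (exists p q, a + p * modulus b i = f i + q * modulus b i) /\
                        (exists k, M = k * modulus b i)) /\
    (forall j, m <= j -> j < n -> inv_mod M (modulus b j))).
  { apply (ind (fun m => m <= n -> exists a M,
    (forall i, i < m -> (exists p q, a + p * modulus b i = f i + q * modulus b i) /\
                        (exists k, M = k * modulus b i)) /\
    (forall j, m <= j -> j < n -> inv_mod M (modulus b j)))); [def| |].
    - intros _. exists 0, 1. split; [intros i Hi; destruct (nlt_0 _ Hi)|].
      intros j _ _. exists 1, 0. ring.
    - intros m IH Hm. destruct IH as (a & M & H1 & H2).
      { eapply le_trans; [apply le_succ|exact Hm]. }
      assert (Hmn : m < n) by (apply lt_iff; auto).
      destruct (H2 m (le_refl m) Hmn) as (u & k & Huk).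
      (* Chinese remaindering adds [M * u * (f m - a)]. Modulo [modulus b m] the number
         [(m + 1) * b] is -1, so [(m + 1) * b * a] stands for [- a]. *)
      exists (a + M * (u * (f m + (m + 1) * b * a))), (M * modulus b m). split.
      + intros i Hi. apply lt_succ in Hi. destruct Hi as [Hi| ->].
        * destruct (H1 i Hi) as ((p & q & E) & (k' & Ek)). split.
          -- exists p, (q + k' * (u * (f m + (m + 1) * b * a))).
             transitivity ((a + p * modulus b i) + M * (u * (f m + (m + 1) * b * a))); [ring|].
             rewrite E, Ek. ring.
          -- exists (k' * modulus b m). rewrite Ek. ring.
        * split.
          -- exists 0, (a + k * (f m + (m + 1) * b * a)).
             transitivity (a + (u * M) * (f m + (m + 1) * b * a)); [ring|].
             rewrite Huk. unfold modulus. ring.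
          -- exists M. ring.
      + intros j Hj Hjn. apply inv_mod_mul.
        * apply H2; auto. eapply le_trans; [apply le_succ|exact Hj].
        * apply Hcop; auto. apply lt_iff; auto. }
  destruct (H n (le_refl n)) as (a & M & H1 & _). exists a, b. intros i Hi.
  destruct (H1 i Hi) as ((p & q & E) & _). specialize (Hlt i Hi).
  split; [exact Hlt|]. fold (modulus b i).
  destruct (le_or_lt p q) as [(z & ->)|K].
  - exists z. apply (add_cancel_r _ _ (p * modulus b i)). rewrite E. ring.
  - apply lt_iff in K. destruct K as (z & ->). exfalso. revert Hlt. apply le_not_lt.
    exists (a + z * modulus b i). apply (add_cancel_r _ _ (q * modulus b i)).
    rewrite <- E. ring.
Qed.

Definition betaf (a b i : N) : N := mu (beta a b i).
Global Instance Fun3_betaf : Fun3 betaf.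
Proof. unfold betaf. def. Qed.

Lemma betaf_eq a b i v : beta a b i v -> betaf a b i = v.
Proof.
  intros H. apply mu_unique; auto; [def|]. intros y Hy. eapply beta_unique; eauto.
Qed.

(** The reflexive transitive closure of [R] as the model sees it: chains are coded by the beta
    function and may have nonstandard length, which keeps the notion arithmetical. *)
Definition reach (R : N -> N -> Prop) (u v : N) : Prop :=
  exists a b n, beta a b 0 u /\ beta a b n v /\
    forall i, i < n -> exists r r', beta a b i r /\ beta a b (i + 1) r' /\ R r r'.

Lemma Def_reach (R : (nat -> N) -> N -> N -> Prop) u v :
  Def (fun e => R (fun i => e (S (S i))) (e 0%nat) (e 1%nat)) -> TDef u -> TDef v ->
  Def (fun e => reach (R e) (u e) (v e)).
Proof.
  intros HR Hu Hv. unfold reach.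
  apply (Def_ex (fun e a => exists b n, beta a b 0 (u e) /\ beta a b n (v e) /\
    forall i, i < n -> exists r r', beta a b i r /\ beta a b (i + 1) r' /\ R e r r')).
  apply (Def_ex (fun e b => exists n, beta (e 0%nat) b 0 (u (fun i => e (S i))) /\
    beta (e 0%nat) b n (v (fun i => e (S i))) /\ forall i, i < n -> exists r r',
    beta (e 0%nat) b i r /\ beta (e 0%nat) b (i + 1) r' /\ R (fun i => e (S i)) r r')).
  apply (Def_ex (fun e n => beta (e 1%nat) (e 0%nat) 0 (u (fun i => e (S (S i)))) /\
    beta (e 1%nat) (e 0%nat) n (v (fun i => e (S (S i)))) /\ forall i, i < n -> exists r r',
    beta (e 1%nat) (e 0%nat) i r /\ beta (e 1%nat) (e 0%nat) (i + 1) r' /\ R (fun i => e (S (S i))) r r')).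
  pose proof (TDef_wkn 3 _ Hu) as Hu'. pose proof (TDef_wkn 3 _ Hv) as Hv'.
  apply Def_and; [|apply Def_and].
  - apply (Def_app4 beta (fun e => e 2%nat) (fun e => e 1%nat) (fun _ => 0)); auto; def.
  - apply (Def_app4 beta (fun e => e 2%nat) (fun e => e 1%nat) (fun e => e 0%nat)); auto; def.
  - apply (Def_all (fun e i => i < e 0%nat -> exists r r', beta (e 2%nat) (e 1%nat) i r /\
      beta (e 2%nat) (e 1%nat) (i + 1) r' /\ R (fun i => e (S (S (S i)))) r r')).
    apply Def_imp; [def|].
    apply (Def_ex (fun e r => exists r', beta (e 3%nat) (e 2%nat) (e 0%nat) r /\
      beta (e 3%nat) (e 2%nat) (e 0%nat + 1) r' /\ R (fun i => e (S (S (S (S i))))) r r')).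
    apply (Def_ex (fun e r' => beta (e 4%nat) (e 3%nat) (e 1%nat) (e 0%nat) /\
      beta (e 4%nat) (e 3%nat) (e 1%nat + 1) r' /\ R (fun i => e (S (S (S (S (S i)))))) (e 0%nat) r')).
    apply Def_and; [def|apply Def_and; [def|]].
    exact (Def_ren (fun i => match i with 0 => 1 | 1 => 0 | S (S i) => S (S (S (S (S (S i))))) end)%nat _ HR).
Qed.

Section Reach.
Variable R : N -> N -> Prop.
Context {HR : Rel2 R}.

Lemma reach_refl u : reach R u u.
Proof.
  destruct (beta_exists (fun _ => u) 1) as (a & b & H).
  assert (K : beta a b 0 u) by (apply H; rewrite <- (add_0_l 1); apply zero_lt_succ).
  exists a, b, 0. repeat split; try apply K.
  intros i Hi. destruct (nlt_0 _ Hi).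
Qed.

Lemma reach_step u v w : reach R u v -> R v w -> reach R u w.
Proof.
  intros (a & b & n & H0 & Hn & H) Hvw.
  destruct (beta_exists (fun i => ite (i < n + 1) (betaf a b i) w) (n + 1 + 1)) as (a' & b' & H').
  assert (K : forall i r, i < n + 1 -> beta a b i r -> beta a' b' i r).
  { intros i r Hi Hr. specialize (H' i). rewrite ite_true in H' by auto.
    rewrite (betaf_eq _ _ _ _ Hr) in H'. apply H'. eapply lt_trans; [exact Hi|apply lt_succ_diag]. }
  assert (Kn : beta a' b' (n + 1) w).
  { specialize (H' (n + 1) (lt_succ_diag _)). rewrite ite_false in H' by apply lt_irrefl. exact H'. }
  exists a', b', (n + 1). split; [|split].
  - apply K; auto. apply zero_lt_succ.
  - exact Kn.
  - intros i Hi. apply lt_succ in Hi. destruct Hi as [Hi| ->].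
    + destruct (H i Hi) as (r & r' & E1 & E2 & E3). exists r, r'. split; [|split; auto]; apply K; auto.
      * eapply lt_trans; [exact Hi|apply lt_succ_diag].
      * apply succ_lt; auto.
    + exists v, w. split; [|split]; auto. apply K; auto. apply lt_succ_diag.
Qed.

Lemma reach_ind (P : N -> Prop) {HP : Rel1 P} u : P u ->
  (forall r r', reach R u r -> P r -> R r r' -> P r') -> forall v, reach R u v -> P v.
Proof.
  intros H0 HS v (a & b & n & B0 & Bn & H).
  assert (K : forall i, i < n + 1 -> forall r, beta a b i r -> reach R u r /\ P r).
  { apply (ind (fun i => i < n + 1 -> forall r, beta a b i r -> reach R u r /\ P r)).
    - assert (HD : Rel1 (reach R u)).
      { apply (Def_reach (fun _ => R) (fun _ => u) (fun e => e 0%nat)); [exact HR|def|def]. }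
      def.
    - intros _ r Hr. rewrite (beta_unique _ _ _ _ _ Hr B0). split; auto. apply reach_refl.
    - intros i IH Hi r Hr. apply succ_lt_inv in Hi. destruct (H i Hi) as (s & s' & E1 & E2 & E3).
      rewrite (beta_unique _ _ _ _ _ Hr E2).
      destruct (IH (lt_trans _ _ _ Hi (lt_succ_diag n)) s E1). split; eauto using reach_step. }
  exact (proj2 (K n (lt_succ_diag n) v Bn)).
Qed.

Global Instance Rel2_reach : Rel2 (reach R).
Proof.
  apply (Def_reach (fun _ => R) (fun e => e 0%nat) (fun e => e 1%nat)); [exact HR|def|def].
Qed.

Lemma reach_inv u v : reach R u v -> u = v \/ exists w, reach R u w /\ R w v.
Proof.
  apply (reach_ind (fun v => u = v \/ exists w, reach R u w /\ R w v)); [auto|].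
  intros r r' Hr _ H. right. eauto.
Qed.

End Reach.

Lemma reach_mono (R R' : N -> N -> Prop) u v :
  (forall x y, R x y -> R' x y) -> reach R u v -> reach R' u v.
Proof.
  intros HR (a & b & n & H0 & Hn & H). exists a, b, n. split; [auto|split; auto].
  intros i Hi. destruct (H i Hi) as (r & r' & E1 & E2 & E3). eauto 6.
Qed.

Definition rec_step (f : N -> N -> N) (u w : N) : Prop :=
  exists i x, u = pr i x /\ w = pr (i + 1) (f i x).

(** [nrec a f n] is the value at [n] of the function [g] with [g 0 = a] and [g (i + 1) = f i (g i)]. *)
Definition nrec (a : N) (f : N -> N -> N) (n : N) : N :=
  mu (fun v => reach (rec_step f) (pr 0 a) (pr n v)).

Lemma TDef_nrec (a : (nat -> N) -> N) (f : (nat -> N) -> N -> N -> N) n :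
  TDef a -> TDef (fun e => f (fun i => e (S (S i))) (e 0%nat) (e 1%nat)) -> TDef n ->
  TDef (fun e => nrec (a e) (f e) (n e)).
Proof.
  intros Ha Hf Hn. unfold nrec.
  apply (TDef_mu (fun e v => reach (rec_step (f e)) (pr 0 (a e)) (pr (n e) v))).
  apply (Def_reach (fun e => rec_step (f (fun i => e (S i))))
    (fun e => pr 0 (a (fun i => e (S i)))) (fun e => pr (n (fun i => e (S i))) (e 0%nat))).
  - unfold rec_step.
    apply (Def_ex (fun e i => exists x, e 0%nat = pr i x /\
      e 1%nat = pr (i + 1) (f (fun i => e (S (S (S i)))) i x))).
    apply (Def_ex (fun e x => e 1%nat = pr (e 0%nat) x /\
      e 2%nat = pr (e 0%nat + 1) (f (fun i => e (S (S (S (S i))))) (e 0%nat) x))).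
    apply Def_and; [def|].
    apply (Def_eq (fun e => e 3%nat) (fun e => pr (e 1%nat + 1) (f (fun i => e (S (S (S (S (S i)))))) (e 1%nat) (e 0%nat)))); [def|].
    apply (TDef_app2 pr (fun e => e 1%nat + 1) (fun e => (f (fun i => e (S (S (S (S (S i)))))) (e 1%nat) (e 0%nat)))); [def|].
    exact (Def_ren (fun i => match i with 0 => 0 | 1 => 2 | 2 => 1 | S (S (S i)) => S (S (S (S (S (S i))))) end)%nat _ Hf).
  - apply (TDef_app2 pr (fun _ => 0) (fun e => (a (fun i => e (S i))))); [def|apply TDef_wk, Ha].
  - apply (TDef_app2 pr (fun e => n (fun i => e (S i))) (fun e => e 0%nat)); [apply TDef_wk, Hn|def].
Qed.

Section NRec.
Variables (a : N) (f : N -> N -> N).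
Context {Hf : Fun2 f}.

Instance Rel2_rec_step : Rel2 (rec_step f).
Proof. unfold rec_step. def. Qed.

Lemma nrec_unique n v v' : reach (rec_step f) (pr 0 a) (pr n v) ->
  reach (rec_step f) (pr 0 a) (pr n v') -> v = v'.
Proof.
  revert n v v'. apply (ind (fun n => forall v v', reach (rec_step f) (pr 0 a) (pr n v) ->
    reach (rec_step f) (pr 0 a) (pr n v') -> v = v')); [def| |].
  - assert (K : forall v, reach (rec_step f) (pr 0 a) (pr 0 v) -> v = a).
    { intros v Hv. apply reach_inv in Hv; [|exact _]. destruct Hv as [Hv|(w & _ & i & x & _ & Hw)].
      - apply pr_inj in Hv. symmetry; tauto.
      - apply pr_inj in Hw. destruct Hw as [Hw _]. symmetry in Hw. destruct (succ_ne _ Hw). }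
    intros v v' H H'. rewrite (K _ H), (K _ H'). reflexivity.
  - intros n IH.
    assert (K : forall v, reach (rec_step f) (pr 0 a) (pr (n + 1) v) ->
      exists x, reach (rec_step f) (pr 0 a) (pr n x) /\ v = f n x).
    { intros v Hv. apply reach_inv in Hv; [|exact _].
      destruct Hv as [Hv|(w & Hw & i & x & -> & E)]; apply pr_inj in Hv || apply pr_inj in E.
      - destruct Hv as [Hv _]. symmetry in Hv. destruct (succ_ne _ Hv).
      - destruct E as [E1 E2]. apply succ_inj in E1. subst. eauto. }
    intros v v' H H'. destruct (K _ H) as (x & Hx & ->), (K _ H') as (x' & Hx' & ->).
    f_equal. eauto.
Qed.

Lemma nrec_reach n : reach (rec_step f) (pr 0 a) (pr n (nrec a f n)).
Proof.
  apply (mu_spec (fun v => reach (rec_step f) (pr 0 a) (pr n v))); [def|].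
  revert n. apply (ind (fun n => exists v, reach (rec_step f) (pr 0 a) (pr n v))); [def| |].
  - exists a. apply reach_refl.
  - intros n (v & Hv). exists (f n v). eapply reach_step; [exact Hv|]. exists n, v. auto.
Qed.

Lemma nrec_0 : nrec a f 0 = a.
Proof. apply (nrec_unique 0); [apply nrec_reach|apply reach_refl]. Qed.

Lemma nrec_S n : nrec a f (n + 1) = f n (nrec a f n).
Proof.
  apply (nrec_unique (n + 1)); [apply nrec_reach|].
  eapply reach_step; [apply nrec_reach|]. exists n, (nrec a f n). auto.
Qed.

End NRec.

End Sequences.

Ltac def_ho ::=
  lazymatch goal with
  | |- TDef (fun e => ite (@?P e) (@?a e) (@?b e)) => apply (TDef_ite P a b)
  | |- TDef (fun e => mu (@?P e)) => apply (TDef_mu P)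
  | |- Def (fun e => reach (@?R e) (@?u e) (@?v e)) => apply (Def_reach R u v)
  | |- TDef (fun e => nrec (@?a e) (@?f e) (@?n e)) => apply (TDef_nrec a f n)
  end.

(** * Strings in the model *)

Section Strings.

Context {A : structure} {HA : aca_model A}.
Local Notation N := (num_sort A).
Local Open Scope model_scope.
Add Ring model_ring : (model_semiring (A := A)).

Definition sc (s x : N) : N := pr s x + 1.

Global Instance Fun2_sc : Fun2 sc.
Proof. unfold sc. def. Qed.

Lemma sc_inj s x s' x' : sc s x = sc s' x' -> s = s' /\ x = x'.
Proof. intros H. apply succ_inj, pr_inj in H. exact H. Qed.
Lemma sc_ne_0 s x : sc s x <> 0.
Proof. apply succ_ne. Qed.
Lemma lt_sc s x : s < sc s x.
Proof. apply lt_succ_le, le_pr_l. Qed.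

Definition one_step (r r' : N) : Prop := exists x, r' = sc r x.
Global Instance Rel2_one_step : Rel2 one_step.
Proof. unfold one_step. def. Qed.

Definition ext (s t : N) : Prop := reach one_step s t.

Lemma ext_refl s : ext s s.
Proof. apply reach_refl. Qed.
Lemma ext_sc s t x : ext s t -> ext s (sc t x).
Proof. intros H. eapply reach_step; [exact H|]. exists x. auto. Qed.
Lemma ext_one s x : ext s (sc s x).
Proof. apply ext_sc, ext_refl. Qed.

Lemma ext_ind (P : N -> Prop) {HP : Rel1 P} s : P s ->
  (forall t x, ext s t -> P t -> P (sc t x)) -> forall t, ext s t -> P t.
Proof. intros H0 HS. apply (reach_ind one_step); auto. intros r r' Hr Pr (x & ->). auto. Qed.

Lemma ext_inv s t : ext s t -> s = t \/ exists t' x, t = sc t' x /\ ext s t'.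
Proof.
  intros H. apply reach_inv in H; [|exact _]. destruct H as [H|(w & Hw & x & ->)]; auto.
  right. exists w, x. auto.
Qed.

Lemma ext_sc_inv s t x : ext s (sc t x) -> s = sc t x \/ ext s t.
Proof.
  intros H. apply ext_inv in H. destruct H as [H|(t' & x' & E & H)]; auto.
  apply sc_inj in E. destruct E as [-> _]. auto.
Qed.

Lemma ext_0_inv s : ext s 0 -> s = 0.
Proof.
  intros H. apply ext_inv in H. destruct H as [H|(t & x & E & _)]; auto.
  symmetry in E. destruct (sc_ne_0 _ _ E).
Qed.

Lemma ext_trans s t u : ext s t -> ext t u -> ext s u.
Proof.
  intros H. apply (ext_ind (fun u => ext s u)); auto. intros; apply ext_sc; auto.
Qed.

Lemma ext_le s t : ext s t -> s <= t.
Proof.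
  apply (ext_ind (fun t => s <= t)); [apply le_refl|]. intros u x _ H.
  eapply le_trans; [exact H|]. apply lt_le, lt_sc.
Qed.

Lemma ext_antisym s t : ext s t -> ext t s -> s = t.
Proof. intros H K. apply le_antisym; apply ext_le; auto. Qed.

Lemma ext_comparable s t u : ext s u -> ext t u -> ext s t \/ ext t s.
Proof.
  intros H. revert u H. apply (ext_ind (fun u => ext t u -> ext s t \/ ext t s)); [auto|].
  intros u x Hu IH H. apply ext_sc_inv in H. destruct H as [->|H]; auto.
  left. apply ext_sc; auto.
Qed.

Definition str (s : N) : Prop := ext 0 s.
Global Instance Rel1_str : Rel1 str.
Proof. unfold str. def. Qed.

Lemma str_0 : str 0.
Proof. apply ext_refl. Qed.
Lemma str_sc s x : str s -> str (sc s x).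
Proof. apply ext_sc. Qed.
Lemma str_ind (P : N -> Prop) {HP : Rel1 P} : P 0 ->
  (forall s x, str s -> P s -> P (sc s x)) -> forall s, str s -> P s.
Proof. intros H0 HS. apply (ext_ind P); auto. Qed.
Lemma str_ext s t : str s -> ext s t -> str t.
Proof. apply ext_trans. Qed.
Lemma str_prefix s t : ext s t -> str t -> str s.
Proof.
  intros H Ht. destruct (ext_comparable _ _ _ H Ht) as [K|K]; auto.
  apply ext_0_inv in K. subst. apply str_0.
Qed.
Lemma str_cases s : str s -> s = 0 \/ exists s' x, s = sc s' x /\ str s'.
Proof. intros H. apply ext_inv in H. destruct H; auto. Qed.

Definition srec_step (f : N -> N -> N -> N) (u v : N) : Prop :=
  exists s w x, u = pr s w /\ v = pr (sc s x) (f w s x).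

(** Recursion on strings: [srec a f (sc s x) = f (srec a f s) s x]. *)
Definition srec (a : N) (f : N -> N -> N -> N) (s : N) : N :=
  mu (fun v => reach (srec_step f) (pr 0 a) (pr s v)).

Lemma TDef_srec (a : (nat -> N) -> N) (f : (nat -> N) -> N -> N -> N -> N) n :
  TDef a -> TDef (fun e => f (fun i => e (S (S (S i)))) (e 0%nat) (e 1%nat) (e 2%nat)) -> TDef n ->
  TDef (fun e => srec (a e) (f e) (n e)).
Proof.
  intros Ha Hf Hn. unfold srec.
  apply (TDef_mu (fun e v => reach (srec_step (f e)) (pr 0 (a e)) (pr (n e) v))).
  apply (Def_reach (fun e => srec_step (f (fun i => e (S i))))
    (fun e => pr 0 (a (fun i => e (S i)))) (fun e => pr (n (fun i => e (S i))) (e 0%nat))).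
  - unfold srec_step.
    apply (Def_ex (fun e s => exists w x, e 0%nat = pr s w /\
      e 1%nat = pr (sc s x) (f (fun i => e (S (S (S i)))) w s x))).
    apply (Def_ex (fun e w => exists x, e 1%nat = pr (e 0%nat) w /\
      e 2%nat = pr (sc (e 0%nat) x) (f (fun i => e (S (S (S (S i))))) w (e 0%nat) x))).
    apply (Def_ex (fun e x => e 2%nat = pr (e 1%nat) (e 0%nat) /\
      e 3%nat = pr (sc (e 1%nat) x) (f (fun i => e (S (S (S (S (S i)))))) (e 0%nat) (e 1%nat) x))).
    apply Def_and; [def|].
    apply (Def_eq (fun e => e 4%nat) (fun e => pr (sc (e 2%nat) (e 0%nat))
      (f (fun i => e (S (S (S (S (S (S i))))))) (e 1%nat) (e 2%nat) (e 0%nat)))); [def|].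
    apply (TDef_app2 pr (fun e => sc (e 2%nat) (e 0%nat)) (fun e =>
      (f (fun i => e (S (S (S (S (S (S i))))))) (e 1%nat) (e 2%nat) (e 0%nat)))); [def|].
    exact (Def_ren (fun i => match i with 0 => 0 | 1 => 2 | 2 => 3 | 3 => 1
      | S (S (S (S i))) => S (S (S (S (S (S (S i)))))) end)%nat _ Hf).
  - apply (TDef_app2 pr (fun _ => 0) (fun e => (a (fun i => e (S i))))); [def|apply TDef_wk, Ha].
  - apply (TDef_app2 pr (fun e => n (fun i => e (S i))) (fun e => e 0%nat)); [apply TDef_wk, Hn|def].
Qed.

Section SRec.
Variables (a : N) (f : N -> N -> N -> N).
Context {Hf : Fun3 f}.

Instance Rel2_srec_step : Rel2 (srec_step f).
Proof. unfold srec_step. def. Qed.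

Lemma srec_unique s v v' : str s -> reach (srec_step f) (pr 0 a) (pr s v) ->
  reach (srec_step f) (pr 0 a) (pr s v') -> v = v'.
Proof.
  intros Hs. revert s Hs v v'.
  apply (str_ind (fun s => forall v v', reach (srec_step f) (pr 0 a) (pr s v) ->
    reach (srec_step f) (pr 0 a) (pr s v') -> v = v')).
  - assert (K : forall v, reach (srec_step f) (pr 0 a) (pr 0 v) -> v = a).
    { intros v Hv. apply reach_inv in Hv; [|exact _].
      destruct Hv as [Hv|(w & _ & s & y & x & _ & Hw)].
      - apply pr_inj in Hv. symmetry; tauto.
      - apply pr_inj in Hw. destruct Hw as [Hw _]. symmetry in Hw. destruct (sc_ne_0 _ _ Hw). }
    intros v v' H H'. rewrite (K _ H), (K _ H'). reflexivity.
  - intros s x Hs IH.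
    assert (K : forall v, reach (srec_step f) (pr 0 a) (pr (sc s x) v) ->
      exists w, reach (srec_step f) (pr 0 a) (pr s w) /\ v = f w s x).
    { intros v Hv. apply reach_inv in Hv; [|exact _].
      destruct Hv as [Hv|(w & Hw & s' & y & x' & -> & E)]; apply pr_inj in Hv || apply pr_inj in E.
      - destruct Hv as [Hv _]. symmetry in Hv. destruct (sc_ne_0 _ _ Hv).
      - destruct E as [E1 E2]. apply sc_inj in E1. destruct E1. subst. eauto. }
    intros v v' H H'. destruct (K _ H) as (w & Hw & ->), (K _ H') as (w' & Hw' & ->).
    f_equal. eauto.
Qed.

Lemma srec_reach s : str s -> reach (srec_step f) (pr 0 a) (pr s (srec a f s)).
Proof.
  intros Hs. apply (mu_spec (fun v => reach (srec_step f) (pr 0 a) (pr s v))); [def|].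
  revert s Hs. apply (str_ind (fun s => exists v, reach (srec_step f) (pr 0 a) (pr s v))).
  - exists a. apply reach_refl.
  - intros s x _ (v & Hv). exists (f v s x). eapply reach_step; [exact Hv|]. exists s, v, x. auto.
Qed.

Lemma srec_0 : srec a f 0 = a.
Proof. apply (srec_unique 0); [apply str_0|apply srec_reach, str_0|apply reach_refl]. Qed.

Lemma srec_sc s x : str s -> srec a f (sc s x) = f (srec a f s) s x.
Proof.
  intros Hs. apply (srec_unique (sc s x)); [apply str_sc, Hs|apply srec_reach, str_sc, Hs|].
  eapply reach_step; [apply srec_reach, Hs|]. exists s, (srec a f s), x. auto.
Qed.

End SRec.

Definition len (s : N) : N := srec 0 (fun w _ _ => w + 1) s.
Global Instance Fun1_len : Fun1 len.
Proof. apply (TDef_srec (fun _ => 0) (fun _ w _ _ => w + 1) (fun e => e 0%nat)); def. Qed.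

Lemma len_0 : len 0 = 0.
Proof. unfold len. apply srec_0. exact _. Qed.
Lemma len_sc s x : str s -> len (sc s x) = len s + 1.
Proof. intros Hs. unfold len. rewrite srec_sc; auto. exact _. Qed.

Lemma ext_len s t : str s -> ext s t -> len s <= len t.
Proof.
  intros Hs H. enough (str t /\ len s <= len t) by tauto. revert t H.
  apply (ext_ind (fun t => str t /\ len s <= len t)).
  - split; auto. apply le_refl.
  - intros t x _ (Ht & H). split; [apply str_sc; auto|]. rewrite len_sc by auto.
    eapply le_trans; [exact H|apply le_succ].
Qed.

Lemma ext_len_eq s t : str s -> ext s t -> len t <= len s -> s = t.
Proof.
  intros Hs H Hl. destruct (ext_inv _ _ H) as [|(t' & x & -> & H')]; auto. exfalso.
  rewrite len_sc in Hl by (eapply str_ext; eauto).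
  apply (le_not_lt _ _ Hl). apply lt_succ_le, ext_len; auto.
Qed.

Lemma ext_of_len s t u : str u -> ext s u -> ext t u -> len s <= len t -> ext s t.
Proof.
  intros Hu H K Hl. destruct (ext_comparable _ _ _ H K) as [|E]; auto.
  rewrite (ext_len_eq t s); auto; [apply ext_refl|]. eapply str_prefix; [exact K|auto].
Qed.

Lemma same_len s t u : str u -> ext s u -> ext t u -> len s = len t -> s = t.
Proof.
  intros Hu H K Hl. apply ext_antisym; eapply ext_of_len; eauto; rewrite Hl; apply le_refl.
Qed.

Lemma prefix_exists t i : str t -> i <= len t -> exists s, ext s t /\ len s = i.
Proof.
  intros Ht. revert t Ht. apply (str_ind (fun t => i <= len t -> exists s, ext s t /\ len s = i)).
  - rewrite len_0. intros H. exists 0. split; [apply ext_refl|]. rewrite len_0.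
    apply le_antisym; auto. apply zero_le.
  - intros s x Hs IH. rewrite len_sc by auto. intros H. apply le_lt_eq in H.
    destruct H as [H| ->].
    + destruct IH as (r & Hr & E); [apply lt_succ_le; auto|]. exists r. split; auto.
      apply ext_sc; auto.
    + exists (sc s x). split; [apply ext_refl|apply len_sc; auto].
Qed.

Definition pre (s i : N) : N := mu (fun r => ext r s /\ len r = i).
Global Instance Fun2_pre : Fun2 pre.
Proof. unfold pre. def. Qed.

Lemma pre_spec s i : str s -> i <= len s -> ext (pre s i) s /\ len (pre s i) = i.
Proof. intros Hs Hi. apply (mu_spec (fun r => ext r s /\ len r = i)); [exact _|]. apply prefix_exists; auto. Qed.

Lemma pre_unique s r : str s -> ext r s -> pre s (len r) = r.
Proof.
  intros Hs H. apply mu_unique; [exact _|auto|]. intros y (Hy & E).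
  apply (same_len _ _ s); auto.
Qed.

Lemma str_pre s i : str s -> i <= len s -> str (pre s i).
Proof. intros Hs Hi. eapply str_prefix; [apply pre_spec; auto|auto]. Qed.

Definition nth (s i : N) : N := mu (fun x => exists r, len r = i /\ ext (sc r x) s).
Global Instance Fun2_nth : Fun2 nth.
Proof. unfold nth. def. Qed.

Lemma nth_eq s r x : str s -> ext (sc r x) s -> nth s (len r) = x.
Proof.
  intros Hs H. apply mu_unique; [exact _|eauto|]. intros y (r' & E & H').
  enough (K : sc r' y = sc r x) by (apply sc_inj in K; tauto).
  assert (Hr : str r) by (eapply str_prefix; [|exact (str_prefix _ _ H Hs)]; apply ext_one).
  assert (Hr' : str r') by (eapply str_prefix; [|exact (str_prefix _ _ H' Hs)]; apply ext_one).
  apply (same_len _ _ s); auto. rewrite !len_sc by auto. congruence.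
Qed.

Lemma nth_last s x : str s -> nth (sc s x) (len s) = x.
Proof. intros Hs. apply nth_eq; [apply str_sc; auto|apply ext_refl]. Qed.

Lemma prefix_sc_exists t i : str t -> i < len t -> exists s x, ext (sc s x) t /\ len s = i.
Proof.
  intros Ht Hi. apply lt_iff in Hi. destruct (prefix_exists t (i + 1) Ht Hi) as (s & Hs & E).
  assert (Ss := str_prefix _ _ Hs Ht).
  destruct (str_cases s Ss) as [->|(s' & x & -> & Hs')].
  - rewrite len_0 in E. symmetry in E. destruct (succ_ne _ E).
  - exists s', x. split; auto. rewrite len_sc in E by auto. apply succ_inj, E.
Qed.

Lemma nth_ext s t i : str s -> ext s t -> i < len s -> nth t i = nth s i.
Proof.
  intros Hs H Hi. destruct (prefix_sc_exists s i Hs Hi) as (r & x & Hr & <-).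
  rewrite (nth_eq s r x), (nth_eq t r x); auto.
  - eapply str_ext; eauto.
  - eapply ext_trans; eauto.
Qed.

Lemma nth_sc s x i : str s -> i < len s -> nth (sc s x) i = nth s i.
Proof. intros Hs Hi. apply nth_ext; auto. apply ext_one. Qed.

Lemma ext_pointwise s t : str s -> str t -> len s <= len t ->
  (forall i, i < len s -> nth s i = nth t i) -> ext s t.
Proof.
  intros Hs Ht. revert s Hs.
  apply (str_ind (fun s => len s <= len t -> (forall i, i < len s -> nth s i = nth t i) -> ext s t)).
  - intros _ _. exact Ht.
  - intros s x Hs IH Hl H. rewrite len_sc in Hl, H by auto.
    assert (E : ext s t).
    { apply IH; [eapply le_trans; [apply le_succ|exact Hl]|]. intros i Hi.
      rewrite <- H, nth_sc; auto. eapply lt_trans; [exact Hi|apply lt_succ_diag]. }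
    destruct (prefix_sc_exists t (len s) Ht) as (r & y & Hr & El); [apply lt_iff, Hl|].
    assert (r = s).
    { apply (same_len r s t); auto. eapply ext_trans; [apply ext_one|exact Hr]. }
    subst r. specialize (H (len s) (lt_succ_diag _)). rewrite nth_last in H by auto.
    rewrite (nth_eq t s y) in H; auto. subst. exact Hr.
Qed.

Lemma str_pointwise s t : str s -> str t -> len s = len t ->
  (forall i, i < len s -> nth s i = nth t i) -> s = t.
Proof.
  intros Hs Ht Hl H. apply ext_antisym; apply ext_pointwise; auto; rewrite ?Hl; try apply le_refl.
  intros i Hi. symmetry. apply H. rewrite Hl. auto.
Qed.

Definition restr (g : N -> N) (n : N) : N := nrec 0 (fun i r => sc r (g i)) n.

Lemma TDef_restr (g : (nat -> N) -> N -> N) n :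
  TDef (fun e => g (fun i => e (S i)) (e 0%nat)) -> TDef n -> TDef (fun e => restr (g e) (n e)).
Proof.
  intros Hg Hn. unfold restr.
  apply (TDef_nrec (fun _ => 0) (fun e i r => sc r (g e i)) n); [def| |auto].
  apply (TDef_app2 sc (fun e => e 1%nat) (fun e => g (fun i => e (S (S i))) (e 0%nat))); [def|].
  exact (Def_ren (fun i => match i with 0 => 0 | 1 => 1 | S (S i) => S (S (S i)) end)%nat _ Hg).
Qed.

Section Restr.
Variable g : N -> N.
Context {Hg : Fun1 g}.

Global Instance Fun1_restr : Fun1 (restr g).
Proof. apply (TDef_restr (fun _ => g) (fun e => e 0%nat)); [exact Hg|def]. Qed.

Lemma restr_0 : restr g 0 = 0.
Proof. unfold restr. apply nrec_0. exact _. Qed.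
Lemma restr_S n : restr g (n + 1) = sc (restr g n) (g n).
Proof. unfold restr. rewrite nrec_S; auto. exact _. Qed.

Lemma restr_str n : str (restr g n) /\ len (restr g n) = n.
Proof.
  revert n. apply (ind (fun n => str (restr g n) /\ len (restr g n) = n)); [exact _| |].
  - rewrite restr_0. split; [apply str_0|apply len_0].
  - intros n (H1 & H2). rewrite restr_S, len_sc, H2 by auto. split; auto. apply str_sc; auto.
Qed.

Lemma str_restr n : str (restr g n).
Proof. apply restr_str. Qed.
Lemma len_restr n : len (restr g n) = n.
Proof. apply restr_str. Qed.

Lemma restr_mono n m : n <= m -> ext (restr g n) (restr g m).
Proof.
  intros (z & ->). revert z. apply (ind (fun z => ext (restr g n) (restr g (n + z)))); [exact _| |].
  - rewrite add_0_r. apply ext_refl.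
  - intros z H. rewrite add_S_r, restr_S. apply ext_sc; auto.
Qed.

Lemma nth_restr n i : i < n -> nth (restr g n) i = g i.
Proof.
  intros Hi. rewrite <- (len_restr i) at 1. apply nth_eq; [apply str_restr|].
  rewrite <- restr_S. apply restr_mono, lt_iff, Hi.
Qed.

Lemma ext_restr s n : ext s (restr g n) -> s = restr g (len s) /\ len s <= n.
Proof.
  intros H. assert (Hs := str_prefix _ _ H (str_restr n)).
  assert (Hl := ext_len _ _ Hs H). rewrite len_restr in Hl. split; auto.
  eapply same_len; [apply (str_restr n)|auto|apply restr_mono; auto|]. rewrite len_restr. auto.
Qed.

End Restr.

Lemma restr_ext g g' {Hg : Fun1 g} {Hg' : Fun1 g'} n :
  (forall i, i < n -> g i = g' i) -> restr g n = restr g' n.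
Proof.
  intros H. apply str_pointwise; try (apply str_restr; exact _).
  - rewrite !len_restr by exact _. reflexivity.
  - intros i Hi. rewrite len_restr in Hi by exact _. rewrite !nth_restr; auto.
Qed.

(** When [f k] has length at least [k], the string [f (p + 1)] is long enough to have an entry at
    [p]. *)
Definition chain_limit (f : N -> N) (p : N) : N := nth (f (p + 1)) p.

Section ChainLimit.
Variable f : N -> N.
Context {Hf : Fun1 f}.
Hypothesis f_str : forall k, str (f k).
Hypothesis f_step : forall k, ext (f k) (f (k + 1)).
Hypothesis f_len : forall k, k <= len (f k).

Global Instance Fun1_chain_limit : Fun1 (chain_limit f).
Proof. unfold chain_limit. def. Qed.

Lemma chain_mono k m : k <= m -> ext (f k) (f m).
Proof.
  intros (z & ->). revert z. apply (ind (fun z => ext (f k) (f (k + z)))); [exact _| |].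
  - rewrite add_0_r. apply ext_refl.
  - intros z H. rewrite add_S_r. eapply ext_trans; [exact H|apply f_step].
Qed.

Lemma chain_limit_below m : ext (restr (chain_limit f) m) (f m).
Proof.
  apply ext_pointwise; [apply str_restr; exact _|apply f_str| |]; rewrite len_restr by exact _.
  - apply f_len.
  - intros i Hi. rewrite nth_restr by (exact _ || exact Hi). symmetry. apply nth_ext.
    + apply f_str.
    + apply chain_mono, lt_iff, Hi.
    + eapply lt_le_trans; [apply lt_succ_diag|apply f_len].
Qed.

Lemma chain_limit_above k m : len (f k) <= m -> ext (f k) (restr (chain_limit f) m).
Proof.
  intros H. apply (ext_of_len _ _ (f m)).
  - apply f_str.
  - apply chain_mono. eapply le_trans; [apply f_len|exact H].
  - apply chain_limit_below.
  - rewrite len_restr by exact _. exact H.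
Qed.

Lemma chain_limit_eq k i : i < len (f k) -> chain_limit f i = nth (f k) i.
Proof.
  intros Hi. rewrite <- (nth_restr (chain_limit f) (len (f k))) by (exact _ || exact Hi).
  apply nth_ext; auto. apply chain_limit_above, le_refl.
Qed.

End ChainLimit.

End Strings.

Ltac def_ho ::=
  lazymatch goal with
  | |- TDef (fun e => ite (@?P e) (@?a e) (@?b e)) => apply (TDef_ite P a b)
  | |- TDef (fun e => mu (@?P e)) => apply (TDef_mu P)
  | |- Def (fun e => reach (@?R e) (@?u e) (@?v e)) => apply (Def_reach R u v)
  | |- TDef (fun e => nrec (@?a e) (@?f e) (@?n e)) => apply (TDef_nrec a f n)
  | |- TDef (fun e => srec (@?a e) (@?f e) (@?n e)) => apply (TDef_srec a f n)
  | |- TDef (fun e => restr (@?g e) (@?n e)) => apply (TDef_restr g n)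
  end.

(** * Computations in the model *)

Section Computations.

Context {A : structure} {HA : aca_model A}.
Local Notation N := (num_sort A).
Local Open Scope model_scope.
Add Ring model_ring : (model_semiring (A := A)).

Fixpoint nu (k : nat) : N := match k with O => 0 | S k => nu k + 1 end.

Lemma nu_inj k : forall k', nu k = nu k' -> k = k'.
Proof.
  induction k; intros [|k'] H; simpl in H; auto.
  - symmetry in H. destruct (succ_ne _ H).
  - destruct (succ_ne _ H).
  - f_equal. apply IHk, succ_inj, H.
Qed.

Lemma nu_lt k i : i < nu (S k) -> i < nu k \/ i = nu k.
Proof. apply lt_succ. Qed.

Definition tri (e x y : N) : N := pr e (pr x y).
Definition earlier (a b i e x y : N) : Prop := exists j, j < i /\ beta a b j (tri e x y).

Definition just (O : N -> Prop) (a b i e x y : N) : Prop :=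
  (e = pr (nu 0) 0 /\ y = 0) \/
  (e = pr (nu 1) 0 /\ y = x + 1) \/
  (e = pr (nu 2) 0 /\ y = x) \/
  (e = pr (nu 3) 0 /\ exists z, x = pr y z) \/
  (e = pr (nu 4) 0 /\ exists z, x = pr z y) \/
  (e = pr (nu 5) 0 /\ ((O x /\ y = 1) \/ (~ O x /\ y = 0))) \/
  (exists f g, e = pr (nu 6) (pr f g) /\ exists u v,
    earlier a b i f x u /\ earlier a b i g x v /\ y = pr u v) \/
  (exists f g, e = pr (nu 7) (pr f g) /\ exists u,
    earlier a b i g x u /\ earlier a b i f u y) \/
  (exists f g, e = pr (nu 8) (pr f g) /\
    ((exists w, x = pr w 0 /\ earlier a b i f w y) \/
     (exists w k v, x = pr w (k + 1) /\ earlier a b i e (pr w k) v /\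
       earlier a b i g (pr w (pr k v)) y))) \/
  (exists f, e = pr (nu 9) f /\ earlier a b i f (pr x y) 0 /\
    forall k, k < y -> exists v, earlier a b i f (pr x k) (v + 1)).

(** [comp_by O a e x y]: a computation of [{e}^O(x) = y] whose beta code starts with [a];
    in particular its oracle queries are at most [a]. *)
Definition comp_by (O : N -> Prop) (a e x y : N) : Prop :=
  exists b n, beta a b n (tri e x y) /\ forall i, i < n + 1 ->
    exists e' x' y', beta a b i (tri e' x' y') /\ just O a b i e' x' y'.

Definition comp (O : N -> Prop) (e x y : N) : Prop := exists a, comp_by O a e x y.

Lemma tri_inj e x y e' x' y' : tri e x y = tri e' x' y' -> e = e' /\ x = x' /\ y = y'.
Proof. intros H. apply pr_inj in H. destruct H as [-> H]. apply pr_inj in H. tauto. Qed.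

(** A query occurs as the argument of some triple of the computation, and all entries of a
    beta-coded sequence are at most [a]. *)
Lemma comp_by_use (O O' : N -> Prop) a e x y :
  (forall q, q <= a -> (O q <-> O' q)) -> comp_by O a e x y -> comp_by O' a e x y.
Proof.
  intros HO (b & n & Hn & H). exists b, n. split; auto. intros i Hi.
  destruct (H i Hi) as (e' & x' & y' & Hb & Hj). exists e', x', y'. split; auto.
  assert (Hx : x' <= a).
  { eapply le_trans; [|exact (beta_le _ _ _ _ Hb)]. eapply le_trans; [apply le_pr_l|apply le_pr_r]. }
  unfold just in *. rewrite <- (HO x' Hx). exact Hj.
Qed.

(** Induction on the position in the first computation, for all positions in the second at once. For
    the search operator, two different results would give the body both a zero and a nonzero value
    at the smaller one. *)
Lemma comp_unique O e x y y' : comp O e x y -> comp O e x y' -> y = y'.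
Proof.
  intros (a & b & n & Hn & H) (a' & b' & n' & Hn' & H').
  enough (K : forall i, i < n + 1 -> forall e x y, beta a b i (tri e x y) ->
    forall j y', j < n' + 1 -> beta a' b' j (tri e x y') -> y = y').
  { eapply K; eauto using lt_succ_diag. }
  clear e x y y' Hn Hn'.
  apply (strong_ind (fun i => i < n + 1 -> forall e x y, beta a b i (tri e x y) ->
    forall j y', j < n' + 1 -> beta a' b' j (tri e x y') -> y = y')); [unfold tri; def|].
  intros i IH Hi e x y Hb j y' Hj Hb'.
  assert (IH' : forall e x y y', earlier a b i e x y -> earlier a' b' j e x y' -> y = y').
  { intros e0 x0 y0 y0' (k & Hk & Bk) (k' & Hk' & Bk').
    apply (IH k Hk (lt_trans _ _ _ Hk Hi) e0 x0 y0 Bk k'); auto. eapply lt_trans; eauto. }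
  clear IH.
  destruct (H i Hi) as (e1 & x1 & y1 & B1 & J).
  apply (beta_unique _ _ _ _ _ Hb), tri_inj in B1. destruct B1 as (<- & <- & <-).
  destruct (H' j Hj) as (e1 & x1 & y1 & B1 & J').
  apply (beta_unique _ _ _ _ _ Hb'), tri_inj in B1. destruct B1 as (<- & <- & <-).
  clear H H' Hb Hb' Hi Hj.
  assert (tag : forall k k' p p', pr (nu k) p = pr (nu k') p' -> k = k' /\ p = p').
  { intros k k' p p' E. apply pr_inj in E. destruct E as [E Ep]. split; auto. apply nu_inj, E. }
  unfold just in J, J'.
  decompose [or] J; clear J; decompose [or] J'; clear J';
  repeat match goal with
  | K : exists _, _ |- _ => destruct K
  | K : _ /\ _ |- _ => destruct K
  end; subst;
  repeat match goal with
  | K : pr (nu _) _ = pr (nu _) _ |- _ => apply tag in K; destruct K; subst; try discriminate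
  | K : pr _ _ = pr _ _ |- _ => apply pr_inj in K; destruct K; subst
  end; auto.
  - repeat match goal with K : _ \/ _ |- _ => destruct K as [[? ?]|[? ?]] end; subst; auto; contradiction.
  - f_equal; eauto.
  - match goal with K1 : earlier a b _ _ _ ?u, K2 : earlier a' b' _ _ _ ?u' |- _ =>
      assert (u = u') by eauto; subst end. eauto.
  - repeat match goal with
    | K : _ \/ _ |- _ => destruct K
    | K : exists _, _ |- _ => destruct K
    | K : _ /\ _ |- _ => destruct K
    end; subst;
    repeat match goal with
    | K : pr _ _ = pr _ _ |- _ => apply pr_inj in K; destruct K; subst
    end.
    all: try (exfalso; match goal with K : _ + 1 = 0 |- _ => exact (succ_ne _ K)
      | K : 0 = _ + 1 |- _ => exact (succ_ne _ (eq_sym K)) end).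
    + eauto.
    + match goal with K : _ + 1 = _ + 1 |- _ => apply succ_inj in K; subst end.
      match goal with K1 : earlier a b _ ?g _ ?u, K2 : earlier a' b' _ ?g _ ?u' |- _ =>
        assert (u = u') by eauto; subst end. eauto.
  -    destruct (le_or_lt y y') as [K|K]; [apply le_lt_eq in K; destruct K as [K|K]; auto|].
    all: exfalso.
    + match goal with K1 : forall k, k < y' -> _ |- _ => destruct (K1 _ K) as (w & Hw) end.
      eapply succ_ne. symmetry. eauto.
    + match goal with K1 : forall k, k < y -> _ |- _ => destruct (K1 _ K) as (w & Hw) end.
      eapply succ_ne. eauto.
Qed.

(** A computation written out by hand has standard length; as a definable function it can be fed to
    [beta_exists]. *)
Lemma list_function (l : list N) : exists f : N -> N, Fun1 f /\
  forall k v, nth_error l k = Some v -> f (nu k) = v.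
Proof.
  induction l as [|w l IH] using rev_ind.
  - exists (fun _ => 0). split; [exact _|]. intros [|k] v; discriminate.
  - destruct IH as (f & Hf & H). exists (fun i => ite (i = nu (length l)) w (f i)).
    split; [exact _|]. intros k v E.
    destruct (Nat.eq_dec k (length l)) as [->|K].
    + rewrite nth_error_app2, Nat.sub_diag in E by lia. simpl in E.
      rewrite ite_true by auto. congruence.
    + assert (length l <> k /\ k < length l)%nat as [_ Hk].
      { split; auto. assert (k < length (l ++ [w]))%nat by (apply nth_error_Some; congruence).
        rewrite length_app in *. simpl in *. lia. }
      rewrite nth_error_app1 in E by lia. rewrite ite_false; auto.
      intros E'. apply nu_inj in E'. contradiction.
Qed.

Lemma nu_lt_lt k k' : (k < k')%nat -> nu k < nu k'.
Proof.
  intros H. induction H; simpl; [apply lt_succ_diag|]. eapply lt_trans; [exact IHle|apply lt_succ_diag].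
Qed.

(** The index of [x |-> O(((x, 0), 0))]. *)
Definition query_index : N :=
  let z := pr (nu 0) 0 in
  pr (nu 7) (pr (pr (nu 5) 0) (pr (nu 6) (pr (pr (nu 6) (pr (pr (nu 2) 0) z)) z))).

(** The oracle will be the graph of a path that carries a set by its values at the positions
    [pr x 0], where the value 0 stands for membership. *)
Lemma comp_query O x y :
  (O (pr (pr x 0) 0) /\ y = 1) \/ (~ O (pr (pr x 0) 0) /\ y = 0) -> comp O query_index x y.
Proof.
  intros Hy. set (z := pr (nu 0) 0). set (p := pr (nu 6) (pr (pr (nu 2) 0) z)).
  set (q := pr (nu 6) (pr p z)).
  set (l := [tri (pr (nu 2) 0) x x; tri z x 0; tri p x (pr x 0); tri q x (pr (pr x 0) 0);
             tri (pr (nu 5) 0) (pr (pr x 0) 0) y; tri query_index x y]).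
  destruct (list_function l) as (f & Hf & H).
  destruct (beta_exists f (nu 6)) as (a & b & Hab).
  assert (B : forall k v, (k < 6)%nat -> nth_error l k = Some v -> beta a b (nu k) v).
  { intros k v Hk E. rewrite <- (H k v E). apply Hab. apply nu_lt_lt, Hk. }
  assert (E : forall i k e' x' y', (i < k)%nat -> (k < 6)%nat -> nth_error l i = Some (tri e' x' y') ->
    earlier a b (nu k) e' x' y').
  { intros i k e' x' y' Hi Hk Hl. exists (nu i). split; [apply nu_lt_lt; auto|]. apply B; auto. lia. }
  exists a, b, (nu 5). split; [apply B; auto|]. intros i Hi. change (i < nu 6) in Hi.
  apply nu_lt in Hi. destruct Hi as [Hi| ->].
  apply nu_lt in Hi. destruct Hi as [Hi| ->].
  apply nu_lt in Hi. destruct Hi as [Hi| ->].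
  apply nu_lt in Hi. destruct Hi as [Hi| ->].
  apply nu_lt in Hi. destruct Hi as [Hi| ->].
  apply nu_lt in Hi. destruct Hi as [Hi| ->].
  destruct (nlt_0 _ Hi).
  all: do 3 eexists; split; [apply B; [|reflexivity]; lia|]; unfold just.
  - auto.
  - auto.
  - do 6 right. left. exists (pr (nu 2) 0), z. split; auto. exists x, 0. split; [|split; auto].
    + apply (E 0%nat); auto; lia.
    + apply (E 1%nat); auto; lia.
  - do 6 right. left. exists p, z. split; auto. exists (pr x 0), 0. split; [|split; auto].
    + apply (E 2%nat); auto; lia.
    + apply (E 1%nat); auto; lia.
  - do 5 right. left. auto.
  - do 7 right. left. exists (pr (nu 5) 0), q. split; auto. exists (pr (pr x 0) 0). split.
    + apply (E 3%nat); auto; lia.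
    + apply (E 4%nat); auto; lia.
Qed.

End Computations.

(** * Semantics of the formula macros *)

Lemma and_iff2 (P P' Q Q' : Prop) : (P <-> P') -> (Q <-> Q') -> (P /\ Q <-> P' /\ Q').
Proof. tauto. Qed.
Lemma or_iff2 (P P' Q Q' : Prop) : (P <-> P') -> (Q <-> Q') -> (P \/ Q <-> P' \/ Q').
Proof. tauto. Qed.
Lemma imp_iff2 (P P' Q Q' : Prop) : (P <-> P') -> (Q <-> Q') -> ((P -> Q) <-> (P' -> Q')).
Proof. tauto. Qed.
Lemma iff_iff2 (P P' Q Q' : Prop) : (P <-> P') -> (Q <-> Q') -> ((P <-> Q) <-> (P' <-> Q')).
Proof. tauto. Qed.
Lemma not_iff2 (P P' : Prop) : (P <-> P') -> (~ P <-> ~ P').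
Proof. tauto. Qed.

Ltac sem_macro := fail.

Ltac sem_step :=
  cbv beta zeta;
  lazymatch goal with
  | |- sat _ _ _ (And _ _) <-> _ => rewrite sat_And; apply and_iff2
  | |- sat _ _ _ (Or _ _) <-> _ => rewrite sat_Or; apply or_iff2
  | |- sat _ _ _ (Iff _ _) <-> _ => rewrite sat_Iff; apply iff_iff2
  | |- sat _ _ _ (Neg _) <-> _ => rewrite sat_Neg; apply not_iff2
  | |- sat _ _ _ (Imp _ _) <-> _ => rewrite sat_Imp; apply imp_iff2
  | |- sat _ _ _ (ExNum _) <-> _ => rewrite sat_ExNum; apply exists_iff; intro
  | |- sat _ _ _ (ExSet _) <-> _ => rewrite sat_ExSet; apply exists_iff; intro
  | |- sat _ _ _ (AllNum _) <-> _ => rewrite sat_AllNum; apply forall_iff; intro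
  | |- sat _ _ _ (AllSet _) <-> _ => rewrite sat_AllSet; apply forall_iff; intro
  | |- sat _ _ _ (Eq _ _) <-> _ => cbn [sat]
  | |- sat _ _ _ (Lt _ _) <-> _ => cbn [sat]
  | |- sat _ _ _ (Mem _ _) <-> _ => cbn [sat]
  | |- _ => sem_macro
  end.

Section Semantics.

Context {A : structure} {HA : aca_model A}.
Local Notation N := (num_sort A).
Local Notation "x \in X" := (s_mem A x X) (at level 70) : model_scope.
Local Open Scope model_scope.

Lemma eval_up e k (t : term) : eval A e (up k t) = eval A (fun i => e (k + i)%nat) t.
Proof. unfold up. rewrite eval_subst. reflexivity. Qed.

Lemma eval_scons_up1 (d1 : N) e t : eval A (scons d1 e) (up 1 t) = eval A e t.
Proof. apply eval_up. Qed.
Lemma eval_scons_up2 (d1 d2 : N) e t : eval A (scons d1 (scons d2 e)) (up 2 t) = eval A e t.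
Proof. apply eval_up. Qed.
Lemma eval_scons_up3 (d1 d2 d3 : N) e t :
  eval A (scons d1 (scons d2 (scons d3 e))) (up 3 t) = eval A e t.
Proof. apply eval_up. Qed.
Lemma eval_scons_up4 (d1 d2 d3 d4 : N) e t :
  eval A (scons d1 (scons d2 (scons d3 (scons d4 e)))) (up 4 t) = eval A e t.
Proof. apply eval_up. Qed.
Lemma eval_scons_up5 (d1 d2 d3 d4 d5 : N) e t :
  eval A (scons d1 (scons d2 (scons d3 (scons d4 (scons d5 e))))) (up 5 t) = eval A e t.
Proof. apply eval_up. Qed.

Lemma eval_pair e s t : eval A e (pair s t) = pr (eval A e s) (eval A e t).
Proof. reflexivity. Qed.
Lemma eval_snoc e s t : eval A e (snoc s t) = sc (eval A e s) (eval A e t).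
Proof. reflexivity. Qed.
Lemma eval_triple e s t u : eval A e (triple s t u) = tri (eval A e s) (eval A e t) (eval A e u).
Proof. reflexivity. Qed.
Lemma eval_num e k : eval A e (num k) = nu k.
Proof. induction k; simpl; congruence. Qed.

Ltac ups := cbn [eval]; rewrite ?eval_scons_up1, ?eval_scons_up2, ?eval_scons_up3,
  ?eval_scons_up4, ?eval_scons_up5, ?eval_pair, ?eval_snoc, ?eval_triple, ?eval_num; cbn [eval scons].
Ltac sem := repeat (repeat sem_step; ups; try reflexivity).

Lemma sat_Beta e v a b i w :
  sat A e v (Beta a b i w) <-> beta (eval A e a) (eval A e b) (eval A e i) (eval A e w).
Proof. unfold Beta, beta. sem. Qed.

Ltac sem_macro ::= lazymatch goal with |- sat _ _ _ (Beta _ _ _ _) <-> _ => rewrite sat_Beta end.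

Lemma sat_Extends e v s t : sat A e v (Extends s t) <-> ext (eval A e s) (eval A e t).
Proof.
  transitivity (exists a b n, beta a b 0 (eval A e s) /\ beta a b n (eval A e t) /\
    forall i, i < n -> exists r x, beta a b i r /\ beta a b (i + 1) (sc r x)).
  - unfold Extends. sem.
  - unfold ext, reach, one_step. do 3 (apply exists_iff; intro). do 2 (apply and_iff2; [reflexivity|]).
    apply forall_iff; intro. apply imp_iff2; [reflexivity|]. split.
    + intros (r & w & H1 & H2). eauto 6.
    + intros (r & r' & H1 & H2 & w & ->). eauto.
Qed.

Lemma sat_Earlier e v a b i ee x y : sat A e v (Earlier a b i ee x y) <->
  earlier (eval A e a) (eval A e b) (eval A e i) (eval A e ee) (eval A e x) (eval A e y).
Proof. unfold Earlier, earlier. sem. Qed.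

Ltac sem_macro ::= lazymatch goal with
  | |- sat _ _ _ (Beta _ _ _ _) <-> _ => rewrite sat_Beta
  | |- sat _ _ _ (Extends _ _) <-> _ => rewrite sat_Extends
  | |- sat _ _ _ (IsString _) <-> _ => unfold IsString
  | |- sat _ _ _ (Earlier _ _ _ _ _ _) <-> _ => rewrite sat_Earlier
  end.

Lemma sat_Justified e v Y a b i ee x y : sat A e v (Justified Y a b i ee x y) <->
  just (fun q => q \in v Y) (eval A e a) (eval A e b) (eval A e i) (eval A e ee) (eval A e x) (eval A e y).
Proof.
  unfold Justified, just, c_zero, c_succ, c_id, c_fst, c_snd, c_oracle, c_pair, c_comp, c_prec, c_mu.
  sem.
Qed.

Ltac sem_macro ::= lazymatch goal with
  | |- sat _ _ _ (Beta _ _ _ _) <-> _ => rewrite sat_Beta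
  | |- sat _ _ _ (Extends _ _) <-> _ => rewrite sat_Extends
  | |- sat _ _ _ (IsString _) <-> _ => unfold IsString
  | |- sat _ _ _ (Justified _ _ _ _ _ _ _) <-> _ => rewrite sat_Justified
  end.

Lemma sat_Computes e v Y ee x y : sat A e v (Computes Y ee x y) <->
  comp (fun q => q \in v Y) (eval A e ee) (eval A e x) (eval A e y).
Proof. unfold Computes, comp, comp_by. sem. Qed.

Definition turing_le (X Y : set_sort A) : Prop := exists e, forall n,
  (n \in X -> comp (fun q => q \in Y) e n 1) /\ (~ n \in X -> comp (fun q => q \in Y) e n 0).

Ltac sem_macro ::= lazymatch goal with
  | |- sat _ _ _ (Beta _ _ _ _) <-> _ => rewrite sat_Beta
  | |- sat _ _ _ (Extends _ _) <-> _ => rewrite sat_Extends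
  | |- sat _ _ _ (IsString _) <-> _ => unfold IsString
  | |- sat _ _ _ (Computes _ _ _ _) <-> _ => rewrite sat_Computes
  end.

Lemma sat_TuringLe e v X Y : sat A e v (TuringLe X Y) <-> turing_le (v X) (v Y).
Proof. unfold TuringLe, turing_le. sem. Qed.

Definition is_graph (g : N -> N) (F : set_sort A) : Prop :=
  forall q, q \in F <-> exists p, q = pr p (g p).

Lemma is_graph_pr g F p y : is_graph g F -> (pr p y \in F <-> y = g p).
Proof.
  intros HF. rewrite (HF (pr p y)). split; [|intros ->; eauto].
  intros (p' & E). apply pr_inj in E. destruct E; subst; auto.
Qed.

Lemma graph_exists g {Hg : Fun1 g} : exists F, is_graph g F.
Proof. apply (set_exists (fun q => exists p, q = pr p (g p))). Qed.

Lemma sat_IsFunction e v F :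
  sat A e v (IsFunction F) <-> exists g, Fun1 g /\ is_graph g (v F).
Proof.
  transitivity ((forall q, q \in v F -> exists x y, q = pr x y) /\
    (forall x, exists y, pr x y \in v F) /\
    (forall x y y', pr x y \in v F -> pr x y' \in v F -> y = y')).
  { unfold IsFunction. sem. }
  split.
  - intros (H1 & H2 & H3). exists (fun p => mu (fun y => pr p y \in v F)).
    assert (K : forall p, pr p (mu (fun y => pr p y \in v F)) \in v F).
    { intros p. apply (mu_spec (fun y => pr p y \in v F)); auto. exact _. }
    split; [exact _|]. intros q. split.
    + intros Hq. destruct (H1 q Hq) as (x & y & ->). exists x. f_equal. eauto.
    + intros (p & ->). apply K.
  - intros (g & Hg & HF). split; [|split].
    + intros q Hq. apply HF in Hq. destruct Hq as (p & ->). eauto.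
    + intros x. exists (g x). apply HF. eauto.
    + intros x y y' H H'. apply (is_graph_pr g) in H; auto. apply (is_graph_pr g) in H'; auto. congruence.
Qed.

Lemma sat_Restriction e v F n s g {Hg : Fun1 g} : is_graph g (v F) ->
  sat A e v (Restriction F n s) <-> eval A e s = restr g (eval A e n).
Proof.
  intros HF.
  transitivity (exists a b, beta a b 0 0 /\ beta a b (eval A e n) (eval A e s) /\
    forall i, i < eval A e n -> exists r x, beta a b i r /\ pr i x \in v F /\ beta a b (i + 1) (sc r x)).
  { unfold Restriction. sem. }
  generalize (eval A e n) (eval A e s). clear n s. intros n s. split.
  - intros (a & b & H0 & Hn & H).
    assert (K : forall i, i < n + 1 -> forall r, beta a b i r -> r = restr g i).
    { apply (ind (fun i => i < n + 1 -> forall r, beta a b i r -> r = restr g i)); [def| |].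
      - intros _ r Hr. rewrite restr_0 by exact _. eapply beta_unique; eauto.
      - intros i IH Hi r Hr. apply succ_lt_inv in Hi.
        destruct (H i Hi) as (r' & x & Hr' & Hx & Hr'').
        apply (is_graph_pr g) in Hx; auto. subst x.
        rewrite restr_S by exact _. rewrite (beta_unique _ _ _ _ _ Hr Hr'').
        f_equal. apply IH; auto. eapply lt_trans; [exact Hi|apply lt_succ_diag]. }
    apply K; auto using lt_succ_diag.
  - intros ->. destruct (beta_exists (restr g) (n + 1)) as (a & b & H). exists a, b.
    split; [pose proof (H 0 (zero_lt_succ n)) as K; rewrite restr_0 in K by exact _; exact K|].
    split; [apply H, lt_succ_diag|]. intros i Hi. exists (restr g i), (g i). split; [|split].
    + apply H. eapply lt_trans; [exact Hi|apply lt_succ_diag].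
    + apply HF. eauto.
    + rewrite <- restr_S by exact _. apply H, succ_lt, Hi.
Qed.

Definition path (g : N -> N) (P : N -> Prop) : Prop := forall n, P (restr g n).

Lemma sat_IsPath e v F T g {Hg : Fun1 g} : is_graph g (v F) ->
  sat A e v (IsPath F T) <-> path g (fun s => s \in v T).
Proof.
  intros HF. unfold IsPath. rewrite sat_And, sat_IsFunction, sat_AllNum.
  assert (E : (exists g, Fun1 g /\ is_graph g (v F)) <-> True) by (split; eauto).
  rewrite E. transitivity (forall n, exists s, s = restr g n /\ s \in v T).
  - split.
    + intros (_ & H) n. specialize (H n). rewrite sat_ExNum in H. destruct H as (s & H).
      rewrite sat_And, (sat_Restriction _ _ _ _ _ g) in H by exact HF. exists s. exact H.
    + intros H. split; auto. intros n. rewrite sat_ExNum. destruct (H n) as (s & Hs). exists s.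
      rewrite sat_And, (sat_Restriction _ _ _ _ _ g) by exact HF. exact Hs.
  - apply forall_iff. intros n. split; [intros (s & -> & H); auto|eauto].
Qed.

Definition is_tree (P : N -> Prop) : Prop := forall s, P s -> str s /\ forall t, ext t s -> P t.
Definition incompatible (t u : N) : Prop := ~ ext t u /\ ~ ext u t.

Ltac sem_macro ::= lazymatch goal with
  | |- sat _ _ _ (Extends _ _) <-> _ => rewrite sat_Extends
  | |- sat _ _ _ (IsString _) <-> _ => unfold IsString
  | |- sat _ _ _ (TuringLe _ _) <-> _ => rewrite sat_TuringLe
  end.

Lemma sat_IsTree e v T : sat A e v (IsTree T) <-> is_tree (fun s => s \in v T).
Proof. unfold IsTree, is_tree, str. sem. Qed.

Lemma sat_IsCofinal e v T : sat A e v (IsCofinal T) <->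
  forall X, exists F g, Fun1 g /\ is_graph g F /\ path g (fun s => s \in v T) /\ turing_le X F.
Proof.
  unfold IsCofinal. rewrite sat_AllSet. apply forall_iff; intros X. rewrite sat_ExSet.
  apply exists_iff; intros F. rewrite sat_And, sat_TuringLe. split.
  - intros (H & K). pose proof H as H'. unfold IsPath in H'. rewrite sat_And, sat_IsFunction in H'.
    destruct H' as ((g & Hg & HF) & _). rewrite (sat_IsPath _ _ _ _ g) in H by exact HF.
    exists g. auto.
  - intros (g & Hg & HF & H & K). rewrite (sat_IsPath _ _ _ _ g) by exact HF. auto.
Qed.

Lemma sat_IsPerfect e v T : sat A e v (IsPerfect T) <->
  is_tree (fun s => s \in v T) /\ (exists s, s \in v T) /\
  forall s, s \in v T -> exists t u, t \in v T /\ u \in v T /\ ext s t /\ ext s u /\ incompatible t u.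
Proof.
  unfold IsPerfect, incompatible. rewrite sat_And, sat_IsTree. apply and_iff2; [reflexivity|]. sem.
Qed.

Lemma sat_IsPointed e v T : sat A e v (IsPointed T) <-> sat A e v (IsPerfect T) /\
  forall F g, Fun1 g -> is_graph g F -> path g (fun s => s \in v T) -> turing_le (v T) F.
Proof.
  unfold IsPointed. rewrite sat_And, sat_AllSet. apply and_iff2; [reflexivity|].
  apply forall_iff; intros F. rewrite sat_Imp, sat_TuringLe. split.
  - intros H g Hg HF Hp. apply H. rewrite (sat_IsPath _ _ _ _ g) by exact HF. exact Hp.
  - intros H K. pose proof K as K'. unfold IsPath in K'. rewrite sat_And, sat_IsFunction in K'.
    destruct K' as ((g & Hg & HF) & _). rewrite (sat_IsPath _ _ _ _ g) in K by exact HF. eauto.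
Qed.

Definition pointed_tree_theorem : Prop := forall T : N -> Prop, Rel1 T -> is_tree T ->
  (forall X, exists F g, Fun1 g /\ is_graph g F /\ path g T /\ turing_le X F) ->
  exists P, (forall s, s \in P -> T s) /\ is_tree (fun s => s \in P) /\ (exists s, s \in P) /\
    (forall s, s \in P ->
      exists t u, t \in P /\ u \in P /\ ext s t /\ ext s u /\ incompatible t u) /\
    forall F g, Fun1 g -> is_graph g F -> path g (fun s => s \in P) -> turing_le P F.

Lemma sat_MPT : (forall e v, sat A e v MPT) -> pointed_tree_theorem.
Proof.
  intros HM T HT Htree Hcof. destruct (set_exists T) as (T0 & HT0).
  destruct (aca_inh (A := A)) as [X0].
  specialize (HM (fun _ => 0) (fun _ => X0)). unfold MPT in HM. rewrite sat_AllSet in HM.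
  specialize (HM T0). rewrite sat_Imp, sat_And, sat_IsTree, sat_IsCofinal, sat_ExSet in HM.
  destruct HM as (P & HP).
  - replace (fun s => s \in scons T0 (fun _ => X0) 0%nat) with T; [auto|].
    extensionality s. apply propositional_extensionality. symmetry. apply HT0.
  - exists P. rewrite sat_And, sat_IsPointed, sat_IsPerfect in HP.
    destruct HP as (H1 & (H2 & H3 & H4) & H5). split; auto.
    intros s Hs. apply HT0. rewrite sat_AllNum in H1. exact (H1 s Hs).
Qed.

End Semantics.

(** * Coding a set into a path of a perfect tree *)

Section Coding.

Context {A : structure} {HA : aca_model A}.
Local Notation N := (num_sort A).
Local Notation "x \in X" := (s_mem A x X) (at level 70) : model_scope.
Local Open Scope model_scope.
Add Ring model_ring : (model_semiring (A := A)).

Definition gr (g : N -> N) (q : N) : Prop := exists p, q = pr p (g p).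

Lemma Rel1_gr g {Hg : Fun1 g} : Rel1 (gr g).
Proof. unfold gr. exact _. Qed.

(** A string as a finite oracle: the graph of the string extended by zeros. *)
Definition onstr (s q : N) : Prop := gr (nth s) q.
Global Instance Rel2_onstr : Rel2 onstr.
Proof. unfold onstr, gr. def. Qed.

(** The bound on [a] confines all queries to the part of the graph that [s] determines, so that
    facts persist under extension. *)
Definition fact (s e x y : N) : Prop := exists a, a < len s /\ comp_by (onstr s) a e x y.
Global Instance Rel4_fact : Rel4 fact.
Proof. unfold fact, comp_by, just, earlier, tri. def. Qed.

Lemma fact_mono s t e x y : str s -> ext s t -> fact s e x y -> fact t e x y.
Proof.
  intros Hs H (a & Ha & Hc). exists a. split.
  - eapply lt_le_trans; [exact Ha|]. apply ext_len; auto.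
  - eapply comp_by_use; [|exact Hc]. intros q Hq. unfold onstr, gr. apply exists_iff. intros p.
    assert (K : p <= q -> nth t p = nth s p).
    { intros Hp. apply nth_ext; auto. eapply le_lt_trans; [exact Hp|]. eapply le_lt_trans; eauto. }
    split; intros E; [rewrite K|rewrite <- K]; auto; rewrite E; apply le_pr_l.
Qed.

Lemma restr_oracle g {Hg : Fun1 g} m q : q < m -> (onstr (restr g m) q <-> gr g q).
Proof.
  intros Hq. unfold onstr, gr. apply exists_iff. intros p.
  assert (K : p <= q -> nth (restr g m) p = g p).
  { intros Hp. apply nth_restr; auto. eapply le_lt_trans; eauto. }
  split; intros E; [rewrite <- K|rewrite K]; auto; rewrite E; apply le_pr_l.
Qed.

Lemma fact_sound g {Hg : Fun1 g} m e x y : fact (restr g m) e x y -> comp (gr g) e x y.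
Proof.
  intros (a & Ha & Hc). rewrite len_restr in Ha by exact _. exists a.
  eapply comp_by_use; [|exact Hc]. intros q Hq. apply restr_oracle; auto.
  eapply le_lt_trans; eauto.
Qed.

Lemma fact_complete g {Hg : Fun1 g} e x y : comp (gr g) e x y -> exists m, fact (restr g m) e x y.
Proof.
  intros (a & Hc). exists (a + 1), a. rewrite len_restr by exact _. split; [apply lt_succ_diag|].
  eapply comp_by_use; [|exact Hc]. intros q Hq. symmetry. apply restr_oracle; auto.
  apply lt_succ_le, Hq.
Qed.

(** [Phi n b] is (partial) information on the characteristic function of a tree; [splitting]
    finds the first pair of incompatible extensions of [s] in that tree. *)
Definition splitting (Phi : N -> N -> Prop) (s t u : N) : Prop :=
  ext s t /\ ext s u /\ incompatible t u /\ Phi t 1 /\ Phi u 1 /\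
  forall t' u', pr t' u' < pr t u -> ext s t' -> ext s u' -> incompatible t' u' ->
    Phi t' 0 \/ Phi u' 0.

Definition dstep (Phi : N -> N -> Prop) (x y : N) : Prop :=
  exists s b t u, x = pr s b /\ splitting Phi s t u /\ (y = pr t (sc b 0) \/ y = pr u (sc b 1)).

(** Following [w] through successive splittings, starting from [s0], reads off the bits [b]. *)
Definition decodes (Phi : N -> N -> Prop) (s0 b w : N) : Prop :=
  exists s, reach (dstep Phi) (pr s0 0) (pr s b) /\ ext s w.

(** [Phi] occurs only positively: that a smaller pair fails has to be confirmed by a computed 0, so
    more information never changes a splitting already found. *)
Lemma splitting_mono (Phi Phi' : N -> N -> Prop) s t u :
  (forall n b, Phi n b -> Phi' n b) -> splitting Phi s t u -> splitting Phi' s t u.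
Proof.
  intros H (H1 & H2 & H3 & H4 & H5 & H6). do 5 (split; auto). intros t' u' K1 K2 K3 K4.
  destruct (H6 t' u' K1 K2 K3 K4); auto.
Qed.

Lemma dstep_mono (Phi Phi' : N -> N -> Prop) x y :
  (forall n b, Phi n b -> Phi' n b) -> dstep Phi x y -> dstep Phi' x y.
Proof.
  intros H (s & b & t & u & E & Hs & Hy). exists s, b, t, u.
  split; [exact E|]. split; [|exact Hy]. eapply splitting_mono; eauto.
Qed.

Lemma Rel2_dstep Phi {HPhi : Rel2 Phi} : Rel2 (dstep Phi).
Proof. unfold dstep, splitting, incompatible. def. Qed.

(** * Branches of a perfect tree that follow given bits *)

Section PerfectTree.

Variable P : N -> Prop.
Context {HP : Rel1 P}.
Hypothesis P_tree : is_tree P.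
Hypothesis P_perfect : forall s, P s ->
  exists t u, P t /\ P u /\ ext s t /\ ext s u /\ incompatible t u.

Definition chi (n b : N) : Prop := (P n /\ b = 1) \/ (~ P n /\ b = 0).

Local Instance Rel2_chi : Rel2 chi.
Proof. unfold chi. def. Qed.
Local Instance Rel3_splitting_chi : Rel3 (splitting chi).
Proof. unfold splitting, incompatible. def. Qed.
Local Instance Rel2_dstep_chi : Rel2 (dstep chi) := Rel2_dstep chi.

Lemma one_ne_zero : (1 : N) <> 0.
Proof. rewrite <- (add_0_l 1). apply succ_ne. Qed.

Lemma chi_1 n : chi n 1 <-> P n.
Proof. unfold chi. split; [|auto]. intros [[H _]|[_ H]]; auto. destruct (one_ne_zero H). Qed.
Lemma chi_0 n : chi n 0 <-> ~ P n.
Proof. unfold chi. split; [|auto]. intros [[_ H]|[H _]]; auto. destruct (one_ne_zero (eq_sym H)). Qed.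

Lemma splitting_exists s : P s -> exists t u, splitting chi s t u.
Proof.
  intros Hs. destruct (least (fun c => exists t u, c = pr t u /\ P t /\ P u /\ ext s t /\ ext s u /\
    ~ ext t u /\ ~ ext u t)) as (c & (t & u & -> & H1 & H2 & H3 & H4 & H5 & H6) & Hm).
  - exact _.
  - destruct (P_perfect s Hs) as (t & u & H). exists (pr t u), t, u. unfold incompatible in H. tauto.
  - exists t, u. unfold splitting, incompatible. rewrite !chi_1. do 5 (split; auto).
    intros t' u' Hlt K1 K2 K3. rewrite !chi_0. apply NNPP. intros K. apply (Hm _ Hlt).
    exists t', u'. tauto.
Qed.

Lemma splitting_unique s t u t' u' : splitting chi s t u -> splitting chi s t' u' -> t = t' /\ u = u'.
Proof.
  assert (K : forall t u t' u', splitting chi s t u -> splitting chi s t' u' -> ~ pr t u < pr t' u').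
  { intros a b a' b' (H1 & H2 & H3 & H4 & H5 & _) (_ & _ & _ & _ & _ & H6) Hlt.
    rewrite chi_1 in H4, H5. destruct (H6 a b Hlt H1 H2 H3) as [H|H]; rewrite chi_0 in H; auto. }
  intros H H'. apply pr_inj. destruct (le_or_lt (pr t u) (pr t' u')) as [E|E].
  - destruct (le_lt_eq _ _ E) as [E'|E']; auto. destruct (K _ _ _ _ H H' E').
  - destruct (K _ _ _ _ H' H E).
Qed.

Variable G : N -> Prop.
Context {HG : Rel1 G}.
Variable s0 : N.
Hypothesis Ps0 : P s0.

Definition node (k : N) : N :=
  nrec s0 (fun k s => mu (fun x => exists t u, splitting chi s t u /\ ((G k /\ x = u) \/ (~ G k /\ x = t)))) k.

Local Instance Fun1_node : Fun1 node.
Proof. unfold node. def. Qed.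

Lemma node_0 : node 0 = s0.
Proof. unfold node. apply nrec_0. exact _. Qed.

Lemma node_S k : P (node k) -> exists t u, splitting chi (node k) t u /\
  ((G k /\ node (k + 1) = u) \/ (~ G k /\ node (k + 1) = t)).
Proof.
  intros Hk. unfold node at 2 3. rewrite nrec_S by exact _. fold (node k).
  apply (mu_spec (fun x => exists t u, splitting chi (node k) t u /\ ((G k /\ x = u) \/ (~ G k /\ x = t))));
    [exact _|].
  destruct (splitting_exists _ Hk) as (t & u & H). destruct (classic (G k)); eauto 8.
Qed.

Lemma P_node k : P (node k).
Proof.
  revert k. apply (ind (fun k => P (node k))); [exact _| |].
  - rewrite node_0. exact Ps0.
  - intros k Hk. destruct (node_S k Hk) as (t & u & (_ & _ & _ & H1 & H2 & _) & [[_ ->]|[_ ->]]);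
      apply chi_1; auto.
Qed.

Lemma str_node k : str (node k).
Proof. apply P_tree, P_node. Qed.

Lemma node_step k : ext (node k) (node (k + 1)).
Proof. destruct (node_S _ (P_node k)) as (t & u & (H1 & H2 & _) & [[_ ->]|[_ ->]]); auto. Qed.

Lemma len_node k : k <= len (node k).
Proof.
  revert k. apply (ind (fun k => k <= len (node k))); [exact _|apply zero_le|].
  intros k Hk. apply lt_iff. eapply le_lt_trans; [exact Hk|].
  assert (He := node_step k).
  destruct (le_or_lt (len (node (k + 1))) (len (node k))) as [H|H]; auto. exfalso.
  assert (E := ext_len_eq _ _ (str_node k) He H).
  destruct (node_S _ (P_node k)) as (t & u & (H1 & H2 & [H3 H4] & _) & [[_ E']|[_ E']]);
    rewrite <- E in E'; subst; auto.
Qed.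

Definition branch (p : N) : N := chain_limit node p.
Global Instance Fun1_branch : Fun1 branch.
Proof. apply Fun1_chain_limit. exact _. Qed.

Lemma branch_path : path branch P.
Proof.
  intros m. eapply P_tree; [apply (P_node m)|].
  apply chain_limit_below; auto using str_node, node_step, len_node; exact _.
Qed.

Lemma node_branch k m : len (node k) <= m -> ext (node k) (restr branch m).
Proof. apply chain_limit_above; auto using str_node, node_step, len_node; exact _. Qed.

Lemma branch_s0 i : i < len s0 -> branch i = nth s0 i.
Proof.
  intros Hi. pose proof (chain_limit_eq node str_node node_step len_node 0 i) as H.
  rewrite node_0 in H. exact (H Hi).
Qed.

Definition bits (k : N) : N := restr (fun i => ite (G i) 1 0) k.

Lemma len_bits k : len (bits k) = k.
Proof. apply len_restr. exact _. Qed.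

Lemma nth_bits k q : q < k -> (nth (bits k) q = 1 <-> G q).
Proof.
  intros Hq. unfold bits. rewrite nth_restr by (exact _ || exact Hq).
  destruct (classic (G q)) as [H|H]; [rewrite ite_true by exact H|rewrite ite_false by exact H].
  - tauto.
  - split; [intros E; destruct (one_ne_zero (eq_sym E))|tauto].
Qed.

Lemma reach_node k : reach (dstep chi) (pr s0 0) (pr (node k) (bits k)).
Proof.
  revert k. apply (ind (fun k => reach (dstep chi) (pr s0 0) (pr (node k) (bits k)))); [exact _| |].
  - unfold bits. rewrite node_0, restr_0 by exact _. apply reach_refl.
  - intros k H. eapply reach_step; [exact H|].
    destruct (node_S _ (P_node k)) as (t & u & Hs & Hk). exists (node k), (bits k), t, u.
    split; auto. split; auto. unfold bits. rewrite restr_S by exact _.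
    destruct Hk as [[HGk ->]|[HGk ->]]; [right; rewrite ite_true by exact HGk|left; rewrite ite_false by exact HGk]; auto.
Qed.

(** The two successors offered by a splitting are incompatible, so only the one chosen by the branch
    can be a prefix of it. *)
Lemma reach_branch s b m : reach (dstep chi) (pr s0 0) (pr s b) -> ext s (restr branch m) ->
  exists k, s = node k /\ b = bits k.
Proof.
  intros H Hm. revert s b m H Hm.
  enough (K : forall z, reach (dstep chi) (pr s0 0) z -> forall s b m, z = pr s b ->
    ext s (restr branch m) -> exists k, s = node k /\ b = bits k) by eauto.
  apply (reach_ind (dstep chi) (fun z => forall s b m, z = pr s b ->
    ext s (restr branch m) -> exists k, s = node k /\ b = bits k)).
  - intros s b m E _. apply pr_inj in E. destruct E as [<- <-]. exists 0.
    unfold bits. rewrite node_0, restr_0 by exact _. auto.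
  - intros z z' _ IH (s & b & t & u & -> & Hs & Hz') s' b' m -> Hm.
    assert (Hs' : ext s s').
    { destruct Hz' as [E|E]; apply pr_inj in E; destruct E as [-> _]; apply Hs. }
    destruct (IH s b m eq_refl (ext_trans _ _ _ Hs' Hm)) as (k & -> & ->).
    destruct (node_S _ (P_node k)) as (t' & u' & Hs2 & Hk).
    destruct (splitting_unique _ _ _ _ _ Hs Hs2) as [<- <-]. clear Hs2.
    (* The restriction is lengthened until it extends [node (k + 1)] as well as [s'], which makes
       these two comparable. *)
    assert (Hn : exists m', m <= m' /\ ext (node (k + 1)) (restr branch m')).
    { exists (m + len (node (k + 1))). split; [apply le_add_r|]. apply node_branch, le_add_l. }
    destruct Hn as (m' & Hm' & Hn).
    assert (Hm2 : ext s' (restr branch m')) by (eapply ext_trans; [exact Hm|apply restr_mono; auto; exact _]).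
    assert (Hb : bits (k + 1) = sc (bits k) (ite (G k) 1 0)) by (unfold bits; rewrite restr_S by exact _; reflexivity).
    destruct Hs as (_ & _ & [Hi1 Hi2] & _).
    destruct Hz' as [E|E]; apply pr_inj in E; destruct E as [-> ->]; exists (k + 1); rewrite Hb;
      destruct Hk as [[HGk E]|[HGk E]]; rewrite E in *;
      first [rewrite ite_true by exact HGk | rewrite ite_false by exact HGk]; auto;
      destruct (ext_comparable _ _ _ Hn Hm2); contradiction.
Qed.

Variable e : N.
Hypothesis He : forall n, (P n -> comp (gr branch) e n 1) /\ (~ P n -> comp (gr branch) e n 0).

Lemma fact_chi m n b : fact (restr branch m) e n b -> chi n b.
Proof.
  intros H. apply fact_sound in H; [|exact _]. destruct (He n) as [H1 H0].
  destruct (classic (P n)) as [K|K]; [left|right]; split; auto; eapply comp_unique; eauto.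
Qed.

Lemma chi_fact n b : chi n b -> exists m, fact (restr branch m) e n b.
Proof. intros [[H ->]|[H ->]]; apply fact_complete; try exact _; apply He; auto. Qed.

Lemma fact_branch_mono m m' n b : m <= m' -> fact (restr branch m) e n b -> fact (restr branch m') e n b.
Proof. intros H. apply fact_mono; [apply str_restr; exact _|apply restr_mono; auto; exact _]. Qed.

(** The clause on smaller pairs calls for boundedly many computations; induction on the bound finds
    one finite part of the branch that suffices for all of them. *)
Lemma splitting_fact s t u : splitting chi s t u ->
  exists m, splitting (fact (restr branch m) e) s t u.
Proof.
  intros (H1 & H2 & H3 & H4 & H5 & H6).
  assert (K : forall c, c <= pr t u -> exists m, forall t' u', pr t' u' < c ->
    ext s t' -> ext s u' -> incompatible t' u' ->
    fact (restr branch m) e t' 0 \/ fact (restr branch m) e u' 0).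
  { unfold incompatible. apply (ind (fun c => c <= pr t u -> exists m, forall t' u', pr t' u' < c ->
      ext s t' -> ext s u' -> ~ ext t' u' /\ ~ ext u' t' ->
      fact (restr branch m) e t' 0 \/ fact (restr branch m) e u' 0)); [def| |].
    - intros _. exists 0. intros t' u' H. destruct (nlt_0 _ H).
    - intros c IH Hc. destruct IH as (m & Hm); [eapply le_trans; [apply le_succ|exact Hc]|].
      assert (Q : exists m', forall t' u', pr t' u' = c ->
        ext s t' -> ext s u' -> ~ ext t' u' /\ ~ ext u' t' ->
        fact (restr branch m') e t' 0 \/ fact (restr branch m') e u' 0).
      { destruct (classic (exists t' u', pr t' u' = c /\ ext s t' /\ ext s u' /\ incompatible t' u'))
          as [(t' & u' & E & K1 & K2 & K3)|K].
        - subst c. destruct (H6 t' u') as [H|H]; auto; [apply lt_iff; auto| |];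
            apply chi_fact in H; destruct H as (m' & Hm'); exists m'; intros t2 u2 E;
            apply pr_inj in E; destruct E as [-> ->]; auto.
        - exists 0. intros t' u' E K1 K2 K3. exfalso. apply K. exists t', u'. unfold incompatible. auto. }
      destruct Q as (m' & Hm'). exists (m + m'). intros t' u' Hlt K1 K2 K3.
      apply lt_succ in Hlt. destruct Hlt as [Hlt|E].
      + destruct (Hm t' u' Hlt K1 K2 K3); [left|right]; eapply fact_branch_mono; eauto using le_add_r.
      + destruct (Hm' t' u' E K1 K2 K3); [left|right]; eapply fact_branch_mono; eauto using le_add_l. }
  destruct (K _ (le_refl _)) as (m & Hm). apply chi_fact in H4. apply chi_fact in H5.
  destruct H4 as (m1 & Hm1), H5 as (m2 & Hm2). exists (m + m1 + m2).
  assert (E1 : m <= m + m1 + m2) by (exists (m1 + m2); ring).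
  assert (E2 : m1 <= m + m1 + m2) by (exists (m + m2); ring).
  assert (E3 : m2 <= m + m1 + m2) by (exists (m + m1); ring).
  split; auto. split; auto. split; auto.
  split; [exact (fact_branch_mono _ _ _ _ E2 Hm1)|]. split; [exact (fact_branch_mono _ _ _ _ E3 Hm2)|].
  intros t' u' K1 K2 K3 K4. destruct (Hm t' u' K1 K2 K3 K4); [left|right];
    apply (fact_branch_mono m); auto.
Qed.

Lemma reach_fact z : reach (dstep chi) (pr s0 0) z ->
  exists m, reach (dstep (fact (restr branch m) e)) (pr s0 0) z.
Proof.
  assert (D : forall m, Rel2 (dstep (fact (restr branch m) e))) by (intros m; apply Rel2_dstep; exact _).
  assert (DR : Rel1 (fun z => exists m, reach (dstep (fact (restr branch m) e)) (pr s0 0) z)).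
  { unfold dstep, splitting, incompatible. def. }
  apply (reach_ind (dstep chi) (fun z => exists m, reach (dstep (fact (restr branch m) e)) (pr s0 0) z)).
  - exists 0. apply reach_refl.
  - intros r r' _ (m & Hm) (s & b & t & u & -> & Hs & Hr').
    destruct (splitting_fact _ _ _ Hs) as (m' & Hm'). exists (m + m').
    apply reach_step with (v := pr s b).
    + eapply reach_mono; [|exact Hm]. intros x y. apply dstep_mono.
      intros n c. apply fact_branch_mono, le_add_r.
    + exists s, b, t, u. split; auto. split; auto. eapply splitting_mono; [|exact Hm'].
      intros n c. apply fact_branch_mono, le_add_l.
Qed.

Lemma decodes_sound m b : decodes (fact (restr branch m) e) s0 b (restr branch m) -> b = bits (len b).
Proof.
  intros (s & Hs & Hm). destruct (reach_branch s b m) as (k & _ & ->); auto.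
  - eapply reach_mono; [|exact Hs]. intros x y. apply dstep_mono. intros n c. apply fact_chi.
  - rewrite len_bits. reflexivity.
Qed.

(** Finitely many splittings use a finite part of the branch, and facts persist, so the decoding
    also succeeds at arbitrarily late stages. *)
Lemma decodes_complete k n : exists m, n <= m /\ decodes (fact (restr branch m) e) s0 (bits k) (restr branch m).
Proof.
  destruct (reach_fact _ (reach_node k)) as (m & Hm).
  exists (n + m + len (node k)). split; [exists (m + len (node k)); ring|].
  exists (node k). split; [|apply node_branch, le_add_l].
  eapply reach_mono; [|exact Hm]. intros x y. apply dstep_mono. intros i c. apply fact_branch_mono.
  exists (n + len (node k)). ring.
Qed.

End PerfectTree.

End Coding.

(** * The tree of stacks of requirements *)

Section Stacks.

Context {A : structure} {HA : aca_model A}.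
Local Notation N := (num_sort A).
Local Notation "x \in X" := (s_mem A x X) (at level 70) : model_scope.
Local Open Scope model_scope.
Add Ring model_ring : (model_semiring (A := A)).

(** The requirement with number [r = (e, s0)] is that the tree computed by [e] from the path, if it
    is perfect, is not one from whose root [s0] the path follows the bits of the hidden set. *)
Definition event (r s k b : N) : Prop := decodes (fact s (fs r)) (sn r) b s /\ len b = k + 1.
Global Instance Rel4_event : Rel4 event.
Proof. unfold event, decodes, dstep, splitting, incompatible. def. Qed.

(** Positions [(n, 0)] of a path carry an arbitrary set, position [1] the index of a tree,
    and the other positions the entries of the stack. *)
Definition stack_pos (p : N) : Prop := ~ (exists n, p = pr n 0) /\ p <> 1.
Global Instance Rel1_stack_pos : Rel1 stack_pos.
Proof. unfold stack_pos. def. Qed.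

(** A stack is a string of entries [(m, (k, c))]. The requirement at its level is waiting for an
    [event] about [k] if [m = 0], and has seen one with the bits [b] if [m = b + 1];
    [c] is a claimed value of the hidden function at this level. *)
Definition push (L s x : N) : N := ite (stack_pos (len s)) (sc L (pr 0 x)) L.
Global Instance Fun3_push : Fun3 push.
Proof. unfold push. def. Qed.

Definition can_act (L s r b : N) : Prop :=
  r < len L /\ fs (nth L r) = 0 /\ event r s (fs (sn (nth L r))) b.
Global Instance Rel4_can_act : Rel4 can_act.
Proof. unfold can_act. def. Qed.

Definition actor (L s : N) : N := mu (fun r => exists b, can_act L s r b).
Global Instance Fun2_actor : Fun2 actor.
Proof. unfold actor. def. Qed.
Definition seen (L s : N) : N := mu (fun b => can_act L s (actor L s) b).
Global Instance Fun2_seen : Fun2 seen.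
Proof. unfold seen. def. Qed.

Definition act (L r b : N) : N := sc (pre L r) (pr (b + 1) (sn (nth L r))).
Global Instance Fun3_act : Fun3 act.
Proof. unfold act. def. Qed.

(** The first level that can act does so, and all higher levels are discarded. *)
Definition fire (L s : N) : N :=
  ite (exists r b, can_act L s r b) (act L (actor L s) (seen L s)) L.
Global Instance Fun2_fire : Fun2 fire.
Proof. unfold fire. def. Qed.

Definition stack (s : N) : N := srec 0 (fun L s x => fire (push L s x) (sc s x)) s.
Global Instance Fun1_stack : Fun1 stack.
Proof. unfold stack. def. Qed.

Lemma stack_0 : stack 0 = 0.
Proof. unfold stack. apply srec_0. exact _. Qed.
Lemma stack_sc s x : str s -> stack (sc s x) = fire (push (stack s) s x) (sc s x).
Proof. intros Hs. unfold stack. rewrite srec_sc by (exact _ || exact Hs). reflexivity. Qed.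

Lemma fire_cases L s :
  (fire L s = L /\ forall r b, ~ can_act L s r b) \/
  (exists r b, fire L s = act L r b /\ can_act L s r b /\
    forall r' b', r' < r -> ~ can_act L s r' b').
Proof.
  unfold fire. destruct (classic (exists r b, can_act L s r b)) as [H|H].
  - right. rewrite ite_true by exact H. exists (actor L s), (seen L s). split; auto.
    assert (K : exists b, can_act L s (actor L s) b).
    { apply (mu_spec (fun r => exists b, can_act L s r b)); auto. exact _. }
    split.
    + apply (mu_spec (fun b => can_act L s (actor L s) b)); auto. exact _.
    + intros r' b' Hr Hc. apply (le_not_lt (actor L s) r'); auto. apply mu_least; [exact _|eauto].
  - left. rewrite ite_false by exact H. split; auto. intros r b Hc. apply H. eauto.
Qed.

Lemma str_act L r b : str L -> r < len L -> str (act L r b) /\ len (act L r b) = r + 1 /\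
  ext (pre L r) (act L r b) /\ nth (act L r b) r = pr (b + 1) (sn (nth L r)).
Proof.
  intros HL Hr. apply lt_le in Hr. assert (Hp := str_pre L r HL Hr).
  destruct (pre_spec L r HL Hr) as [_ E]. unfold act.
  split; [apply str_sc; auto|]. split; [rewrite len_sc, E; auto|].
  split; [apply ext_one|]. pose proof (nth_last (pre L r) (pr (b + 1) (sn (nth L r))) Hp) as Q.
  rewrite E in Q. exact Q.
Qed.

Lemma push_cases L s x :
  (stack_pos (len s) /\ push L s x = sc L (pr 0 x)) \/ (~ stack_pos (len s) /\ push L s x = L).
Proof.
  unfold push. destruct (classic (stack_pos (len s))) as [H|H];
    [left; rewrite ite_true by exact H|right; rewrite ite_false by exact H]; auto.
Qed.

Lemma ext_push L s x : ext L (push L s x).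
Proof. destruct (push_cases L s x) as [[_ ->]|[_ ->]]; [apply ext_one|apply ext_refl]. Qed.

Lemma str_fire L s : str L -> str (fire L s).
Proof.
  intros HL. destruct (fire_cases L s) as [[-> _]|(r & b & -> & (Hr & _) & _)]; auto. apply str_act; auto.
Qed.

Lemma str_push L s x : str L -> str (push L s x).
Proof. intros HL. eapply str_ext; [exact HL|apply ext_push]. Qed.

Lemma str_stack s : str s -> str (stack s).
Proof.
  revert s. apply (str_ind (fun s => str (stack s))).
  - rewrite stack_0. apply str_0.
  - intros s x Hs H. rewrite stack_sc by exact Hs. apply str_fire, str_push, H.
Qed.

(** The action turns the first component of entry [r], which lies in [l], from 0 into [b + 1]. *)
Lemma act_breaks l L r b : str L -> ext l L -> r < len l -> fs (nth L r) = 0 -> ~ ext l (act L r b).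
Proof.
  intros HL Hl Hr H0 Hx. assert (Sl := str_prefix _ _ Hl HL).
  destruct (str_act L r b HL) as (S1 & S2 & S3 & S4).
  { eapply lt_le_trans; [exact Hr|apply ext_len; auto]. }
  assert (E2 : nth (act L r b) r = nth L r).
  { rewrite (nth_ext l (act L r b) r), (nth_ext l L r); auto. }
  rewrite E2 in S4. rewrite S4, fs_pr in H0. exact (succ_ne _ H0).
Qed.

(** A part [l] of the stack survives unless one of its levels acts. *)
Lemma fire_keeps l L s : str L -> ext l L ->
  ext l (fire L s) \/
  exists r b, r < len l /\ can_act L s r b /\ fire L s = act L r b /\ ~ ext l (fire L s).
Proof.
  intros HL Hl. assert (Sl := str_prefix _ _ Hl HL).
  destruct (fire_cases L s) as [[-> _]|(r & b & E & Hc & _)]; auto.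
  destruct Hc as (Hr & H0 & He). destruct (str_act L r b HL Hr) as (S1 & S2 & S3 & S4).
  destruct (le_or_lt (len l) r) as [K|K].
  - left. rewrite E. eapply ext_trans; [|exact S3].
    destruct (pre_spec L r HL (lt_le _ _ Hr)) as [E1 E2].
    apply (ext_of_len _ _ L); auto. rewrite E2. exact K.
  - right. exists r, b. split; auto. split; [split; auto|]. split; auto. rewrite E.
    apply act_breaks; auto.
Qed.

Definition claim (L j : N) : N := sn (sn (nth L j)).
Global Instance Fun2_claim : Fun2 claim.
Proof. unfold claim. def. Qed.

Variable K : N -> N -> Prop.
Context {HK : Rel2 K}.

(** No claim made on the stack is visibly wrong: the claimed values are on a path of [K i], and the
    bits seen by the levels that have acted are not those of the graph of the hidden function. *)
Definition ok (s : N) : Prop := 1 < len s ->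
  (forall m, m <= len (stack s) -> K (nth s 1) (restr (claim (stack s)) m)) /\
  (forall r b, r < len (stack s) -> fs (nth (stack s) r) = b + 1 -> len b <= len (stack s) ->
    ~ (forall q, q < len b -> (nth b q = 1 <-> gr (claim (stack s)) q))).

Global Instance Rel1_ok : Rel1 ok.
Proof. unfold ok, gr. def. Qed.

Definition tree (s : N) : Prop := str s /\ forall t, ext t s -> ok t.
Global Instance Rel1_tree : Rel1 tree.
Proof. unfold tree. def. Qed.

Lemma tree_is_tree : is_tree tree.
Proof.
  intros s [Hs H]. split; auto. intros t Ht. split; [eapply str_prefix; eauto|].
  intros u Hu. apply H. eapply ext_trans; eauto.
Qed.

(** The numbers [pr n 0] are [n * n + n] and lie at least two apart. Hence of two adjacent positions
    beyond 1, at least one belongs to the stack. *)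
Lemma pr_0_gap (x y : N) : pr x 0 + 1 <> pr y 0.
Proof.
  intros E. unfold pr in E. rewrite !add_0_r in E. destruct (le_or_lt y x) as [(z & ->)|H].
  - apply (lt_irrefl (y * y + y)). apply lt_iff. exists (y * z + y * z + z * z + z).
    transitivity ((y + z) * (y + z) + (y + z) + 1); [symmetry; exact E|ring].
  - apply lt_iff in H. destruct H as (z & ->).
    apply (succ_ne (x + x + x * z + x * z + z + z + z + z * z)).
    apply (add_cancel_r _ _ (x * x + x + 1)).
    transitivity ((x + 1 + z) * (x + 1 + z) + (x + 1 + z)); [ring|rewrite <- E; ring].
Qed.

Lemma not_stack_pos p : 1 < p -> ~ stack_pos p -> exists n, p = pr n 0.
Proof.
  intros Hp H. apply NNPP. intros Hn. apply H. split; auto. intros ->. exact (lt_irrefl _ Hp).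
Qed.

Lemma stack_pos_next p : 1 < p -> stack_pos p \/ stack_pos (p + 1).
Proof.
  intros Hp. apply NNPP. intros H.
  destruct (not_stack_pos p) as (x & Ex); [auto|tauto|].
  destruct (not_stack_pos (p + 1)) as (y & Ey); [|tauto|].
  - eapply lt_trans; [exact Hp|apply lt_succ_diag].
  - apply (pr_0_gap x y). rewrite <- Ex. exact Ey.
Qed.

Lemma stack_pos_unbounded n : exists p, n <= p /\ stack_pos p.
Proof.
  destruct (stack_pos_next (n + 1 + 1)) as [H|H].
  - apply lt_iff. exists n. ring.
  - exists (n + 1 + 1). split; auto. exists (1 + 1). ring.
  - exists (n + 1 + 1 + 1). split; auto. exists (1 + 1 + 1). ring.
Qed.

(** * Finite injury along a path of the tree *)

Section Injury.

Variable y : N -> N.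
Context {Hy : Fun1 y}.
Hypothesis y_path : path y tree.

Definition stack_at (n : N) : N := stack (restr y n).
Local Instance Fun1_stack_at : Fun1 stack_at.
Proof. unfold stack_at. def. Qed.

Definition pushed (n : N) : N := push (stack_at n) (restr y n) (y n).

Lemma stack_at_S n : stack_at (n + 1) = fire (pushed n) (restr y (n + 1)).
Proof.
  unfold stack_at, pushed. rewrite restr_S by exact _. rewrite stack_sc by (apply str_restr; exact _).
  reflexivity.
Qed.

Lemma str_stack_at n : str (stack_at n).
Proof. apply str_stack, str_restr. exact _. Qed.
Lemma ext_pushed n : ext (stack_at n) (pushed n).
Proof. apply ext_push. Qed.
Lemma str_pushed n : str (pushed n).
Proof. eapply str_ext; [apply str_stack_at|apply ext_pushed]. Qed.

Definition stable (l n : N) : Prop := forall n', n <= n' -> ext l (stack_at n').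
Local Instance Rel2_stable : Rel2 stable.
Proof. unfold stable. def. Qed.

Lemma stable_str l n : stable l n -> str l.
Proof. intros H. eapply str_prefix; [apply (H n (le_refl n))|apply str_stack_at]. Qed.

Lemma stable_later l n n' : stable l n -> n <= n' -> stable l n'.
Proof. intros H Hn m Hm. apply H. eapply le_trans; eauto. Qed.

Lemma stable_step l n : (forall n', n <= n' -> ext l (stack_at n') -> ext l (stack_at (n' + 1))) ->
  ext l (stack_at n) -> stable l n.
Proof.
  intros H H0 n' (z & ->). revert z. apply (ind (fun z => ext l (stack_at (n + z)))); [exact _| |].
  - rewrite add_0_r. exact H0.
  - intros z Hz. rewrite add_S_r. apply H; auto. apply le_add_r.
Qed.

(** An action at level [r] leaves [r + 1] levels, and [r] cannot lie inside the stable part, which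
    the action would break. *)
Lemma grows l n : stable l n -> len l < len (pushed n) -> len l < len (stack_at (n + 1)).
Proof.
  intros Hl Hn. rewrite stack_at_S. pose proof (Hl (n + 1) (le_succ n)) as E. rewrite stack_at_S in E.
  assert (Sp := str_pushed n). assert (Sl := stable_str _ _ Hl).
  destruct (fire_cases (pushed n) (restr y (n + 1))) as [[-> _]|(r & b & E' & Hc & _)]; auto.
  destruct Hc as (Hr & H0 & _). destruct (str_act _ r b Sp Hr) as (S1 & S2 & _ & S4).
  rewrite E' in *. rewrite S2. apply lt_succ_le. destruct (le_or_lt (len l) r) as [|Q]; auto. exfalso.
  revert E. apply act_breaks; auto. eapply ext_trans; [apply (Hl n (le_refl n))|apply ext_pushed].
Qed.

(** The finite injury argument: once the levels below are stable, the next level is eventually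
    occupied, is never discarded again, and changes at most once more. *)
Lemma stabilizes e : exists l n, len l = e /\ stable l n.
Proof.
  revert e. apply (ind (fun e => exists l n, len l = e /\ stable l n)); [exact _| |].
  - exists 0, 0. split; [apply len_0|]. intros n' _. apply str_stack_at.
  - intros e (l & n & <- & Hl). assert (Sl := stable_str _ _ Hl).
    assert (H1 : exists n1, n <= n1 /\ len l < len (stack_at n1)).
    { destruct (stack_pos_unbounded n) as (p & Hp & Hpos). exists (p + 1).
      split; [eapply le_trans; [exact Hp|apply le_succ]|]. apply grows; [eapply stable_later; eauto|].
      unfold pushed. destruct (push_cases (stack_at p) (restr y p) (y p)) as [[_ ->]|[H _]].
      - rewrite len_sc by apply str_stack_at. apply lt_succ_le, ext_len; auto.
      - rewrite len_restr in H by exact _. contradiction. }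
    destruct H1 as (n1 & Hn1 & H1). assert (Hl1 := stable_later _ _ _ Hl Hn1). clear n Hl Hn1.
    assert (H2 : forall n', n1 <= n' -> len l < len (stack_at n')).
    { intros n' (z & ->). revert z. apply (ind (fun z => len l < len (stack_at (n1 + z)))); [exact _| |].
      - rewrite add_0_r. exact H1.
      - intros z Hz. rewrite add_S_r. apply grows; [eapply stable_later; [exact Hl1|apply le_add_r]|].
        eapply lt_le_trans; [exact Hz|]. apply ext_len; [apply str_stack_at|apply ext_pushed]. }
    (* An action above level [len l] keeps this prefix and one below it is excluded by [H2], so only
       the level itself can change its entry, from waiting to acted. *)
    assert (H3 : forall n', n1 <= n' -> forall l2, ext l2 (stack_at n') -> len l2 = len l + 1 ->
      ext l2 (stack_at (n' + 1)) \/
      (fs (nth l2 (len l)) = 0 /\ fs (nth (stack_at (n' + 1)) (len l)) <> 0)).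
    { intros n' Hn' l2 Hl2 El2. rewrite stack_at_S. assert (Sp := str_pushed n').
      assert (Sl2 := str_prefix _ _ Hl2 (str_stack_at n')).
      assert (Hx : ext l2 (pushed n')) by (eapply ext_trans; [exact Hl2|apply ext_pushed]).
      destruct (fire_keeps l2 (pushed n') (restr y (n' + 1)) Sp Hx) as [H|(r & b & Hr & Hc & E & _)]; auto.
      right. destruct Hc as (Hr' & H0 & _). destruct (str_act _ r b Sp Hr') as (S1 & S2 & _ & S4).
      rewrite E. assert (r = len l).
      { apply le_antisym; [apply lt_succ_le; rewrite <- El2; exact Hr|].
        apply lt_succ_le. rewrite <- S2, <- E, <- stack_at_S. apply H2. eapply le_trans; [exact Hn'|apply le_succ]. }
      subst r. rewrite S4, fs_pr. split; [|apply succ_ne]. rewrite <- H0. f_equal. symmetry.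
      apply nth_ext; auto. }
    assert (Hpre : forall n', n1 <= n' -> ext (pre (stack_at n') (len l + 1)) (stack_at n') /\
        len (pre (stack_at n') (len l + 1)) = len l + 1).
    { intros n' Hn'. apply pre_spec; [apply str_stack_at|apply lt_iff, H2, Hn']. }
    assert (Hnth : forall n', n1 <= n' ->
        nth (pre (stack_at n') (len l + 1)) (len l) = nth (stack_at n') (len l)).
    { intros n' Hn'. destruct (Hpre n' Hn') as [E1 E2]. symmetry. apply nth_ext; auto.
      - eapply str_prefix; [exact E1|apply str_stack_at].
      - rewrite E2. apply lt_succ_diag. }
    (* If the level is ever found to have acted, its entry is final from then on; otherwise it waits
       for ever with the entry it has at [n1]. *)
    destruct (classic (exists n2, n1 <= n2 /\ fs (nth (stack_at n2) (len l)) <> 0)) as [(n2 & Hn2 & Hd)|Hw].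
    + exists (pre (stack_at n2) (len l + 1)), n2. destruct (Hpre n2 Hn2) as [E1 E2]. split; auto.
      apply stable_step; auto. intros n' Hn' Hx.
      destruct (H3 n' (le_trans _ _ _ Hn2 Hn') _ Hx E2) as [|[Hz _]]; auto.
      rewrite Hnth in Hz by exact Hn2. contradiction.
    + exists (pre (stack_at n1) (len l + 1)), n1. destruct (Hpre n1 (le_refl n1)) as [E1 E2]. split; auto.
      apply stable_step; auto. intros n' Hn' Hx.
      destruct (H3 n' Hn' _ Hx E2) as [|[_ Hz]]; auto. exfalso. apply Hw. exists (n' + 1). split; auto.
      eapply le_trans; [exact Hn'|apply le_succ].
Qed.

Definition hidden (j : N) : N :=
  mu (fun c => exists l n, len l = j + 1 /\ stable l n /\ c = claim l j).
Global Instance Fun1_hidden : Fun1 hidden.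
Proof. unfold hidden. def. Qed.

Lemma claim_ext l L j : str l -> ext l L -> j < len l -> claim L j = claim l j.
Proof. intros Hl H Hj. unfold claim. rewrite (nth_ext l L j); auto. Qed.

Lemma hidden_claim l n j : stable l n -> j < len l -> hidden j = claim l j.
Proof.
  intros Hl Hj.
  assert (Q : exists l n, len l = j + 1 /\ stable l n /\ hidden j = claim l j).
  { apply (mu_spec (fun c => exists l n, len l = j + 1 /\ stable l n /\ c = claim l j)); [exact _|].
    destruct (stabilizes (j + 1)) as (l' & n' & H). exists (claim l' j), l', n'. tauto. }
  destruct Q as (l' & n' & E & Hl' & ->).
  (* At stage [n + n'] both stable strings are prefixes of the same stack. *)
  pose proof (Hl (n + n') (le_add_r _ _)) as H1. pose proof (Hl' (n + n') (le_add_l _ _)) as H2.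
  rewrite <- (claim_ext l (stack_at (n + n')) j), <- (claim_ext l' (stack_at (n + n')) j); auto.
  - eapply stable_str; eauto.
  - rewrite E. apply lt_succ_diag.
  - eapply stable_str; eauto.
Qed.

Lemma stable_claims m : exists n, 1 < n /\ m <= len (stack_at n) /\
  forall j, j < m -> claim (stack_at n) j = hidden j.
Proof.
  (* The two extra stages give [1 < n], since [ok] says nothing before the index at position 1 is
     present. *)
  destruct (stabilizes m) as (l & n & <- & Hl). exists (n + 1 + 1).
  assert (Hx : ext l (stack_at (n + 1 + 1))) by (apply Hl; exists (1 + 1); ring).
  split; [apply lt_iff; exists n; ring|]. split; [apply ext_len; auto; eapply stable_str; eauto|].
  intros j Hj. rewrite (claim_ext l); auto; [|eapply stable_str; eauto]. symmetry. eapply hidden_claim; eauto.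
Qed.

Lemma ok_at n : 1 < n ->
  (forall m, m <= len (stack_at n) -> K (y 1) (restr (claim (stack_at n)) m)) /\
  (forall r b, r < len (stack_at n) -> fs (nth (stack_at n) r) = b + 1 -> len b <= len (stack_at n) ->
    ~ (forall q, q < len b -> (nth b q = 1 <-> gr (claim (stack_at n)) q))).
Proof.
  intros Hn. destruct (y_path n) as [_ H]. specialize (H _ (ext_refl _)). unfold ok in H.
  rewrite len_restr, nth_restr in H by (exact _ || exact Hn). apply H, Hn.
Qed.

Lemma hidden_path : path hidden (K (y 1)).
Proof.
  intros m. destruct (stable_claims m) as (n & Hn & Hm & H). destruct (ok_at n Hn) as [Hok _].
  rewrite (restr_ext hidden (claim (stack_at n))).
  - apply Hok, Hm.
  - intros i Hi. symmetry. auto.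
Qed.

(** The stack records only the bits that were seen; tracing the construction back recovers the
    prefix at which they were decoded, so that soundness of decoding on the path applies to them. *)
Lemma acted_event s r b : str s -> r < len (stack s) -> fs (nth (stack s) r) = b + 1 ->
  exists t k, ext t s /\ event r t k b.
Proof.
  intros Hs. revert s Hs r b.
  apply (str_ind (fun s => forall r b, r < len (stack s) -> fs (nth (stack s) r) = b + 1 ->
    exists t k, ext t s /\ event r t k b)).
  - intros r b. rewrite stack_0, len_0. intros H. destruct (nlt_0 _ H).
  - intros s x Hs IH r b. rewrite stack_sc by exact Hs.
    assert (SL := str_stack s Hs). set (L := push (stack s) s x).
    assert (SP : str L) by (apply str_push, SL).
    assert (HP : forall r, r < len L -> fs (nth L r) = b + 1 -> exists t k, ext t (sc s x) /\ event r t k b).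
    { intros r' Hr' E. unfold L in Hr', E.
      destruct (push_cases (stack s) s x) as [[_ EL]|[_ EL]]; rewrite EL in Hr', E.
      - rewrite len_sc in Hr' by exact SL. apply lt_succ in Hr'. destruct Hr' as [Hr'| ->].
        + rewrite nth_sc in E by auto. destruct (IH r' b Hr' E) as (t & k & Ht & He).
          exists t, k. split; auto. apply ext_sc, Ht.
        + rewrite nth_last, fs_pr in E by auto. destruct (succ_ne b (eq_sym E)).
      - destruct (IH r' b Hr' E) as (t & k & Ht & He). exists t, k. split; auto. apply ext_sc, Ht. }
    destruct (fire_cases L (sc s x)) as [[-> _]|(r' & b' & -> & Hc & _)]; [apply HP|].
    pose proof Hc as (Hr' & _ & He). destruct (str_act L r' b' SP Hr') as (S1 & S2 & S3 & S4).
    intros Hr E. rewrite S2 in Hr. apply lt_succ in Hr. destruct Hr as [Hr| ->].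
    + apply HP; [eapply lt_trans; eauto|]. rewrite <- E. f_equal.
      destruct (pre_spec L r' SP (lt_le _ _ Hr')) as [E1 E2].
      rewrite (nth_ext (pre L r') L r), (nth_ext (pre L r') (act L r' b') r); auto;
        try (rewrite E2; exact Hr); apply str_pre; auto using lt_le.
    + rewrite S4, fs_pr in E. apply succ_inj in E. subst b'. eexists _, _. split; [apply ext_refl|exact He].
Qed.

(** The final entry of level [r = (e, s0)] is impossible either way. If it waits for ever, the
    decoding of the right bits, which happens at a late stage, would have made it act. If it has
    acted, its bits are right by soundness, which [ok] forbids once enough claims are final. *)
Lemma not_decoded (e s0 : N) :
  (forall k n, exists m, n <= m /\ decodes (fact (restr y m) e) s0 (bits (gr hidden) k) (restr y m)) ->
  (forall m b, decodes (fact (restr y m) e) s0 b (restr y m) -> b = bits (gr hidden) (len b)) -> False.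
Proof.
  intros Hc Hs. assert (HG := Rel1_gr hidden). set (r := pr e s0).
  destruct (stabilizes (r + 1)) as (l & n & El & Hl). assert (Sl := stable_str _ _ Hl).
  assert (Hr : r < len l) by (rewrite El; apply lt_succ_diag).
  destruct (zero_or_succ (fs (nth l r))) as [Hw|(b & Hd)].
  - set (k := fs (sn (nth l r))).
    (* An event about [k] needs [k + 1] bits, and a stage beyond [n] is the successor of a stage at
       which [l] is already stable. *)
    destruct (Hc (k + 1) (n + 1)) as (m & Hm & Hdec).
    assert (Hm' : exists m', m = m' + 1 /\ n <= m').
    { destruct Hm as (z & ->). exists (n + z). split; [ring|apply le_add_r]. }
    destruct Hm' as (m' & -> & Hm').
    assert (Hx : ext l (pushed m')) by (eapply ext_trans; [apply Hl, Hm'|apply ext_pushed]).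
    assert (Hact : can_act (pushed m') (restr y (m' + 1)) r (bits (gr hidden) (k + 1))).
    { split; [eapply lt_le_trans; [exact Hr|apply ext_len; auto]|]. rewrite (nth_ext l) by auto.
      split; auto. fold k. unfold event, r. rewrite fs_pr, sn_pr. split; auto. apply len_bits. exact _. }
    pose proof (Hl (m' + 1) (le_trans _ _ _ Hm' (le_succ m'))) as Hkeep. rewrite stack_at_S in Hkeep.
    (* Level [r] is able to act, so the level that does act is at most [r] and breaks the stable
       string [l]. *)
    destruct (fire_cases (pushed m') (restr y (m' + 1))) as [[_ Hno]|(r' & b' & E & Hc' & Hmin)].
    + exact (Hno _ _ Hact).
    + destruct (le_or_lt r' r) as [Hle|Hlt]; [|exact (Hmin _ _ Hlt Hact)].
      pose proof Hc' as (Hr' & H0 & _). rewrite E in Hkeep. revert Hkeep.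
      apply act_breaks; auto; [apply str_pushed|]. eapply le_lt_trans; eauto.
  - assert (Hb : b = bits (gr hidden) (len b)).
    { destruct (acted_event (restr y n) r b) as (t & k & Ht & He & _).
      - apply str_restr. exact _.
      - eapply lt_le_trans; [exact Hr|]. apply ext_len; auto. apply (Hl n (le_refl n)).
      - rewrite <- Hd. f_equal. apply nth_ext; auto. apply (Hl n (le_refl n)).
      - apply ext_restr in Ht; [|exact _]. destruct Ht as [Et _]. unfold r in He.
        rewrite fs_pr, sn_pr, Et in He. exact (Hs _ _ He). }
    (* With this many final levels the condition [len b <= len (stack s)] in [ok] holds, and the
       bits are compared with final claims only. *)
    destruct (stabilizes (r + 1 + len b)) as (l' & n' & El' & Hl'). assert (Sl' := stable_str _ _ Hl').
    set (m := n + n' + 1 + 1).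
    assert (Hx : ext l (stack_at m)) by (apply Hl; exists (n' + 1 + 1); unfold m; ring).
    assert (Hx' : ext l' (stack_at m)) by (apply Hl'; exists (n + 1 + 1); unfold m; ring).
    assert (Hlen' := ext_len _ _ Sl' Hx'). assert (Hlen := ext_len _ _ Sl Hx).
    destruct (ok_at m) as [_ Hok]; [apply lt_iff; exists (n + n'); unfold m; ring|].
    apply (Hok r b).
    + eapply lt_le_trans; eauto.
    + rewrite <- Hd. f_equal. apply nth_ext; auto.
    + eapply le_trans; [|exact Hlen']. rewrite El'. apply le_add_l.
    + intros q Hq. rewrite Hb, nth_bits by (exact _ || exact Hq). unfold gr. apply exists_iff. intros p.
      assert (E : p <= q -> claim (stack_at m) p = hidden p).
      { intros Hp. assert (Hpl : p < len l').
        { rewrite El'. eapply le_lt_trans; [exact Hp|]. eapply lt_le_trans; [exact Hq|apply le_add_l]. }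
        rewrite (claim_ext l') by auto. symmetry. eapply hidden_claim; eauto. }
      split; intros Eq; [rewrite E|rewrite <- E]; auto; rewrite Eq; apply le_pr_l.
Qed.

End Injury.

(** A node of [P] of length two determines [i] and so the hidden function; the branch of [P] that
    follows the bits of the graph of this function hides the same function and computes [P]. *)
Lemma no_pointed_subtree (P : set_sort A) :
  (forall i g g', Fun1 g -> Fun1 g' -> path g (K i) -> path g' (K i) -> forall n, g n = g' n) ->
  (forall s, s \in P -> tree s) -> is_tree (fun s => s \in P) -> (exists s, s \in P) ->
  (forall s, s \in P ->
      exists t u, t \in P /\ u \in P /\ ext s t /\ ext s u /\ incompatible t u) ->
  (forall F g, Fun1 g -> is_graph g F -> path g (fun s => s \in P) -> turing_le P F) -> False.
Proof.
  intros Huniq Hsub Htree (s & Hs) Hperf Hpt.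
  set (Q := fun s => s \in P).
  assert (H0 : Q 0) by (apply (Htree s Hs), Htree, Hs).
  (* By [len_node] this node has length at least two, so all branches above it share the index at
     position 1; the bits followed so far are arbitrary. *)
  set (s0 := node Q (fun _ => False) 0 (1 + 1)).
  assert (Hs0 : Q s0) by (apply P_node; auto; exact _).
  assert (Hlen : 1 < len s0).
  { apply lt_iff. unfold s0. apply len_node; auto; exact _. }
  set (y0 := branch Q (fun _ => False) s0).
  assert (Hy0 : Fun1 y0) by (apply Fun1_branch; exact _).
  assert (Py0 : path y0 tree) by (intros n; apply Hsub; apply branch_path; auto; exact _).
  set (h := hidden y0). assert (Hh : Fun1 h) by (apply Fun1_hidden; auto).
  assert (Ph := hidden_path y0 Py0). fold h in Ph.
  assert (HG : Rel1 (gr h)) by (apply Rel1_gr; auto).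
  set (y1 := branch Q (gr h) s0).
  assert (Hy1 : Fun1 y1) by (apply Fun1_branch; exact _).
  assert (Qy1 : path y1 Q) by (apply branch_path; auto; exact _).
  assert (Py1 : path y1 tree) by (intros n; apply Hsub, Qy1).
  assert (Hh1 : Fun1 (hidden y1)) by (apply Fun1_hidden; auto).
  assert (Ph1 := hidden_path y1 Py1).
  assert (E : hidden y1 = h).
  { assert (E1 : y1 1 = y0 1) by (unfold y0, y1; rewrite !branch_s0; auto; exact _).
    rewrite E1 in Ph1. extensionality n. exact (Huniq _ _ _ Hh1 Hh Ph1 Ph n). }
  destruct (graph_exists y1) as (F & HF).
  destruct (Hpt F y1 Hy1 HF Qy1) as (e & He).
  assert (EF : (fun q => q \in F) = gr y1).
  { extensionality q. apply propositional_extensionality. apply HF. }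
  rewrite EF in He.
  apply (not_decoded y1 Py1 e s0); rewrite E.
  - intros k n. apply (decodes_complete Q); auto; exact _.
  - intros m b. apply (decodes_sound Q); auto; exact _.
Qed.

End Stacks.

(** * Paths of the tree of stacks above a given set *)

Section Cofinality.

Context {A : structure} {HA : aca_model A}.
Local Notation N := (num_sort A).
Local Notation "x \in X" := (s_mem A x X) (at level 70) : model_scope.
Local Open Scope model_scope.
Add Ring model_ring : (model_semiring (A := A)).

Variable K : N -> N -> Prop.
Context {HK : Rel2 K}.
Variable X : set_sort A.

Definition compat (s : N) : Prop :=
  forall n, pr n 0 < len s -> nth s (pr n 0) = ite (n \in X) 0 1.
Global Instance Rel1_compat : Rel1 compat.
Proof. unfold compat. def. Qed.

(** The last entry is left unchecked: what an extension does to the stack has to be known first, and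
    is then used to show that the extension is [ok]. *)
Definition preok (s : N) : Prop := str s /\ forall t, ext t s -> t <> s -> ok K t.
Global Instance Rel1_preok : Rel1 preok.
Proof. unfold preok. def. Qed.

(** At [t], the level placed on the stack by the entry [(k, c)] after [s] acts with the bits [b]. *)
Definition acts_after (s c k t b : N) : Prop :=
  ext (sc s (pr k c)) t /\ compat t /\ preok t /\
  stack t = sc (stack s) (pr (b + 1) (pr k c)) /\ len b = k + 1.
Global Instance Rel5_acts_after : Rel5 acts_after.
Proof. unfold acts_after. def. Qed.

(** The countably many sets, uniformly arithmetical in [X], from which the hidden function has to
    differ if the construction of a path is to succeed. *)
Definition candidate (q k : N) : Prop :=
  exists t b, acts_after (fs q) (sn q) k t b /\ nth b k = 1.
Global Instance Rel2_candidate : Rel2 candidate.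
Proof. unfold candidate. def. Qed.

Lemma preok_prefix s t : ext s t -> preok t -> preok s.
Proof.
  intros H (Ht & Hok). split; [eapply str_prefix; eauto|]. intros r Hr Hne. apply Hok.
  - eapply ext_trans; eauto.
  - intros ->. apply Hne. apply ext_antisym; auto.
Qed.

Lemma compat_prefix s t : str t -> ext s t -> compat t -> compat s.
Proof.
  intros Ht H Hc n Hn. assert (Hs := str_prefix _ _ H Ht).
  rewrite <- (nth_ext s t) by auto. apply Hc. eapply lt_le_trans; [exact Hn|apply ext_len; auto].
Qed.

Lemma compat_sc s x : str s -> compat s ->
  (forall n, len s = pr n 0 -> x = ite (n \in X) 0 1) -> compat (sc s x).
Proof.
  intros Hs Hc Hx n Hn. rewrite len_sc in Hn by auto. apply lt_succ in Hn. destruct Hn as [Hn|E].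
  - rewrite nth_sc by auto. auto.
  - rewrite E, nth_last by auto. auto.
Qed.

Lemma tree_sc s x : tree K s -> ok K (sc s x) -> tree K (sc s x).
Proof.
  intros [Hs H] Hok. split; [apply str_sc, Hs|]. intros t Ht. apply ext_sc_inv in Ht.
  destruct Ht as [->|Ht]; auto.
Qed.

Lemma preok_sc s x : tree K s -> preok (sc s x).
Proof.
  intros [Hs H]. split; [apply str_sc, Hs|]. intros t Ht Hne. apply ext_sc_inv in Ht.
  destruct Ht as [->|Ht]; auto. contradiction.
Qed.

Lemma preok_ok_tree s : preok s -> ok K s -> tree K s.
Proof.
  intros [Hs H] Hok. split; auto. intros t Ht. destruct (classic (t = s)) as [->|]; auto.
Qed.

Lemma fire_noact (L s : N) : str L -> ext L (fire L s) -> fire L s = L.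
Proof.
  intros HL H. destruct (fire_cases L s) as [[E _]|(r & b & E & (Hr & H0 & _) & _)]; auto.
  rewrite E in H. destruct (act_breaks L L r b HL (ext_refl L) Hr H0 H).
Qed.

Variables (i : N) (g : N -> N).
Context {Hg : Fun1 g}.
Hypothesis g_path : path g (K i).
Hypothesis g_new : forall q, ~ forall k, gr g k <-> candidate q k.

Local Instance Rel1_gr_g : Rel1 (gr g) := Rel1_gr g.

Definition refuted (b : N) : Prop := exists q, q < len b /\ ~ (nth b q = 1 <-> gr g q).
Local Instance Rel1_refuted : Rel1 refuted.
Proof. unfold refuted. def. Qed.

Definition truthful (L : N) : Prop :=
  (forall j, j < len L -> claim L j = g j) /\
  (forall r b, r < len L -> fs (nth L r) = b + 1 -> refuted b).
Local Instance Rel1_truthful : Rel1 truthful.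
Proof. unfold truthful. def. Qed.

(** The bits that [ok] compares are at most as many as the claims on the stack, and these claims are
    values of [g]; a pair in the graph bounds its argument. *)
Lemma truthful_ok s : nth s 1 = i -> truthful (stack s) -> ok K s.
Proof.
  intros Hi [H1 H2] _. split.
  - intros m Hm. rewrite Hi, (restr_ext (claim (stack s)) g); [apply g_path|].
    intros j Hj. apply H1. eapply lt_le_trans; eauto.
  - intros r b Hr E Hb Hq. destruct (H2 r b Hr E) as (q & Hql & Hn). apply Hn.
    rewrite Hq by exact Hql. unfold gr. apply exists_iff. intros p.
    assert (Ep : p <= q -> claim (stack s) p = g p).
    { intros Hp. apply H1. eapply le_lt_trans; [exact Hp|]. eapply lt_le_trans; eauto. }
    split; intros Eq; [rewrite <- Ep|rewrite Ep]; auto; rewrite Eq; apply le_pr_l.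
Qed.

Lemma truthful_sc L x : str L -> truthful L -> sn (sn x) = g (len L) ->
  (forall b, fs x = b + 1 -> refuted b) -> truthful (sc L x).
Proof.
  intros HL [H1 H2] Hx Hb. split.
  - intros j Hj. rewrite len_sc in Hj by auto. apply lt_succ in Hj. unfold claim.
    destruct Hj as [Hj| ->]; [rewrite nth_sc by auto; apply H1, Hj|rewrite nth_last by auto; exact Hx].
  - intros r b Hr. rewrite len_sc in Hr by auto. apply lt_succ in Hr.
    destruct Hr as [Hr| ->]; [rewrite nth_sc by auto; apply H2, Hr|rewrite nth_last by auto; apply Hb].
Qed.

(** A forcing condition: the stack of [s] survives in all admissible extensions, not only along the
    path under construction. *)
Definition frozen (s : N) : Prop :=
  forall t, ext s t -> compat t -> preok t -> ext (stack s) (stack t).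
Local Instance Rel1_frozen : Rel1 frozen.
Proof. unfold frozen. def. Qed.

(** A string on which the first [e] requirements have been met for good. *)
Definition met (e s : N) : Prop :=
  tree K s /\ compat s /\ 1 < len s /\ nth s 1 = i /\ len (stack s) = e /\
  truthful (stack s) /\ frozen s.
Local Instance Rel2_met : Rel2 met.
Proof. unfold met. def. Qed.

Lemma pr_0_0 : pr 0 0 = (0 : N).
Proof. unfold pr. ring. Qed.

Lemma met_start : exists s, met 0 s.
Proof.
  (* Position [0 = pr 0 0] carries the membership of 0 and position 1 the index; neither belongs to
     the stack, which is therefore empty. *)
  set (x := ite (0 \in X) 0 1 : N). exists (sc (sc 0 x) i).
  assert (S1 : str (sc 0 x)) by apply str_sc, str_0.
  assert (L1 : len (sc 0 x) = 1) by (rewrite len_sc, len_0 by apply str_0; apply add_0_l).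
  assert (S2 : str (sc (sc 0 x) i)) by apply str_sc, S1.
  assert (L2 : len (sc (sc 0 x) i) = 1 + 1) by (rewrite len_sc, L1 by exact S1; auto).
  assert (P0 : ~ stack_pos (0 : N)) by (intros [H _]; apply H; exists 0; symmetry; apply pr_0_0).
  assert (P1 : ~ stack_pos (1 : N)) by (intros [_ H]; auto).
  assert (F0 : forall s : N, fire 0 s = 0).
  { intros s. apply fire_noact; [apply str_0|]. apply str_fire, str_0. }
  assert (St : stack (sc (sc 0 x) i) = 0).
  { rewrite !stack_sc by (exact S1 || apply str_0). rewrite stack_0.
    unfold push. rewrite len_0, L1, !ite_false by auto. rewrite !F0. reflexivity. }
  assert (Hn : nth (sc (sc 0 x) i) 1 = i).
  { pose proof (nth_last (sc 0 x) i S1) as H. rewrite L1 in H. exact H. }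
  assert (Ht : truthful (stack (sc (sc 0 x) i))).
  { rewrite St. split; intros j; rewrite len_0; [intros H|intros b H]; destruct (nlt_0 _ H). }
  split; [|split; [|split; [|split; [|split; [|split]]]]]; auto.
  - split; auto. intros t Hx. apply ext_sc_inv in Hx. destruct Hx as [->|Hx].
    + apply truthful_ok; auto.
    + intros H. exfalso. apply (lt_irrefl (1 : N)). eapply lt_le_trans; [exact H|].
      rewrite <- L1. apply ext_len; auto. eapply str_prefix; eauto.
  - intros n. rewrite L2. intros Hlt. assert (n = 0).
    { destruct (zero_or_succ n) as [->|(m & ->)]; auto. exfalso. revert Hlt. apply le_not_lt.
      exists (m * m + m + m + m). unfold pr. ring. }
    subst n. rewrite pr_0_0, nth_sc by (exact S1 || (rewrite L1; rewrite <- (add_0_l 1); apply zero_lt_succ)).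
    pose proof (nth_last 0 x str_0) as H. rewrite len_0 in H. exact H.
  - rewrite L2. apply lt_succ_diag.
  - rewrite St. apply len_0.
  - intros t Hx _ _. rewrite St. apply str_stack. eapply str_ext; eauto.
Qed.

(** If the next position codes a membership, its entry is dictated by [X]; nothing is pushed there,
    and an action would contradict [frozen]. The position after it belongs to the stack. *)
Lemma met_pad e s : met e s -> exists t, ext s t /\ met e t /\ stack_pos (len t).
Proof.
  intros Hm. destruct (classic (stack_pos (len s))) as [Hp|Hp]; [exists s; auto using ext_refl|].
  pose proof Hm as (Ht & Hc & Hl & Hi & He & Htr & Hf). assert (Hs : str s) by apply Ht.
  destruct (not_stack_pos _ Hl Hp) as (n & En).
  set (x := ite (n \in X) 0 1 : N). exists (sc s x). split; [apply ext_one|].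
  assert (Hc' : compat (sc s x)).
  { apply compat_sc; auto. intros m Em. rewrite En in Em. apply pr_inj in Em.
    destruct Em as [<- _]. reflexivity. }
  assert (St : stack (sc s x) = stack s).
  { pose proof (Hf (sc s x) (ext_one s x) Hc' (preok_sc s x Ht)) as H.
    rewrite stack_sc in * by exact Hs. unfold push in *. rewrite ite_false in * by exact Hp.
    apply fire_noact; auto. apply str_stack, Hs. }
  assert (Hi' : nth (sc s x) 1 = i) by (rewrite nth_sc; auto).
  split.
  - split; [|split; [|split; [|split; [|split; [|split]]]]]; rewrite ?St; auto.
    + apply tree_sc; auto. apply truthful_ok; rewrite ?St; auto.
    + rewrite len_sc by exact Hs. eapply lt_trans; [exact Hl|apply lt_succ_diag].
    + intros t Hx Hct Hpt. rewrite St. apply Hf; auto. eapply ext_trans; [apply ext_one|exact Hx].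
  - rewrite len_sc by exact Hs. destruct (stack_pos_next (len s) Hl); [contradiction|auto].
Qed.

Section Step.

Variables (e s : N).
Hypothesis s_met : met e s.
Hypothesis s_pos : stack_pos (len s).

Let s_tree : tree K s := proj1 s_met.
Let s_str : str s := proj1 s_tree.
Let L : N := stack s.
Let L_str : str L := str_stack s s_str.
Let L_len : len L = e.
Proof. apply s_met. Qed.
Let s_frozen : frozen s.
Proof. apply s_met. Qed.

Definition entry (k : N) : N := pr k (g e).
Definition waiting (k : N) : N := sc L (pr 0 (entry k)).

Lemma len_waiting k : len (waiting k) = e + 1.
Proof. unfold waiting. rewrite len_sc by exact L_str. rewrite L_len. reflexivity. Qed.
Lemma nth_waiting k : nth (waiting k) e = pr 0 (entry k).
Proof. unfold waiting. rewrite <- L_len. apply nth_last, L_str. Qed.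
Lemma str_waiting k : str (waiting k).
Proof. apply str_sc, L_str. Qed.

(** Levels below [e] cannot act because [s] is frozen, so only the new level itself can destroy
    [waiting k], and its action is the one that [acts_after] describes. *)
Lemma frozen_step k t x L' : ext (sc s (entry k)) (sc t x) -> compat (sc t x) -> preok (sc t x) ->
  stack (sc t x) = fire L' (sc t x) -> str L' -> ext (waiting k) L' ->
  ext (waiting k) (stack (sc t x)) \/ exists b, acts_after s (g e) k (sc t x) b.
Proof.
  intros Hx Hc Hp E HL' Hw. rewrite E.
  destruct (fire_keeps (waiting k) L' (sc t x) HL' Hw) as [H|(r & b & Hr & Hact & Ef & _)]; auto. right.
  pose proof Hact as (Hr' & H0 & Hev). rewrite len_waiting in Hr. apply lt_succ in Hr.
  assert (HLL : ext L L') by (eapply ext_trans; [apply ext_one|exact Hw]).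
  destruct Hr as [Hr|Er].
  - exfalso. rewrite <- L_len in Hr. apply (act_breaks L L' r b HL' HLL Hr H0).
    rewrite <- Ef, <- E. apply s_frozen; auto. eapply ext_trans; [apply ext_one|exact Hx].
  - exists b. split; [exact Hx|]. split; [exact Hc|]. split; [exact Hp|].
    assert (En : nth L' r = pr 0 (entry k)).
    { rewrite (nth_ext (waiting k)); [rewrite Er; apply nth_waiting|apply str_waiting|exact Hw|].
      rewrite len_waiting, Er. apply lt_succ_diag. }
    split.
    + rewrite E, Ef. unfold act. rewrite En, sn_pr. fold L. f_equal.
      rewrite Er, <- L_len. apply pre_unique; auto.
    + destruct Hev as [_ Hev]. rewrite Hev, En, sn_pr. unfold entry. rewrite fs_pr. reflexivity.
Qed.

Lemma compat_entry k : compat (sc s (entry k)).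
Proof.
  apply compat_sc; [exact s_str|apply s_met|]. intros n En. exfalso. apply (proj1 s_pos). eauto.
Qed.

Lemma stack_entry k : stack (sc s (entry k)) = fire (waiting k) (sc s (entry k)).
Proof. rewrite stack_sc by exact s_str. unfold push. rewrite ite_true by exact s_pos. reflexivity. Qed.

Lemma waits_or_acts k t : ext (sc s (entry k)) t -> compat t -> preok t ->
  ext (waiting k) (stack t) \/ exists t' b, acts_after s (g e) k t' b.
Proof.
  revert t.
  apply (ext_ind (fun t => compat t -> preok t ->
    ext (waiting k) (stack t) \/ exists t' b, acts_after s (g e) k t' b)).
  - intros Hc Hp. destruct (frozen_step k s (entry k) (waiting k)) as [|(b & H)];
      eauto using ext_refl, stack_entry, str_waiting.
  - intros t x Hx IH Hc Hp. assert (Ht : str t).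
    { eapply str_ext; [|exact Hx]. apply str_sc, s_str. }
    destruct IH as [H|H]; auto.
    + eapply compat_prefix; [|apply ext_one|exact Hc]. apply Hp.
    + eapply preok_prefix; [apply ext_one|exact Hp].
    + assert (Hw : ext (waiting k) (push (stack t) t x)).
      { eapply ext_trans; [exact H|apply ext_push]. }
      destruct (frozen_step k t x (push (stack t) t x)) as [|(b & Hb)]; eauto using ext_sc, stack_sc.
      apply str_push, str_stack, Ht.
Qed.

Lemma nth_1_entry k t : ext (sc s (entry k)) t -> 1 < len t /\ nth t 1 = i.
Proof.
  intros H. pose proof s_met as (_ & _ & Hl & Hi & _). assert (Hx : ext s t).
  { eapply ext_trans; [apply ext_one|exact H]. }
  split; [eapply lt_le_trans; [exact Hl|apply ext_len; auto]|]. rewrite <- Hi. apply nth_ext; auto.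
Qed.

(** If some [k] can provoke an answer that is wrong about [g], the path goes there and the level is
    done. If some [k] is never answered, the level waits for ever. Otherwise all [k] are answered
    and all answers are right, which makes the graph of [g] a candidate. *)
Lemma met_step : exists t, ext s t /\ len s < len t /\ met (e + 1) t.
Proof.
  assert (Htr : truthful L) by apply s_met.
  assert (Hshort : forall k t, ext (sc s (entry k)) t -> ext s t /\ len s < len t).
  { intros k t Hx. split; [eapply ext_trans; [apply ext_one|exact Hx]|]. apply lt_iff.
    rewrite <- (len_sc s (entry k)) by exact s_str. apply ext_len; auto. apply str_sc, s_str. }
  destruct (classic (exists k t b, acts_after s (g e) k t b /\ refuted b)) as [(k & t & b & Ha & Hb)|H1].
  { exists t. destruct Ha as (Hx & Hc & Hp & Es & Eb).
    destruct (Hshort k t Hx) as [E1 E2]. split; auto. split; auto.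
    destruct (nth_1_entry k t Hx) as [N1 N2]. fold L in Es. fold (entry k) in Es.
    assert (HT : truthful (stack t)).
    { rewrite Es. apply truthful_sc; auto.
      - rewrite sn_pr. unfold entry. rewrite sn_pr, L_len. reflexivity.
      - intros b'. rewrite fs_pr. intros E. apply succ_inj in E. subst. exact Hb. }
    assert (El : len (stack t) = e + 1) by (rewrite Es, len_sc, L_len; auto).
    assert (St : str t) by apply Hp.
    split; [apply preok_ok_tree; auto; apply truthful_ok; auto|]. do 5 (split; auto).
    (* Levels below [e] are kept from acting by [s_frozen], and the new level has acted already,
       which a level does only once. *)
    assert (Q : forall t', ext t t' -> compat t' -> preok t' -> ext (stack t) (stack t')); [|exact Q].
    apply (ext_ind (fun t' => compat t' -> preok t' -> ext (stack t) (stack t'))).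
    - intros _ _. apply ext_refl.
    - intros t' x Hx' IH Hc' Hp'. assert (St' : str t') by (eapply str_ext; eauto).
      assert (H' : ext (stack t) (stack t')).
      { apply IH.
        - eapply compat_prefix; [apply Hp'|apply ext_one|exact Hc'].
        - eapply preok_prefix; [apply ext_one|exact Hp']. }
      assert (H2 : ext (stack t) (push (stack t') t' x)).
      { eapply ext_trans; [exact H'|apply ext_push]. }
      assert (S2 : str (push (stack t') t' x)) by apply str_push, str_stack, St'.
      rewrite stack_sc by exact St'.
      destruct (fire_keeps (stack t) _ (sc t' x) S2 H2) as [|(r & b' & Hr & (Hr' & H0 & _) & Ef & _)]; auto.
      exfalso. rewrite El in Hr. apply lt_succ in Hr. destruct Hr as [Hr|Er].
      + rewrite <- L_len in Hr.
        assert (HL2 : ext L (push (stack t') t' x)).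
        { eapply ext_trans; [|exact H2]. rewrite Es. apply ext_one. }
        apply (act_breaks L _ r b' S2 HL2 Hr H0). rewrite <- Ef, <- stack_sc by exact St'.
        apply s_frozen; auto. eapply ext_trans; [exact E1|]. apply ext_sc, Hx'.
      + rewrite (nth_ext (stack t)) in H0; auto using str_stack.
        * rewrite Es, Er, <- L_len, nth_last, fs_pr in H0 by exact L_str. exact (succ_ne _ H0).
        * rewrite El, Er. apply lt_succ_diag. }
  (* For such a [k] no admissible extension lets the new level act, so [waiting k] is frozen. *)
  destruct (classic (exists k, ~ exists t b, acts_after s (g e) k t b)) as [(k & H2)|H2].
  { assert (Q : forall t, ext (sc s (entry k)) t -> compat t -> preok t -> ext (waiting k) (stack t)).
    { intros t Hx Hc Hp. destruct (waits_or_acts k t Hx Hc Hp); [auto|contradiction]. }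
    assert (Hp := preok_sc s (entry k) s_tree).
    pose proof (Q _ (ext_refl _) (compat_entry k) Hp) as Es. rewrite stack_entry in Es.
    apply fire_noact in Es; [|apply str_waiting]. rewrite <- stack_entry in Es.
    exists (sc s (entry k)). destruct (Hshort k _ (ext_refl _)) as [E1 E2]. split; auto. split; auto.
    destruct (nth_1_entry k _ (ext_refl _)) as [N1 N2].
    assert (HT : truthful (stack (sc s (entry k)))).
    { rewrite Es. apply truthful_sc; auto.
      - rewrite sn_pr. unfold entry. rewrite sn_pr, L_len. reflexivity.
      - intros b'. rewrite fs_pr. intros E. destruct (succ_ne _ (eq_sym E)). }
    split; [apply preok_ok_tree; auto; apply truthful_ok; auto|].
    split; [apply compat_entry|]. do 2 (split; auto). split; [rewrite Es; apply len_waiting|].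
    split; auto. intros t. rewrite Es. apply Q. }
  (* The new entry contains only the number [g e], so [g] enters this candidate through a single
     value and [candidate] need not refer to the function. *)
  exfalso. apply (g_new (pr s (g e))). intros k. unfold candidate. rewrite fs_pr, sn_pr.
  assert (Ht : forall t b, acts_after s (g e) k t b -> (nth b k = 1 <-> gr g k)).
  { intros t b Ha. apply NNPP. intros Hn. apply H1. exists k, t, b. split; auto. exists k. split; auto.
    destruct Ha as (_ & _ & _ & _ & ->). apply lt_succ_diag. }
  split.
  - intros Hk. destruct (NNPP (exists t b, acts_after s (g e) k t b)) as (t & b & Ha).
    + intros Hn. apply H2. exists k. exact Hn.
    + exists t, b. split; auto. apply (Ht t b Ha), Hk.
  - intros (t & b & Ha & Hb). apply (Ht t b Ha), Hb.
Qed.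

End Step.

Lemma met_next e s : met e s -> exists t, ext s t /\ len s < len t /\ met (e + 1) t.
Proof.
  intros H. destruct (met_pad e s H) as (t & Hst & Ht & Hp).
  destruct (met_step e t Ht Hp) as (u & Htu & Hlen & Hu). exists u. split; [|split]; auto.
  - eapply ext_trans; eauto.
  - eapply le_lt_trans; [|exact Hlen]. apply ext_len; auto. apply H.
Qed.

Lemma path_above : exists F y, Fun1 y /\ is_graph y F /\ path y (tree K) /\ turing_le X F.
Proof.
  destruct met_start as (s0 & Hs0).
  (* Taking the extension with the least code makes the chain definable, so that its limit is a
     function of the model. *)
  set (f := nrec s0 (fun n s => mu (fun t => ext s t /\ len s < len t /\ met (n + 1) t))).
  assert (Hf : Fun1 f) by (unfold f; def).
  assert (f_met : forall n, met n (f n)).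
  { apply (ind (fun n => met n (f n))); [exact _| |].
    - unfold f. rewrite nrec_0 by exact _. exact Hs0.
    - intros n Hn. unfold f. rewrite nrec_S by exact _. fold (f n).
      apply (mu_spec (fun t => ext (f n) t /\ len (f n) < len t /\ met (n + 1) t)); [exact _|].
      apply met_next, Hn. }
  assert (f_step : forall n, ext (f n) (f (n + 1)) /\ len (f n) < len (f (n + 1))).
  { intros n. unfold f at 2 4. rewrite nrec_S by exact _. fold (f n).
    destruct (mu_spec (fun t => ext (f n) t /\ len (f n) < len t /\ met (n + 1) t)) as (H1 & H2 & _); auto;
      [exact _|]. apply met_next, f_met. }
  assert (f_str : forall n, str (f n)) by (intros n; apply f_met).
  assert (f_len : forall n, n <= len (f n)).
  { apply (ind (fun n => n <= len (f n))); [exact _|apply zero_le|]. intros n Hn.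
    apply lt_iff. eapply le_lt_trans; [exact Hn|apply f_step]. }
  set (y := chain_limit f). assert (Hy : Fun1 y) by (apply Fun1_chain_limit; exact _).
  destruct (graph_exists y) as (F & HF). exists F, y. split; [exact _|]. split; [exact HF|].
  assert (f_ext : forall n, ext (f n) (f (n + 1))) by (intros n; apply f_step).
  split.
  - intros n. apply (tree_is_tree K (f n)); [apply f_met|]. apply chain_limit_below; auto.
  - assert (Hval : forall n, y (pr n 0) = ite (n \in X) 0 1).
    { intros n. unfold y. rewrite (chain_limit_eq f f_str f_ext f_len (pr n 0 + 1)).
      - apply f_met. apply lt_iff, f_len.
      - apply lt_iff, f_len. }
    exists query_index. intros n. split; intros Hn; apply comp_query; [left|right]; split; auto;
      rewrite (is_graph_pr y F) by exact HF; rewrite Hval.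
    + rewrite ite_true by exact Hn. reflexivity.
    + rewrite ite_false by exact Hn. intros E. exact (one_ne_zero (eq_sym E)).
Qed.

End Cofinality.

(** * Unique paths *)

Section UniquePaths.

Context {A : structure} {HA : aca_model A}.
Local Notation N := (num_sort A).
Local Notation "x \in X" := (s_mem A x X) (at level 70) : model_scope.
Local Open Scope model_scope.

Definition has_path (P : N -> Prop) : Prop := exists g, Fun1 g /\ path g P.

Lemma unique_paths (K : N -> N -> Prop) {HK : Rel2 K} : pointed_tree_theorem (A := A) ->
  (forall i g g', Fun1 g -> Fun1 g' -> path g (K i) -> path g' (K i) -> forall n, g n = g' n) ->
  exists Z, forall i, i \in Z <-> has_path (K i).
Proof.
  intros HM Huniq. apply NNPP. intros Hno.
  destruct (HM (tree K) _ (tree_is_tree K)) as (P & H1 & H2 & H3 & H4 & H5).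
  - intros X. 
    destruct (classic (forall i g, Fun1 g -> path g (K i) ->
      exists q, forall k, gr g k <-> candidate K X q k)) as [H|H].
    + exfalso. apply Hno.
      (* Under the assumption the graph of every path is a candidate, so having a path becomes an
         arithmetical condition with a number quantifier over [q]. *)
      destruct (set_exists (fun i => exists q, forall n,
        K i (restr (fun p => mu (fun v => candidate K X q (pr p v))) n))) as (Z & HZ).
      exists Z. intros i. rewrite HZ. split.
      * intros (q & Hq). exists (fun p => mu (fun v => candidate K X q (pr p v))). split; [exact _|exact Hq].
      * intros (g & Hg & Hp). destruct (H i g Hg Hp) as (q & Hq). exists q. intros n.
        rewrite (restr_ext _ g); [apply Hp|]. intros p _. apply mu_unique; [exact _| |].
        -- apply Hq. exists p. reflexivity.
        -- intros v Hv. apply Hq in Hv. destruct Hv as (p' & E). apply pr_inj in E.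
           destruct E as [-> ->]. reflexivity.
    + apply NNPP. intros Hx. apply H. intros i g Hg Hp. apply NNPP. intros Hq. apply Hx.
      apply (path_above K X i g Hp). intros q Hk. apply Hq. eauto.
  - exact (no_pointed_subtree K P Huniq H1 H2 H3 H4 H5).
Qed.

End UniquePaths.

(** * Closed conditions on functions *)

Section Local.

Context {A : structure} {HA : aca_model A}.
Local Notation N := (num_sort A).
Local Open Scope model_scope.

(** [Q i g] says that [g] satisfies infinitely many conditions on three of its values each. *)
Definition local (Q : N -> (N -> N) -> Prop) : Prop :=
  exists (B : N -> N -> N -> N -> N -> Prop) (t1 t2 t3 : N -> N -> N),
    Rel5 B /\ Fun2 t1 /\ Fun2 t2 /\ Fun2 t3 /\
    forall i g, Fun1 g -> (Q i g <-> forall c, B i c (g (t1 i c)) (g (t2 i c)) (g (t3 i c))).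

Lemma local_ext Q Q' : local Q -> (forall i g, Fun1 g -> (Q i g <-> Q' i g)) -> local Q'.
Proof.
  intros (B & t1 & t2 & t3 & HB & H1 & H2 & H3 & H) HQ. exists B, t1, t2, t3.
  do 4 (split; auto). intros i g Hg. rewrite <- HQ by exact Hg. apply H, Hg.
Qed.

Lemma local_intro (B : N -> N -> N -> N -> N -> Prop) (t1 t2 t3 : N -> N -> N) :
  Rel5 B -> Fun2 t1 -> Fun2 t2 -> Fun2 t3 ->
  local (fun i g => forall c, B i c (g (t1 i c)) (g (t2 i c)) (g (t3 i c))).
Proof. intros HB H1 H2 H3. exists B, t1, t2, t3. do 4 (split; auto). reflexivity. Qed.

Lemma local_and Q Q' : local Q -> local Q' -> local (fun i g => Q i g /\ Q' i g).
Proof.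
  intros (B & t1 & t2 & t3 & HB & H1 & H2 & H3 & H) (B' & t1' & t2' & t3' & HB' & H1' & H2' & H3' & H').
  (* Conditions are tagged: [fs c = 0] selects the first family, any other tag the second. *)
  exists (fun i c x y z => (fs c = 0 -> B i (sn c) x y z) /\ (fs c <> 0 -> B' i (sn c) x y z)).
  exists (fun i c => ite (fs c = 0) (t1 i (sn c)) (t1' i (sn c))).
  exists (fun i c => ite (fs c = 0) (t2 i (sn c)) (t2' i (sn c))).
  exists (fun i c => ite (fs c = 0) (t3 i (sn c)) (t3' i (sn c))).
  split; [def|]. split; [exact _|]. split; [exact _|]. split; [exact _|].
  intros i g Hg. rewrite H, H' by exact Hg. split.
  - intros [K K'] c. split; intros E; [rewrite !ite_true by exact E; apply K|rewrite !ite_false by exact E; apply K'].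
  - intros K. split; intros c.
    + destruct (K (pr 0 c)) as [K1 _]. rewrite fs_pr, sn_pr, !ite_true in K1 by reflexivity. auto.
    + destruct (K (pr 1 c)) as [_ K1]. rewrite fs_pr, sn_pr in K1.
      rewrite !ite_false in K1 by exact one_ne_zero. apply K1, one_ne_zero.
Qed.

Lemma local_all (R : N -> N -> Prop) (h : N -> N -> N) Q : Rel2 R -> Fun2 h -> local Q ->
  local (fun i g => forall x, R i x -> Q (h i x) g).
Proof.
  intros HR Hh (B & t1 & t2 & t3 & HB & H1 & H2 & H3 & H).
  exists (fun i c x y z => R i (fs c) -> B (h i (fs c)) (sn c) x y z).
  exists (fun i c => t1 (h i (fs c)) (sn c)), (fun i c => t2 (h i (fs c)) (sn c)),
    (fun i c => t3 (h i (fs c)) (sn c)).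
  split; [def|]. split; [exact _|]. split; [exact _|]. split; [exact _|].
  intros i g Hg. split.
  - intros K c HRc. apply H; [exact Hg|]. apply K, HRc.
  - intros K x Hx. apply H; [exact Hg|]. intros c. specialize (K (pr x c)). rewrite fs_pr, sn_pr in K. auto.
Qed.

(** A condition is checked on a string as soon as all three locations lie within its length, and
    every condition is reached by some restriction. *)
Lemma local_path Q : local Q -> exists K : N -> N -> Prop, Rel2 K /\
  forall i g, Fun1 g -> (path g (K i) <-> Q i g).
Proof.
  intros (B & t1 & t2 & t3 & HB & H1 & H2 & H3 & H).
  exists (fun i s => forall c, t1 i c < len s -> t2 i c < len s -> t3 i c < len s ->
    B i c (nth s (t1 i c)) (nth s (t2 i c)) (nth s (t3 i c))).
  split; [exact _|]. intros i g Hg. rewrite H by exact Hg. split.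
  - intros Hp c. set (n := t1 i c + t2 i c + t3 i c + 1).
    assert (E1 : t1 i c < n) by (apply lt_succ_le; eapply le_trans; [apply le_add_r|apply le_add_r]).
    assert (E2 : t2 i c < n) by (apply lt_succ_le; eapply le_trans; [apply le_add_l|apply le_add_r]).
    assert (E3 : t3 i c < n) by (apply lt_succ_le; apply le_add_l).
    specialize (Hp n c). rewrite len_restr in Hp by exact _.
    rewrite !nth_restr in Hp by (exact _ || auto). auto.
  - intros K n c. rewrite len_restr by exact _. intros E1 E2 E3.
    rewrite !nth_restr by (exact _ || auto). apply K.
Qed.

End Local.

(** * Evaluation of arithmetical formulas by a function satisfying a closed condition *)

Section Evaluation.

Context {A : structure} {HA : aca_model A}.
Local Notation N := (num_sort A).
Local Notation "x \in X" := (s_mem A x X) (at level 70) : model_scope.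
Local Open Scope model_scope.
Add Ring model_ring : (model_semiring (A := A)).

(** [c] codes the assignment [fs c, fs (sn c), ...] of numbers to variables. *)
Fixpoint assign (c : N) (k : nat) : N :=
  match k with O => fs c | S k => assign (sn c) k end.

Lemma Fun1_assign k : Fun1 (fun c => assign c k).
Proof.
  induction k as [|k IH]; [exact Fun1_fs|].
  exact (TDef_app1 (fun c => assign c k) (fun e => sn (e 0%nat)) ltac:(def)).
Qed.

Global Instance Fun1_eval t : Fun1 (fun c => eval A (assign c) t).
Proof.
  induction t; cbn [eval].
  - apply Fun1_assign.
  - def.
  - def.
  - exact (TDef_app2 (s_plus A) (fun e => eval A (assign (e 0%nat)) t1) (fun e => eval A (assign (e 0%nat)) t2) IHt1 IHt2).
  - exact (TDef_app2 (s_times A) (fun e => eval A (assign (e 0%nat)) t1) (fun e => eval A (assign (e 0%nat)) t2) IHt1 IHt2).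
Qed.

Lemma assignment_exists k (e : nat -> N) : exists c, forall j, (j < k)%nat -> assign c j = e j.
Proof.
  revert e. induction k as [|k IH]; intros e; [exists 0; lia|].
  destruct (IH (fun j => e (S j))) as (c & Hc). exists (pr (e 0%nat) c).
  intros [|j] Hj; simpl; [apply fs_pr|]. rewrite sn_pr. apply Hc. lia.
Qed.

Variable v : nat -> set_sort A.

Definition evalt (t : term) (c : N) : N := eval A (assign c) t.

Definition atom (Z : N -> N -> Prop) (p : formula) (i c : N) : Prop :=
  match p with
  | Eq s t => evalt s c = evalt t c
  | Lt s t => evalt s c < evalt t c
  | Mem t O => Z i (evalt t c)
  | Mem t (S Y) => evalt t c \in v Y
  | _ => False
  end.

(** [0] if [p] is true under the assignment [c] when its set variable [0] is interpreted by [Z i],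
    and a positive number if it is false; for a universal formula, one more than the least
    counterexample. *)
Fixpoint val (Z : N -> N -> Prop) (p : formula) (i c : N) : N :=
  match p with
  | Imp p q => ite (val Z p i c <> 0 \/ val Z q i c = 0) 0 1
  | AllNum p => ite (forall x, val Z p i (pr x c) = 0) 0 (mu (fun x => val Z p i (pr x c) <> 0) + 1)
  | _ => ite (atom Z p i c) 0 1
  end.

(** The values of [p] and of all its subformulas. *)
Fixpoint table (Z : N -> N -> Prop) (p : formula) (i n : N) : N :=
  ite (fs n = 0) (val Z p i (sn n))
    match p with
    | Imp p q => ite (fs n = 1) (table Z p i (sn n)) (ite (fs n = 1 + 1) (table Z q i (sn n)) 0)
    | AllNum p => ite (fs n = 1) (table Z p i (sn n)) 0
    | _ => 0
    end.

Section Definable.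
Variable Z : N -> N -> Prop.
Context {HZ : Rel2 Z}.

Lemma Rel2_atom p : Rel2 (atom Z p).
Proof. destruct p as [| | |t [|Y]| | |]; unfold atom; def. Qed.

Global Instance Fun2_val p : Fun2 (val Z p).
Proof.
  induction p; cbn [val];
    try match goal with |- Fun2 (fun i c => ite (atom Z ?p i c) 0 1) => pose proof (Rel2_atom p) end; def.
Qed.

Global Instance Fun2_table p : Fun2 (table Z p).
Proof.
  induction p; cbn [table];
    match goal with |- Fun2 (fun i n => ite _ (val Z ?p i (sn n)) _) => pose proof (Fun2_val p) end; def.
Qed.
End Definable.

Lemma table_val Z p i c : table Z p i (pr 0 c) = val Z p i c.
Proof. destruct p; cbn [table]; rewrite fs_pr, sn_pr, ite_true; reflexivity. Qed.

Lemma val_congr (Z Z' : N -> N -> Prop) p i i' : (forall q, Z i q <-> Z' i' q) ->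
  forall c, val Z p i c = val Z' p i' c.
Proof.
  intros H.
  induction p; intros c; cbn [val]; try reflexivity.
  - f_equal. apply propositional_extensionality. destruct X; cbn [atom]; [apply H|reflexivity].
  - rewrite IHp1, IHp2. reflexivity.
  - replace (val Z p i) with (val Z' p i') by (extensionality x; symmetry; apply IHp). reflexivity.
Qed.

Lemma table_congr (Z Z' : N -> N -> Prop) p i i' : (forall q, Z i q <-> Z' i' q) ->
  forall n, table Z p i n = table Z' p i' n.
Proof.
  intros H. induction p; intros n; cbn [table]; rewrite (val_congr Z Z' _ i i') by exact H;
    rewrite ?IHp, ?IHp1, ?IHp2; reflexivity.
Qed.

Lemma ite_01 P : ite P 0 1 = (0 : N) <-> P.
Proof.
  destruct (classic P) as [H|H]; [rewrite ite_true by exact H|rewrite ite_false by exact H];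
    split; auto; [intros E; destruct (one_ne_zero E)|contradiction].
Qed.

Lemma assign_pr x c : assign (pr x c) = scons x (assign c).
Proof. extensionality j. destruct j; simpl; [apply fs_pr|rewrite sn_pr; reflexivity]. Qed.

Lemma val_sat (Z : N -> N -> Prop) (Y : set_sort A) p i : arithmetical p -> (forall q, Z i q <-> q \in Y) ->
  forall c, val Z p i c = 0 <-> sat A (assign c) (scons Y v) p.
Proof.
  intros Hp HY. induction p; intros c; cbn [val]; rewrite ?ite_01; cbn [atom sat]; try reflexivity.
  - destruct X; [apply HY|reflexivity].
  - destruct Hp as [Hp1 Hp2]. rewrite IHp1, IHp2 by assumption. tauto.
  - destruct (classic (forall x, val Z p i (pr x c) = 0)) as [H|H];
      [rewrite ite_true by exact H|rewrite ite_false by exact H]; split; auto.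
    + intros _ d. rewrite <- assign_pr. apply IHp; auto.
    + intros E. destruct (succ_ne _ E).
    + intros K. exfalso. apply H. intros x. apply IHp; auto. rewrite assign_pr. apply K.
  - destruct Hp.
Qed.

(** Outside the range of [pr] the search defining [fs] fails and returns 0, so a nonzero tag can
    only come from a pair. *)
Lemma fs_ne_0 (n : N) : fs n <> 0 -> n = pr (fs n) (sn n).
Proof.
  intros H. destruct (classic (exists x y, n = pr x y)) as [(x & y & ->)|Hn].
  - rewrite fs_pr, sn_pr. reflexivity.
  - exfalso. apply H. destruct (mu_cases (fun x => exists y, n = pr x y)) as [[(y & E) _]|[_ E]]; [exact _| |exact E].
    exfalso. eauto.
Qed.

(** The location in [g] of the bit deciding whether [q] belongs to [zg g i]. *)
Variable below : N -> N -> Prop.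
Variable loc : N -> N.
Context {Hbelow : Rel2 below} {Hloc : Fun1 loc}.

Definition zg (g : N -> N) (i q : N) : Prop := below i q /\ g (loc q) = 0.

Definition tabulates (p : formula) (L : N -> N -> N) (i : N) (g : N -> N) : Prop :=
  forall n, g (L i n) = table (zg g) p i n.

(** An atom consults [g] at no more than one further place: for a membership in the set being
    iterated, the place given by [loc]. *)
Lemma local_atom p (L : N -> N -> N) : Fun2 L ->
  (forall Z i n, table Z p i n = ite (fs n = 0) (ite (atom Z p i (sn n)) 0 1) 0) ->
  local (tabulates p L).
Proof.
  intros HL Hp.
  assert (E : exists (B : N -> N -> N -> Prop) (q : N -> N), Rel3 B /\ Fun1 q /\
    forall g i c, atom (zg g) p i c <-> B i c (g (loc (q c)))).
  { destruct p as [|s t|s t|t [|Y]| | |].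
    2: exists (fun _ c _ => evalt s c = evalt t c), (fun c => c).
    3: exists (fun _ c _ => evalt s c < evalt t c), (fun c => c).
    4: exists (fun i c x => below i (evalt t c) /\ x = 0), (evalt t).
    5: exists (fun _ c _ => evalt t c \in v Y), (fun c => c).
    1,6,7,8: exists (fun _ _ _ => False), (fun c => c).
    all: split; [exact _|split; [exact _|]]; intros; reflexivity. }
  destruct E as (B & q & HB & Hq & E).
  eapply local_ext; [apply (local_intro
    (fun i n x y _ => x = ite (fs n = 0) (ite (B i (sn n) y) 0 1) 0)
    L (fun _ n => loc (q (sn n))) L)|]; try exact _; [def|].
  intros i g _. apply forall_iff. intros n. rewrite Hp.
  rewrite (propositional_extensionality _ _ (E g i (sn n))). reflexivity.
Qed.

Lemma one_ne_two : (1 : N) <> 1 + 1.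
Proof. intros E. apply one_ne_zero. symmetry. apply succ_inj. rewrite add_0_l. exact E. Qed.

(** An implication relates its value to two others. A universal formula depends on infinitely many
    values, but its least counterexample splits this into one condition per instance: 0 demands
    truth of each instance, and [x + 1] demands falsity at [x] and truth below [x]. *)
Lemma local_table p : arithmetical p -> forall L : N -> N -> N, Fun2 L -> local (tabulates p L).
Proof.
  assert (Hsub : forall (L : N -> N -> N) x, Fun2 L -> Fun2 (fun i n => L i (pr x n))) by (intros; exact _).
  induction p; intros Hp L HL; try (apply local_atom; auto; reflexivity).
  - destruct Hp as [Hp1 Hp2].
    pose proof (local_and _ _ (IHp1 Hp1 _ (Hsub L 1 HL)) (IHp2 Hp2 _ (Hsub L (1 + 1) HL))) as Hs.
    pose proof (local_intro (fun i n x y z =>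
      (fs n = 0 -> x = ite (y <> 0 \/ z = 0) 0 1) /\ (fs n <> 0 -> fs n <> 1 -> fs n <> 1 + 1 -> x = 0))
      L (fun i n => L i (pr 1 (pr 0 (sn n)))) (fun i n => L i (pr (1 + 1) (pr 0 (sn n))))) as Hc.
    assert (HB : Rel5 (fun _ n x y z : N =>
      (fs n = 0 -> x = ite (y <> 0 \/ z = 0) 0 1) /\ (fs n <> 0 -> fs n <> 1 -> fs n <> 1 + 1 -> x = 0))) by def.
    specialize (Hc HB HL _ _). eapply local_ext; [exact (local_and _ _ Hs Hc)|].
    intros i g _. unfold tabulates. cbn [table val]. split.
    + intros [[H1 H2] H3] n. destruct (H3 n) as [H4 H5]. rewrite H1, H2, !table_val in H4.
      destruct (classic (fs n = 0)) as [E0|E0]; [rewrite ite_true by exact E0; auto|rewrite ite_false by exact E0].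
      destruct (classic (fs n = 1)) as [E1|E1]; [rewrite ite_true by exact E1|rewrite ite_false by exact E1].
      { rewrite <- H1, <- E1, <- fs_ne_0 by exact E0. reflexivity. }
      destruct (classic (fs n = 1 + 1)) as [E2|E2]; [rewrite ite_true by exact E2|rewrite ite_false by exact E2; auto].
      rewrite <- H2, <- E2, <- fs_ne_0 by exact E0. reflexivity.
    + intros H.
      assert (H1 : forall n, g (L i (pr 1 n)) = table (zg g) p1 i n).
      { intros n. rewrite H, fs_pr, sn_pr. rewrite ite_false by exact one_ne_zero. apply ite_true. reflexivity. }
      assert (H2 : forall n, g (L i (pr (1 + 1) n)) = table (zg g) p2 i n).
      { intros n. rewrite H, fs_pr, sn_pr. rewrite ite_false by apply succ_ne.
        rewrite ite_false by (intros E; exact (one_ne_two (eq_sym E))). apply ite_true. reflexivity. }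
      split; [auto|]. intros n. rewrite H1, H2, !table_val, H. split.
      * intros E0. apply ite_true, E0.
      * intros E0 E1 E2. rewrite !ite_false; auto.
  - pose proof (IHp Hp _ (Hsub L 1 HL)) as Hs.
    (* The condition [c] codes a table entry [fs c] and an instance [sn c]; [x] is the value of that
       entry and [y] the value of the body at the instance. *)
    pose proof (local_intro (fun i c x y _ =>
      (fs (fs c) = 0 -> (x = 0 -> y = 0) /\ (x = sn c + 1 -> y <> 0) /\ (sn c + 1 < x -> y = 0)) /\
      (fs (fs c) <> 0 -> fs (fs c) <> 1 -> x = 0))
      (fun i c => L i (fs c)) (fun i c => L i (pr 1 (pr 0 (pr (sn c) (sn (fs c)))))) L) as Hc.
    assert (HB : Rel5 (fun _ c x y _ : N =>
      (fs (fs c) = 0 -> (x = 0 -> y = 0) /\ (x = sn c + 1 -> y <> 0) /\ (sn c + 1 < x -> y = 0)) /\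
      (fs (fs c) <> 0 -> fs (fs c) <> 1 -> x = 0))) by def.
    specialize (Hc HB _ _ HL). eapply local_ext; [exact (local_and _ _ Hs Hc)|].
    intros i g Hg. unfold tabulates. cbn [table val].
    assert (Hzg : Rel2 (zg g)) by (unfold zg; exact _).
    assert (HR : forall m, Rel1 (fun x => val (zg g) p i (pr x m) <> 0)) by (intros m; exact _).
    split.
    + intros [H1 H2] n.
      destruct (classic (fs n = 0)) as [E0|E0]; [rewrite ite_true by exact E0|rewrite ite_false by exact E0].
      * assert (H3 : forall x, (g (L i n) = 0 -> val (zg g) p i (pr x (sn n)) = 0) /\
          (g (L i n) = x + 1 -> val (zg g) p i (pr x (sn n)) <> 0) /\
          (x + 1 < g (L i n) -> val (zg g) p i (pr x (sn n)) = 0)).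
        { intros x. destruct (H2 (pr n x)) as [H3 _]. rewrite fs_pr, sn_pr, H1, table_val in H3. auto. }
        destruct (zero_or_succ (g (L i n))) as [E|(x & E)]; rewrite E in *.
        -- rewrite ite_true; [reflexivity|]. intros x. apply (proj1 (H3 x)). reflexivity.
        -- destruct (H3 x) as (_ & Hx & _). specialize (Hx eq_refl). rewrite ite_false by auto. f_equal.
           assert (Hmin : forall y, y < x -> val (zg g) p i (pr y (sn n)) = 0).
           { intros y Hy. apply (proj2 (proj2 (H3 y))), succ_lt, Hy. }
           apply le_antisym.
           ++ destruct (le_or_lt x (mu (fun x => val (zg g) p i (pr x (sn n)) <> 0))) as [|K]; auto.
              exfalso. apply (mu_spec (fun x => val (zg g) p i (pr x (sn n)) <> 0)); eauto.
           ++ apply (mu_least (fun x => val (zg g) p i (pr x (sn n)) <> 0)); auto.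
      * destruct (classic (fs n = 1)) as [E1|E1]; [rewrite ite_true by exact E1|rewrite ite_false by exact E1].
        { rewrite <- H1, <- E1, <- fs_ne_0 by exact E0. reflexivity. }
        destruct (H2 (pr n 0)) as [_ H3]. rewrite fs_pr in H3. auto.
    + intros H.
      assert (H1 : forall n, g (L i (pr 1 n)) = table (zg g) p i n).
      { intros n. rewrite H, fs_pr, sn_pr. rewrite ite_false by exact one_ne_zero. apply ite_true. reflexivity. }
      split; [auto|]. intros c. rewrite H1, table_val, H. split.
      * intros E0. rewrite ite_true by exact E0.
        destruct (classic (forall x, val (zg g) p i (pr x (sn (fs c))) = 0)) as [HA0|HA0];
          [rewrite ite_true by exact HA0|rewrite ite_false by exact HA0].
        { split; [auto|]. split; auto. intros E. destruct (succ_ne _ (eq_sym E)). }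
        assert (Hex : exists x, val (zg g) p i (pr x (sn (fs c))) <> 0).
        { apply NNPP. intros Hn. apply HA0. intros x. apply NNPP. eauto. }
        split; [intros E; destruct (succ_ne _ E)|]. split.
        -- intros E. apply succ_inj in E. rewrite <- E.
           exact (mu_spec (fun x => val (zg g) p i (pr x (sn (fs c))) <> 0) (HR _) Hex).
        -- intros Hlt. apply succ_lt_inv in Hlt. apply NNPP. intros Hn. revert Hlt. apply le_not_lt.
           apply (mu_least (fun x => val (zg g) p i (pr x (sn (fs c))) <> 0)); auto.
      * intros E0 E1. rewrite !ite_false; auto.
Qed.

End Evaluation.

(** * Transfinite recursion *)

Section Recursion.

Context {A : structure} {HA : aca_model A}.
Local Notation N := (num_sort A).
Local Notation "x \in X" := (s_mem A x X) (at level 70) : model_scope.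
Local Open Scope model_scope.
Add Ring model_ring : (model_semiring (A := A)).

Definition ord_lt (X : set_sort A) (i j : N) : Prop := pr i j \in X /\ ~ pr j i \in X.
Global Instance Rel2_ord_lt X : Rel2 (ord_lt X).
Proof. unfold ord_lt. def. Qed.

Definition well_order (X : set_sort A) : Prop :=
  (forall i j, pr i j \in X -> pr i i \in X /\ pr j j \in X) /\
  (forall i j k, pr i j \in X -> pr j k \in X -> pr i k \in X) /\
  forall f, Fun1 f -> ~ forall n, ord_lt X (f (n + 1)) (f n).

Lemma sat_IsWellOrder e v X : sat A e v (IsWellOrder X) -> well_order (v X).
Proof.
  unfold IsWellOrder, IsLinearOrder, IsReflexive. rewrite !sat_And.
  intros (((_ & R) & T & _ & _) & W). split; [|split].
  - intros i j H. specialize (R i j). rewrite sat_Imp, sat_And in R. exact (R H).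
  - intros i j k H H'. specialize (T i j k). rewrite sat_Imp, sat_And in T. exact (T (conj H H')).
  - intros f Hf H. unfold IsWellFounded in W. rewrite sat_Neg, sat_ExSet in W. apply W.
    destruct (graph_exists f) as (F & HF). exists F. rewrite sat_And, sat_IsFunction. split; [eauto|].
    intros n. rewrite sat_ExNum. exists (f n). rewrite sat_ExNum. exists (f (n + 1)).
    unfold Lt_in. rewrite !sat_And. split; [|split]; [apply (is_graph_pr f); auto|apply (is_graph_pr f); auto|].
    exact (H n).
Qed.

Variable X : set_sort A.
Hypothesis X_wo : well_order X.

Lemma ord_lt_trans i j k : ord_lt X i j -> ord_lt X j k -> ord_lt X i k.
Proof.
  destruct X_wo as (_ & T & _). intros [H1 H2] [H3 H4]. split; eauto.
Qed.

(** Otherwise, moving each time to the numerically least member of [D] that precedes the current one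
    yields a definable descending sequence. *)
Lemma ord_minimal (D : N -> Prop) : Rel1 D -> (exists i, D i) ->
  exists i, D i /\ forall j, ord_lt X j i -> ~ D j.
Proof.
  intros HD (i0 & H0). apply NNPP. intros Hn.
  assert (Hd : forall i, D i -> exists j, D j /\ ord_lt X j i).
  { intros i Hi. apply NNPP. intros K. apply Hn. exists i. split; auto. intros j Hj Dj. apply K. eauto. }
  set (f := nrec i0 (fun _ i => mu (fun j => D j /\ ord_lt X j i))).
  assert (Hf : Fun1 f) by (unfold f; def).
  assert (HS : forall n, D (f n) -> D (f (n + 1)) /\ ord_lt X (f (n + 1)) (f n)).
  { intros n Hfn. unfold f. rewrite nrec_S by exact _. fold (f n).
    apply (mu_spec (fun j => D j /\ ord_lt X j (f n))); auto. exact _. }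
  assert (HDf : forall n, D (f n)).
  { apply (ind (fun n => D (f n))); [exact _| |].
    - unfold f. rewrite nrec_0 by exact _. exact H0.
    - intros n Hfn. apply HS, Hfn. }
  destruct X_wo as (_ & _ & W). apply (W f Hf). intros n. apply HS, HDf.
Qed.

Variables (v : nat -> set_sort A) (th : formula) (c0 : N).
Hypothesis th_arith : arithmetical th.

Definition below (i q : N) : Prop := exists m j, q = pr m j /\ ord_lt X j i.
Local Instance Rel2_below : Rel2 below.
Proof. unfold below. def. Qed.
(** For [q = pr m j] this is the entry at level [j] for the whole formula [th] (tag 0), under the
    assignment of [m] to its first variable and of the parameters coded by [c0] to the others. *)
Definition loc (q : N) : N := pr (sn q) (pr 0 (pr (fs q) c0)).
Local Instance Fun1_loc : Fun1 loc.
Proof. unfold loc. def. Qed.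

Local Notation stageset := (zg below loc).

Lemma Rel2_stageset g {Hg : Fun1 g} : Rel2 (stageset g).
Proof. unfold zg. def. Qed.
Local Existing Instance Rel2_stageset.

Definition hierarchy (j : N) (g : N -> N) : Prop :=
  forall i, ord_lt X i j -> tabulates v below loc th pr i g.

Lemma stageset_congr g g' i : (forall j, ord_lt X j i -> forall n, g (pr j n) = g' (pr j n)) ->
  forall q, stageset g i q <-> stageset g' i q.
Proof.
  intros H q. unfold zg. split; intros [Hb E]; split; auto; destruct Hb as (m & j & -> & Hj);
    rewrite <- E; unfold loc; rewrite sn_pr; [symmetry|]; apply H, Hj.
Qed.

Lemma hierarchy_unique g g' j : Fun1 g -> Fun1 g' -> hierarchy j g -> hierarchy j g' ->
  forall i, ord_lt X i j -> forall n, g (pr i n) = g' (pr i n).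
Proof.
  intros Hg Hg' H H'. apply NNPP. intros Hn.
  destruct (ord_minimal (fun i => ord_lt X i j /\ exists n, g (pr i n) <> g' (pr i n))) as (i & [Hi (n & Hin)] & Hm).
  - exact _.
  - apply NNPP. intros K. apply Hn. intros i Hi n. apply NNPP. intros E. apply K. eauto.
  - apply Hin. rewrite (H i Hi), (H' i Hi). apply table_congr. apply stageset_congr.
    intros k Hk m. apply NNPP. intros E. apply (Hm k Hk). split; [eapply ord_lt_trans; eauto|eauto].
Qed.

Lemma hierarchy_below i j g : ord_lt X i j -> hierarchy j g -> hierarchy i g.
Proof. intros Hij H k Hk. apply H. eapply ord_lt_trans; eauto. Qed.

(** The index [(j, (m, y))] asks for a hierarchy below [j] with value [y] at [m]. *)
Definition hierarchy_at (I : N) (g : N -> N) : Prop :=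
  hierarchy (fs I) g /\
  (forall n, ~ ord_lt X (fs n) (fs I) \/ n <> pr (fs n) (sn n) -> g n = 0) /\
  g (fs (sn I)) = sn (sn I).

Lemma local_hierarchy_at : local hierarchy_at.
Proof.
  apply local_and; [|apply local_and].
  - apply (local_all (fun I i => ord_lt X i (fs I)) (fun _ i => i) (tabulates v below loc th pr));
      try exact _. apply local_table; auto; exact _.
  - apply (local_ext (fun I g => forall c,
      ~ ord_lt X (fs c) (fs I) \/ c <> pr (fs c) (sn c) -> g c = 0)); [|reflexivity].
    apply (local_intro (fun I c x _ _ => ~ ord_lt X (fs c) (fs I) \/ c <> pr (fs c) (sn c) -> x = 0)
      (fun _ c => c) (fun _ c => c) (fun _ c => c)); try exact _. def.
  - apply (local_ext (fun I g => forall c : N, g (fs (sn I)) = sn (sn I))).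
    + apply (local_intro (fun I _ x _ _ => x = sn (sn I)) (fun I _ => fs (sn I))
        (fun I _ => fs (sn I)) (fun I _ => fs (sn I))); try exact _. def.
    + intros I g _. split; [intros H; exact (H 0)|auto].
Qed.

Lemma hierarchy_at_unique I I' g g' : fs I = fs I' -> Fun1 g -> Fun1 g' ->
  hierarchy_at I g -> hierarchy_at I' g' -> forall n, g n = g' n.
Proof.
  intros E Hg Hg' (H1 & H2 & _) (H1' & H2' & _) n. rewrite <- E in *.
  destruct (classic (~ ord_lt X (fs n) (fs I) \/ n <> pr (fs n) (sn n))) as [H|H].
  - rewrite H2, H2'; auto.
  - assert (En : n = pr (fs n) (sn n)) by (apply NNPP; tauto). rewrite En.
    apply (hierarchy_unique g g' (fs I)); auto. apply NNPP. tauto.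
Qed.

(** All values of all hierarchies are read off from the one set [Z0]. Hence the existence of a
    hierarchy below [j] is an arithmetical property of [j] with this parameter, and transfinite
    induction along [X] applies to it. *)
Lemma recursion : pointed_tree_theorem (A := A) ->
  exists Y, forall z, z \in Y <-> exists n j, z = pr n j /\ pr j j \in X /\
    exists Z, (forall q, q \in Z <-> exists m i, q = pr m i /\ ord_lt X i j /\ q \in Y) /\
      sat A (assign (pr n c0)) (scons Z v) th.
Proof.
  intros HM.
  destruct (local_path _ local_hierarchy_at) as (K & HK & Kspec).
  destruct (unique_paths K HM) as (Z0 & HZ0).
  { intros I g g' Hg Hg' H H'. apply Kspec in H, H'; auto.
    exact (hierarchy_at_unique I I g g' eq_refl Hg Hg' H H'). }
  (* [Z0] only tells which indices have a path; since an index names a value [y] at [m], searching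
     for the right [y] recovers the function. *)
  set (G := fun j m => mu (fun y => pr j (pr m y) \in Z0)).
  assert (HG : Fun2 G) by (unfold G; def).
  assert (Gspec : forall I g, Fun1 g -> hierarchy_at I g -> G (fs I) = g).
  { intros I g Hg H. extensionality m. unfold G. apply mu_unique; [exact _| |].
    - apply HZ0. exists g. split; auto. apply Kspec; auto.
      destruct H as (H1 & H2 & _). unfold hierarchy_at. rewrite !sn_pr, !fs_pr. auto.
    - intros y Hy. apply HZ0 in Hy. destruct Hy as (g' & Hg' & Hy). apply Kspec in Hy; auto.
      rewrite (hierarchy_at_unique I (pr (fs I) (pr m y)) g g'); auto; [|rewrite fs_pr; reflexivity].
      destruct Hy as (_ & _ & Hy). rewrite !sn_pr, fs_pr in Hy. symmetry. exact Hy. }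
  set (S := fun i => stageset (G i) i).
  assert (HS : Rel2 S) by (unfold S, zg; def).
  assert (Sspec : forall i j, ord_lt X i j -> hierarchy i (G i) -> hierarchy j (G j) ->
    forall q, stageset (G j) i q <-> S i q).
  { intros i j Hij Hi Hj. apply stageset_congr.
    apply hierarchy_unique; try exact _; auto. eapply hierarchy_below; eauto. }
  assert (HH : forall j, hierarchy j (G j)).
  { set (Z' := fun c => stageset (G (fs c)) (sn c)).
    assert (HZ' : Rel2 Z') by (unfold Z', zg; def).
    set (D := fun j => forall i, ord_lt X i j -> forall n, G j (pr i n) = table v Z' th (pr j i) n).
    assert (HDef : Rel1 D) by (unfold D; def).
    assert (HD : forall j, D j <-> hierarchy j (G j)).
    { intros j. unfold D, hierarchy, tabulates. apply forall_iff; intros i.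
      apply imp_iff2; [reflexivity|]. apply forall_iff; intros n.
      rewrite (table_congr v Z' (stageset (G j)) th (pr j i) i); [reflexivity|].
      intros q. unfold Z'. rewrite fs_pr, sn_pr. reflexivity. }
    apply NNPP. intros Hn.
    destruct (ord_minimal (fun j => ~ D j)) as (j & Hj & Hm).
    - exact _.
    - apply NNPP. intros Hx. apply Hn. intros j. apply HD. apply NNPP. eauto.
    - assert (Hlow : forall i, ord_lt X i j -> hierarchy i (G i)).
      { intros i Hi. apply HD, NNPP, Hm, Hi. }
      (* The hierarchy [G i] below [i] determines level [i]; collecting these levels for all [i]
         below [j] gives a hierarchy below [j]. *)
      set (g := fun n => ite (ord_lt X (fs n) j /\ n = pr (fs n) (sn n)) (table v S th (fs n) (sn n)) 0).
      assert (Hg : Fun1 g) by (unfold g; exact _).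
      assert (gpr : forall i n, ord_lt X i j -> g (pr i n) = table v S th i n).
      { intros i n Hi. unfold g. rewrite fs_pr, sn_pr. apply ite_true. auto. }
      assert (Hgj : hierarchy j g).
      { intros i Hi n. rewrite gpr by exact Hi. apply table_congr. intros q.
        symmetry. unfold S. apply stageset_congr. intros k Hk m.
        rewrite gpr by (eapply ord_lt_trans; eauto).
        rewrite (Hlow i Hi k Hk). symmetry. apply table_congr. apply Sspec; auto.
        apply Hlow. eapply ord_lt_trans; eauto. }
      (* The index must name a correct value of [g], and its value at 0 is as good as any. *)
      apply Hj, HD. pose proof (Gspec (pr j (pr 0 (g 0))) g Hg) as E. rewrite fs_pr in E.
      rewrite E; auto. unfold hierarchy_at. rewrite !sn_pr, !fs_pr. split; [exact Hgj|]. split; auto.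
      intros n Hno. apply ite_false. tauto. }
  destruct (set_exists (fun z => exists n j, z = pr n j /\ pr j j \in X /\ val v S th j (pr n c0) = 0))
    as (Y & HY).
  exists Y.
  assert (YS : forall j q, S j q <-> exists m i, q = pr m i /\ ord_lt X i j /\ q \in Y).
  { intros j q. unfold S, zg, below. split.
    - intros ((m & i & -> & Hi) & E). exists m, i. split; auto. split; auto. apply HY.
      exists m, i. split; auto. split; [exact (proj1 (proj1 X_wo i j (proj1 Hi)))|].
      unfold loc in E. rewrite fs_pr, sn_pr, (HH j i Hi), table_val in E. rewrite <- E.
      apply val_congr. intros q. symmetry. apply Sspec; auto.
    - intros (m & i & -> & Hi & Hq). split; [eauto|]. apply HY in Hq.
      destruct Hq as (m' & i' & E & _ & Hq). apply pr_inj in E. destruct E as [<- <-].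
      unfold loc. rewrite fs_pr, sn_pr, (HH j i Hi), table_val. rewrite <- Hq.
      apply val_congr. apply Sspec; auto. }
  intros z. rewrite (HY z). apply exists_iff; intros n. apply exists_iff; intros j.
  apply and_iff2; [reflexivity|]. apply and_iff2; [reflexivity|]. split.
  - intros E. destruct (set_exists (S j)) as (Z & HZ). exists Z. split.
    + intros q. rewrite HZ. apply YS.
    + rewrite <- (val_sat v S Z th j) by (auto; intros q; symmetry; apply HZ). exact E.
  - intros (Z & HZ & Hsat). apply (val_sat v S Z th j th_arith); auto.
    intros q. rewrite YS. symmetry. apply HZ.
Qed.

End Recursion.

Lemma transfinite_recursion_holds (A : structure) (HA : aca_model A) th e v :
  pointed_tree_theorem (A := A) -> arithmetical th -> sat A e v (transfinite_recursion th).
Proof.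
  intros HM Hth. unfold transfinite_recursion. rewrite sat_AllSet. intros X. rewrite sat_Imp. intros HX.
  apply sat_IsWellOrder in HX.
  (* One number can code the values of the finitely many variables that occur in [th]. *)
  destruct (assignment_exists (boundN th) e) as (c0 & Hc0).
  destruct (recursion X HX v th c0 Hth HM) as (Y & HY).
  rewrite sat_ExSet. exists Y. rewrite sat_AllNum. intros z. rewrite sat_Iff.
  transitivity (s_mem A z Y); [reflexivity|]. rewrite HY. symmetry.
  rewrite sat_ExNum. apply exists_iff; intros n. rewrite sat_ExNum. apply exists_iff; intros j.
  unfold InField, IsBelow, Lt_in. rewrite !sat_And, sat_ExSet.
  apply and_iff2; [reflexivity|]. apply and_iff2; [reflexivity|].
  apply exists_iff; intros Z. rewrite sat_And. apply and_iff2.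
  - rewrite sat_AllNum. apply forall_iff; intros q. rewrite sat_Iff. apply iff_iff2; [reflexivity|].
    rewrite sat_ExNum. apply exists_iff; intros m. rewrite sat_ExNum. apply exists_iff; intros i.
    rewrite !sat_And. reflexivity.
  - rewrite sat_subst, assign_pr.
    rewrite (sat_ext A th _ (scons n e) _ (scons Z v)); [|intros [|k]; reflexivity|intros [|k]; reflexivity].
    apply sat_agree. intros [|k] Hk; simpl; auto. symmetry. apply Hc0. lia.
Qed.

Lemma subst_closed_ACA0_MPT : subst_closed (add_axiom ACA0 MPT).
Proof.
  intros sg rho p [H | ->]; [left|right; reflexivity].
  destruct H as [p H| |p H].
  - apply ACA0_basic_axiom. destruct H; constructor.
  - apply ACA0_induction.
  - replace (subst sg rho (comprehension p)) with (comprehension (subst (liftN sg) rho p)).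
    + apply ACA0_comprehension, arithmetical_subst, H.
    + unfold comprehension. rewrite <- subst_shiftS. reflexivity.
Qed.

Theorem proposition5p4 : proves_theory (add_axiom ACA0 MPT) ATR0.
Proof.
  intros p [q Hq | th Hth].
  - apply D_Ax. left. exact Hq.
  - apply completeness; [apply subst_closed_ACA0_MPT|]. intros A HT e v.
    assert (HA : aca_model A).
    { split; [intros q e' v' Hq; apply HT; left; exact Hq|exact (inhabits (v 0))]. }
    apply transfinite_recursion_holds; auto. apply sat_MPT. intros e' v'. apply HT. right. reflexivity.
Qed.
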